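(* Let $N\ge 3$, $k\in\{1,\dots,N-1\}$, $a>0$ and $\alpha>0$, and let $Q_\alpha=\mathbb{1}_{L_\alpha}$ be the characteristic function of $$L_\alpha=\{x=(x^{(N-k)},x^{(k)})\in\mathbb{R}^{N-k}\times\mathbb{R}^k:\ |x^{(N-k)}|\le a\,|x^{(k)}|^{-\alpha}\}.$$ Suppose that $\alpha>\frac{1}{N-1}$ if $k=1$, and that $\alpha<N-1$ if $k=N-1$. Define $$\lambda_{N,k,\alpha}=\begin{cases}\dfrac{2(N-1)-\frac{2}{\alpha}}{N-2}, & k=1,\\[2mm] \max\Big\{\dfrac{2(N-k)-\frac{2k}{\alpha}}{N-k-1},\ \dfrac{2k-2\alpha(N-k)}{k-1}\Big\}, & 2\le k\le N-2,\\[2mm] \dfrac{2(N-1)-2\alpha}{N-2}, & k=N-1.\end{cases}$$ Then $(G_k,q,Q_\alpha)$ is an admissible extension triple for every $q\ge 1$ with $q>\lambda_{N,k,\alpha}$.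
   Context: For $F\in L^2(\mathbb{S}^{N-1})$ (with $d\sigma$ the surface measure on the unit sphere $\mathbb{S}^{N-1}\subset\mathbb{R}^N$) set $\check F_\sigma(x)=(2\pi)^{-N/2}\int_{\mathbb{S}^{N-1}}e^{i\omega\cdot x}F(\omega)\,d\sigma(\omega)$. For a closed subgroup $G\subset O(N)$, a function $F$ on $\mathbb{S}^{N-1}$ is $G$-invariant if $F(A\theta)=F(\theta)$ for all $\theta\in\mathbb{S}^{N-1}$, $A\in G$. Given $q\ge1$, a closed subgroup $G\subset O(N)$ and a measurable $Q:\mathbb{R}^N\to\mathbb{C}$, the triple $(G,q,Q)$ is called an admissible extension triple if there is $C>0$ with $\|Q\check F_\sigma\|_{L^q(\mathbb{R}^N)}\le C\|F\|_{L^2(\mathbb{S}^{N-1})}$ for every $G$-invariant $F\in L^2(\mathbb{S}^{N-1})$. Points of $\mathbb{R}^N$ are written $x=(x^{(N-k)},x^{(k)})\in\mathbb{R}^{N-k}\times\mathbb{R}^k$, and $G_k=O(N-k)\times O(k)\subset O(N)$ acts blockwise on these two factors. *)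

(* Defs.v *)
From HB Require Import structures.
From mathcomp Require Import all_boot all_order all_algebra.
From mathcomp Require Import all_classical all_reals all_analysis.
From mathcomp Require Import complex.
Unset Printing Implicit Defensive.
Import Order.TTheory GRing.Theory Num.Theory.
Import numFieldNormedType.Exports.
Local Open Scope classical_set_scope.
Local Open Scope ring_scope.
Local Open Scope complex_scope.

Definition dotv {R : realType} {n : nat} (x y : 'rV[R]_n) : R :=
  \sum_(i < n) x 0 i * y 0 i.
Definition enorm {R : realType} {n : nat} (x : 'rV[R]_n) : R :=
  Num.sqrt (dotv x x).

Definition cmod {R : realType} (z : R[i]) : R := Num.sqrt (complex.Re z ^+ 2 + complex.Im z ^+ 2).

Definition sphere {R : realType} (n : nat) : set 'rV[R]_n :=
  [set x | enorm x = 1].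

Definition borelN {R : realType} (n : nat) : set (set 'rV[R]_n) :=
  smallest (sigma_algebra setT) (@open 'rV[R]_n).

Definition vcons {R : realType} {n : nat} (t : R) (v : 'rV[R]_n) : 'rV[R]_n.+1 :=
  \row_(i < n.+1) (if unlift ord0 i is Some j then v 0 j else t).

(* Lebesgue integral over R^n of a nonnegative (Borel) function, defined as
   the iterated one-dimensional Lebesgue integral (Tonelli). *)
Fixpoint iint {R : realType} (n : nat) : ('rV[R]_n -> \bar R) -> \bar R :=
  match n return ('rV[R]_n -> \bar R) -> \bar R with
  | 0 => fun f => f 0
  | n'.+1 => fun f =>
      (\int[@lebesgue_measure R]_(t in [set: R]) @iint R n' (fun v => f (vcons (t : R) v)))%E
  end.
Arguments iint {R} n f.

(* integral over S^{n-1} w.r.t. the surface measure of a nonnegative function,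
   via polar coordinates:  int_S g dsigma = n * int_{0<|x|<=1} g(x/|x|) dx *)
Definition sint_nn {R : realType} {n : nat} (g : 'rV[R]_n -> \bar R) : \bar R :=
  (n%:R%:E * iint n (fun x => if ((0 < enorm x) && (enorm x <= 1))%R
                              then g (((enorm x)^-1)%R *: x) else 0%E))%E.

Definition sint {R : realType} {n : nat} (g : 'rV[R]_n -> R) : R :=
  fine (sint_nn (fun w => (Num.max (g w) 0)%:E)) -
  fine (sint_nn (fun w => (Num.max (- g w) 0)%:E)).

Definition L2_sphere {R : realType} {n : nat} (F : 'rV[R]_n -> R[i]) : Prop :=
  (forall U : set R, open U ->
     borelN n (sphere n `&` ((fun w => complex.Re (F w)) @^-1` U)) /\
     borelN n (sphere n `&` ((fun w => complex.Im (F w)) @^-1` U))) /\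
  (sint_nn (fun w : 'rV[R]_n => ((cmod (F w)) ^+ 2)%:E) < +oo)%E.

Definition L2norm {R : realType} {n : nat} (F : 'rV[R]_n -> R[i]) : R :=
  Num.sqrt (fine (sint_nn (fun w : 'rV[R]_n => ((cmod (F w)) ^+ 2)%:E))).

Definition ext_op {R : realType} {n : nat} (F : 'rV[R]_n -> R[i]) (x : 'rV[R]_n) : R[i] :=
  let c := (2 * pi) `^ (- (n%:R / 2)) in
  let h := fun w => ((cos (dotv w x) +i* sin (dotv w x)) * F w)%C in
  (c * sint (fun w => complex.Re (h w)))%:C + ((c * sint (fun w => complex.Im (h w)))%:C * 'i)%C.

Definition orthmx {R : realType} {n : nat} (A : 'M[R]_n) : Prop := A *m A^T = 1%:M.

Definition G_invariant {R : realType} {n : nat} (G : set 'M[R]_n)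
  (F : 'rV[R]_n -> R[i]) : Prop :=
  forall (A : 'M[R]_n) (th : 'rV[R]_n), G A -> sphere n th ->
    F (th *m A^T) = F th.

Definition Gk {R : realType} (m k : nat) : set 'M[R]_(m + k) :=
  [set M | exists (A : 'M[R]_m) (B : 'M[R]_k),
      orthmx A /\ orthmx B /\ M = block_mx A 0 0 B].

Definition admissible {R : realType} {n : nat} (G : set 'M[R]_n) (q : R)
  (Q : 'rV[R]_n -> R[i]) : Prop :=
  exists C : R, 0 < C /\
    forall F : 'rV[R]_n -> R[i], L2_sphere F -> G_invariant G F ->
      ((iint n (fun x => ((cmod (Q x * ext_op F x)%C) `^ q)%:E)) `^ q^-1
         <= (C * L2norm F)%:E)%E.

Definition L_alpha {R : realType} (m k : nat) (a alpha : R) : set 'rV[R]_(m + k) :=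
  [set x | rsubmx x = 0 \/
           enorm (lsubmx x) <= a * (enorm (rsubmx x)) `^ (- alpha)].

Definition Q_alpha {R : realType} (m k : nat) (a alpha : R) (x : 'rV[R]_(m + k)) : R[i] :=
  (if `[< L_alpha m k a alpha x >] then 1 else 0)%:C.

Definition lambda_Nk {R : realType} (N k : nat) (alpha : R) : R :=
  if k == 1%N then (2 * (N%:R - 1) - 2 / alpha) / (N%:R - 2)
  else if k == (N - 1)%N then (2 * (N%:R - 1) - 2 * alpha) / (N%:R - 2)
  else Num.max ((2 * (N%:R - k%:R) - 2 * k%:R / alpha) / (N%:R - k%:R - 1))
               ((2 * k%:R - 2 * alpha * (N%:R - k%:R)) / (k%:R - 1)).

(* Main.v *)
(* Averaging a function F invariant under O(k) acting on the last block over that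
   group replaces the plane wave e^{i x.w} by a zonal kernel: up to constants and a
   phase depending on the first block, |F^(x)| is at most the integral over the sphere
   of |F(w)| |J(|x''| |w''|)|, where x'', w'' denote the last blocks and
   J(l) = int_{-pi/2}^{pi/2} cos(l sin u) cos^(k-2) u du (k >= 2; nothing is needed if k = 1).
   J solves l J'' + (k-1) J' + l J = 0, and an energy argument gives
   J(l)^2 <= C (1+l)^{-(k-1)}. By Cauchy-Schwarz,
   |F^(x)| <= C ||F|| (1+|x''|)^{-(k-1)/2}, and exchanging the blocks,
   |F^(x)| <= C ||F|| (1+|x'|)^{-(N-k-1)/2}. The set L_alpha is covered by the horns
   |x''| >= 1, |x'| <= a |x''|^{-alpha} and |x'| >= 1, |x''| <= (a/|x'|)^{1/alpha},
   and the bounded set |x'|, |x''| <= 1. In polar coordinates the q-th powers of the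
   two bounds are integrable over the respective horns when
   k - (k-1)q/2 - alpha (N-k) < 0 and N-k - (N-k-1)q/2 - k/alpha < 0, which
   q > lambda_{N,k,alpha} guarantees. *)

Require Import Defs.
From HB Require Import structures.
From mathcomp Require Import all_boot all_order all_algebra.
From mathcomp Require Import all_classical all_reals all_analysis.
From mathcomp Require Import measurable_realfun complex.
From mathcomp Require Import ring lra zify.
Import Order.TTheory GRing.Theory Num.Theory.
Import numFieldNormedType.Exports.
Local Open Scope classical_set_scope.
Local Open Scope ring_scope.
Set Implicit Arguments.
Unset Strict Implicit.

(** * Borel structure and Lebesgue measure on row vectors *)

(** The proof works without Haar measure on O(k) and without multidimensional changes of variables.
    [iint] is an iterated integral and [sint_nn] integrates over the unit ball a function constant
    along rays, so everything reduces to Tonelli and affine substitutions on the line. Averaging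
    takes the following form. Use coordinates (u, r, s): u is the first block, r the length of the
    last block, and s the tangent of the angle between the last block and the hyperplane orthogonal
    to x''. An invariant function does not vary with s, so integrating the plane wave in s alone
    produces J, and J(0) is the total mass of the weight in s. The kernel is evaluated at |x''|
    |w''|, which gives no decay where |w''| is small. The Jacobian r^(k-1) of the last block makes
    up for this: with rho = |y| <= 1 one has (1+X) r <= 1 + X r/rho. Hence the integral of J^2 over
    the sphere has the full rate (1+X)^(-(k-1)), and Cauchy-Schwarz loses nothing. Since [sint]
    integrates real functions, the complex exponential is split into cosines with phase shifts. *)

Definition rvT (R : realType) (n : nat) := g_sigma_algebraType (@open 'rV[R]_n).

Lemma measurable_coord_rv (R : realType) (n : nat) (i : 'I_n) :
  measurable_fun setT (fun x : rvT R n => (x : 'rV[R]_n) 0 i).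
Proof.
apply: (measurability _ (RGenOpens.measurableE R)) => _ [_ [a [b ->] <-]].
rewrite setTI; apply: sub_sigma_algebra.
apply: open_comp; last exact: interval_open.
by move=> x _; exact: coord_continuous.
Qed.

(** Second countability in the form needed for measurability: the index set is countable, and a ball
    of the sup norm is a finite intersection of coordinate slabs, so measurability into [rvT]
    reduces to the coordinates. *)
Lemma open_rv_bigcup (R : realType) (n : nat) (U : set 'rV[R]_n) : open U ->
  U = \bigcup_(c in [set c : 'rV[rat]_n * nat |
        ball (map_mx (@ratr R) c.1 : 'rV[R]_n) (c.2.+1%:R^-1) `<=` U])
        ball (map_mx (@ratr R) c.1 : 'rV[R]_n) (c.2.+1%:R^-1).
Proof.
move=> oU; apply/seteqP; split=> [x Ux|x [c Hc]]; last exact: Hc.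
have /nbhs_ballP[e /= e0 He] : nbhs x U by exact: open_nbhs_nbhs.
have [N _ HN] := near_infty_natSinv_lt (PosNum (divr_gt0 e0 (ltr0Sn R 1))).
(* Half of e: a ball of this radius centred at a rational point that close to x contains x and stays
   inside the ball of radius e around x. *)
have HNe : N.+1%:R^-1 < e / 2 := HN N (leqnn N).
have Hq (i : 'I_n) : exists q : rat, `|x 0 i - ratr q| < N.+1%:R^-1.
  have [q] := @rat_in_itvoo R (x 0 i - N.+1%:R^-1) (x 0 i + N.+1%:R^-1)
    ltac:(rewrite ltrBlDr -addrA ltrDl; apply: addr_gt0; rewrite invr_gt0 ltr0n//).
  rewrite in_itv/= => /andP[q1 q2]; exists q.
  by rewrite ltr_distlC q1 q2.
pose q i := sval (cid (Hq i)).
have Hqi i : `|x 0 i - ratr (q i)| < N.+1%:R^-1 by rewrite /q; case: cid.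
exists (\row_i q i, N) => /=; last first.
  split; first by rewrite invr_gt0.
  by move=> i j; rewrite !mxE (ord1 i) /ball /= distrC.
move=> y [_ Hy]; apply: He; split=> // i j.
have := Hy i j; rewrite !mxE (ord1 i) /ball /= => Hyj.
rewrite (le_lt_trans (ler_distD (ratr (q j)) _ _))//.
rewrite [e]splitr; apply: ltrD.
  exact: lt_trans (Hqi j) HNe.
exact: lt_trans Hyj HNe.
Qed.

Lemma measurable_fun_rv (d : measure_display) (T : measurableType d)
    (R : realType) (n : nat) (f : T -> rvT R n) :
  (forall i, measurable_fun setT (fun t => (f t : 'rV[R]_n) 0 i)) ->
  measurable_fun setT f.
Proof.
move=> mf.
have mball (x : 'rV[R]_n) e : 0 < e -> measurable (f @^-1` ball x e).
  move=> e0.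
  rewrite (_ : _ @^-1` _ = \bigcap_(i in [set: 'I_n])
      (fun t => (f t : 'rV[R]_n) 0 i) @^-1` ball (x 0 i) e).
    apply: fin_bigcap_measurable => [|i _]; first exact: finite_finset.
    rewrite -[X in measurable X]setTI; apply: mf => //.
    by apply: open_measurable; exact: ball_open.
  apply/seteqP; split=> [t /= [_ H] i _ /=|t H]; first exact: H.
  by split=> // i j; rewrite (ord1 i); exact: H.
apply: (@measurability _ _ T (rvT R n) setT f (@open 'rV[R]_n)) => // _ [U oU <-].
rewrite setTI (open_rv_bigcup oU) preimage_bigcup.
rewrite bigcup_mkcond; apply: countable_bigcupT_measurable => [|c].
  exact: countableP.
by case: ifP => // _; apply: mball; rewrite invr_gt0.
Qed.

Lemma measurable_dotv (d : measure_display) (T : measurableType d)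
    (R : realType) (n : nat) (f g : T -> rvT R n) :
  measurable_fun setT f -> measurable_fun setT g ->
  measurable_fun setT (fun t => dotv (f t) (g t)).
Proof.
move=> mf mg; apply: measurable_sum => i; apply: measurable_funM.
  exact: (measurableT_comp (measurable_coord_rv i) mf).
exact: (measurableT_comp (measurable_coord_rv i) mg).
Qed.

Lemma measurable_sqrtr (d : measure_display) (T : measurableType d)
    (R : realType) (f : T -> R) :
  measurable_fun setT f -> measurable_fun setT (fun t => Num.sqrt (f t)).
Proof.
move=> mf; apply: (@measurableT_comp _ _ _ _ _ _ (@Num.sqrt R)) => //.
by apply: continuous_measurable_fun; exact: sqrt_continuous.
Qed.

Lemma measurable_enorm (d : measure_display) (T : measurableType d)
    (R : realType) (n : nat) (f : T -> rvT R n) :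
  measurable_fun setT f -> measurable_fun setT (fun t => enorm (f t)).
Proof. by move=> mf; apply: measurable_sqrtr; exact: measurable_dotv. Qed.

Lemma measurable_scale_rv (d : measure_display) (T : measurableType d)
    (R : realType) (n : nat) (c : T -> R) (f : T -> rvT R n) :
  measurable_fun setT c -> measurable_fun setT f ->
  measurable_fun setT (fun t => (c t *: (f t : 'rV[R]_n)) : rvT R n).
Proof.
move=> mc mf; apply: measurable_fun_rv => i; under eq_fun do rewrite mxE.
by apply: measurable_funM => //; exact: (measurableT_comp (measurable_coord_rv i) mf).
Qed.

Lemma measurable_vcons (d : measure_display) (T : measurableType d)
    (R : realType) (n : nat) (c : T -> R) (f : T -> rvT R n) :
  measurable_fun setT c -> measurable_fun setT f ->
  measurable_fun setT (fun t => vcons (c t) (f t) : rvT R n.+1).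
Proof.
move=> mc mf; apply: measurable_fun_rv => i; under eq_fun do rewrite mxE.
case: unliftP => [j|] _ //.
exact: (measurableT_comp (measurable_coord_rv j) mf).
Qed.

Lemma measurable_row_mx (d : measure_display) (T : measurableType d)
    (R : realType) (m k : nat) (f : T -> rvT R m) (g : T -> rvT R k) :
  measurable_fun setT f -> measurable_fun setT g ->
  measurable_fun setT (fun t => row_mx (f t) (g t) : rvT R (m + k)).
Proof.
move=> mf mg; apply: measurable_fun_rv => i; under eq_fun do rewrite mxE.
case: (fintype.split i) => j; first exact: (measurableT_comp (measurable_coord_rv j) mf).
exact: (measurableT_comp (measurable_coord_rv j) mg).
Qed.

Lemma measurable_lsubmx (d : measure_display) (T : measurableType d)
    (R : realType) (m k : nat) (f : T -> rvT R (m + k)) :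
  measurable_fun setT f ->
  measurable_fun setT (fun t => lsubmx (f t : 'rV[R]_(m + k)) : rvT R m).
Proof.
move=> mf; apply: measurable_fun_rv => i; under eq_fun do rewrite mxE.
exact: (measurableT_comp (measurable_coord_rv _) mf).
Qed.

Lemma measurable_rsubmx (d : measure_display) (T : measurableType d)
    (R : realType) (m k : nat) (f : T -> rvT R (m + k)) :
  measurable_fun setT f ->
  measurable_fun setT (fun t => rsubmx (f t : 'rV[R]_(m + k)) : rvT R k).
Proof.
move=> mf; apply: measurable_fun_rv => i; under eq_fun do rewrite mxE.
exact: (measurableT_comp (measurable_coord_rv _) mf).
Qed.

Definition vtail (R : realType) (n : nat) (v : 'rV[R]_n.+1) : 'rV[R]_n :=
  \row_i v 0 (lift ord0 i).

Lemma measurable_vtail (R : realType) (n : nat) :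
  measurable_fun setT (fun v : rvT R n.+1 => vtail v : rvT R n).
Proof.
apply: measurable_fun_rv => i; under eq_fun do rewrite mxE.
exact: measurable_coord_rv.
Qed.

Lemma vcons_eta (R : realType) (n : nat) (v : 'rV[R]_n.+1) :
  vcons (v 0 ord0) (vtail v) = v.
Proof.
apply/rowP => i; rewrite mxE; case: unliftP => [j ->|->] //.
by rewrite mxE.
Qed.

Lemma vtail_vcons (R : realType) (n : nat) (t : R) (v : 'rV[R]_n) :
  vtail (vcons t v) = v.
Proof. by apply/rowP => i; rewrite !mxE liftK. Qed.

Lemma vcons_ord0 (R : realType) (n : nat) (t : R) (v : 'rV[R]_n) :
  vcons t v 0 ord0 = t.
Proof. by rewrite mxE unlift_none. Qed.

(** The preimages under [g] of an exhaustion of T1 exhaust T2, and they keep their measures because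
    [g \o f] is the identity. *)
Lemma sigma_finite_bij_pushforward (d1 d2 : measure_display)
    (T1 : measurableType d1) (T2 : measurableType d2) (R : realType)
    (mu : set T1 -> \bar R) (f : T1 -> T2) (g : T2 -> T1) :
  sigma_finite setT mu ->
  measurable_fun setT f -> measurable_fun setT g -> cancel f g ->
  sigma_finite setT (pushforward mu f).
Proof.
move=> [F UF mF] mf mg fg.
exists (fun i => g @^-1` F i).
  by rewrite -preimage_bigcup -UF preimage_setT.
move=> i; have [mFi fFi] := mF i; split.
  by rewrite -[X in measurable X]setTI; exact: mg.
rewrite /pushforward -comp_preimage (_ : _ \o _ = id) ?preimage_id//.
by apply/funext => x /=; rewrite fg.
Qed.

Lemma sigma_finite_prod (d1 d2 : measure_display)
    (T1 : measurableType d1) (T2 : measurableType d2) (R : realType)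
    (m1 : {sigma_finite_measure set T1 -> \bar R})
    (m2 : {sigma_finite_measure set T2 -> \bar R}) :
  sigma_finite setT (m1 \x m2)%E.
Proof.
have [F UF mF] := @sigma_finiteT _ _ _ m1.
have [G UG mG] := @sigma_finiteT _ _ _ m2.
pose H n : set (T1 * T2) :=
  if @unpickle (nat * nat)%type n is Some ij then F ij.1 `*` G ij.2 else set0.
exists H.
  apply/seteqP; split=> // -[x y] _.
  have : setT x by []. rewrite UF => -[i _ Fi].
  have : setT y by []. rewrite UG => -[j _ Gj].
  by exists (pickle (i, j)) => //; rewrite /H pickleK.
move=> n; rewrite /H; case: unpickle => [[i j]|]; last by rewrite measure0.
have [[mFi fFi] [mGj fGj]] := (mF i, mG j).
split; first exact: measurableX.
by rewrite product_measure1E// lte_mul_pinfty// ge0_fin_numE.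
Qed.

(* [sfm_fun] is a copy of [mu] on which a proof of sigma-finiteness can be declared as
   an instance: neither product measures nor pushforwards have one in the library. *)
Definition sfm_fun (d : measure_display) (T : measurableType d) (R : realType)
    (mu : {measure set T -> \bar R}) (h : sigma_finite setT mu) : set T -> \bar R := mu.

HB.instance Definition _ (d : measure_display) (T : measurableType d) (R : realType)
    (mu : {measure set T -> \bar R}) (h : sigma_finite setT mu) :=
  Measure.copy (sfm_fun h) mu.

HB.instance Definition _ (d : measure_display) (T : measurableType d) (R : realType)
    (mu : {measure set T -> \bar R}) (h : sigma_finite setT mu) :=
  Measure_isSigmaFinite.Build _ _ _ (sfm_fun h) h.

Definition sfmeasure (d : measure_display) (T : measurableType d) (R : realType)
    (mu : {measure set T -> \bar R}) (h : sigma_finite setT mu) :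
    {sigma_finite_measure set T -> \bar R} := sfm_fun h.

Definition sfprod (d1 d2 : measure_display)
    (T1 : measurableType d1) (T2 : measurableType d2) (R : realType)
    (m1 : {sigma_finite_measure set T1 -> \bar R})
    (m2 : {sigma_finite_measure set T2 -> \bar R}) :
    {sigma_finite_measure set (T1 * T2)%type -> \bar R} :=
  sfmeasure (sigma_finite_prod m1 m2).

Definition pushm (d1 d2 : measure_display)
    (T1 : measurableType d1) (T2 : measurableType d2) (R : realType)
    (mu : {measure set T1 -> \bar R}) (f : T1 -> T2) (mf : measurable_fun setT f) :
    {measure set T2 -> \bar R} :=
  measure_function_pushforward__canonical__measure_function_Measure mu mf.

Lemma ge0_integral_pushm (d1 d2 : measure_display)
    (T1 : measurableType d1) (T2 : measurableType d2) (R : realType)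
    (mu : {measure set T1 -> \bar R}) (f : T1 -> T2) (mf : measurable_fun setT f)
    (g : T2 -> \bar R) :
  measurable_fun setT g -> (forall y, (0 <= g y)%E) ->
  (\int[pushm mu mf]_y g y = \int[mu]_x g (f x))%E.
Proof.
by move=> mg g0; rewrite (ge0_integral_pushforward mf)// preimage_setT.
Qed.

Definition leb (R : realType) :
  {sigma_finite_measure set (measurableTypeR R) -> \bar R} := @lebesgue_measure R.

(** An iterated integral is not by definition an integral against a measure. By induction, the
    measure is the image under [vcons] of the product of Lebesgue measure with the measure one
    dimension lower; Tonelli identifies the two integrals. This opens the way to Fubini,
    integrability and Cauchy-Schwarz. *)
Lemma iint_measure (R : realType) (n : nat) :
  exists mu : {sigma_finite_measure set rvT R n -> \bar R},
    forall f : rvT R n -> \bar R, measurable_fun setT f ->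
      (forall x, (0 <= f x)%E) -> (iint n f = \int[mu]_x f x)%E.
Proof.
elim: n => [|n [mu IH]].
  exists (@dirac _ (rvT R 0) (0 : 'rV[R]_0) R) => f mf f0.
  by rewrite integral_dirac//= diracT mul1e.
pose vc (z : measurableTypeR R * rvT R n) : rvT R n.+1 := vcons z.1 z.2.
pose uvc (v : rvT R n.+1) : measurableTypeR R * rvT R n :=
  ((v : 'rV[R]_n.+1) 0 ord0, vtail v).
have mvc : measurable_fun setT vc by exact: measurable_vcons.
have muvc : measurable_fun setT uvc.
  apply: measurable_fun_pair; first exact: measurable_coord_rv.
  exact: measurable_vtail.
have vcK : cancel vc uvc.
  by move=> [t v]; rewrite /uvc /vc /= vtail_vcons vcons_ord0.
pose nu := pushm (sfprod (leb R) mu) mvc.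
exists (sfmeasure (mu := nu) (sigma_finite_bij_pushforward
  (sigma_finiteT (sfprod (leb R) mu)) mvc muvc vcK)) => f mf f0.
rewrite [RHS](_ : _ = \int[nu]_x f x)%E// ge0_integral_pushm//.
rewrite fubini_tonelli1//; last exact: measurableT_comp.
apply: eq_integral => t _; apply: (IH (fun v => f (vcons t v))) => //.
have mvt : measurable_fun setT (fun v : rvT R n => vcons t v : rvT R n.+1).
  exact: measurable_vcons.
exact: (measurableT_comp mf mvt).
Qed.

(** Lebesgue measure on R^n, picked by choice; apart from sigma-finiteness, its properties all come
    from [iintE]. *)
Definition mun (R : realType) (n : nat) : {sigma_finite_measure set rvT R n -> \bar R} :=
  sval (cid (iint_measure R n)).

Lemma iintE (R : realType) (n : nat) (f : rvT R n -> \bar R) :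
  measurable_fun setT f -> (forall x, (0 <= f x)%E) ->
  (iint n f = \int[mun R n]_x f x)%E.
Proof. by move=> mf f0; rewrite /mun; case: cid => mu /= ->. Qed.

Lemma row_mx_vcons (R : realType) (m k : nat) (t : R) (u : 'rV[R]_m) (v : 'rV[R]_k) :
  row_mx (vcons t u) v = vcons t (row_mx u v) :> 'rV[R]_(m.+1 + k).
Proof.
apply/rowP => i; rewrite [RHS]mxE; case: unliftP => [j ->|->].
  have [l lE|l lE] := fintype.splitP (j : 'I_(m + k)).
    have -> : j = lshift k l by exact: val_inj.
    rewrite row_mxEl (_ : lift _ _ = lshift k (lift ord0 l)); last exact: val_inj.
    by rewrite row_mxEl mxE liftK.
  have -> : j = rshift m l by exact: val_inj.
  rewrite row_mxEr (_ : lift _ _ = rshift m.+1 l); last exact: val_inj.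
  by rewrite row_mxEr.
rewrite (_ : ord0 = lshift k (ord0 : 'I_m.+1)); last exact: val_inj.
by rewrite row_mxEl mxE unlift_none.
Qed.

Lemma iint_add (R : realType) (m k : nat) (f : 'rV[R]_(m + k) -> \bar R) :
  iint (m + k) f = iint m (fun u => iint k (fun v => f (row_mx u v))).
Proof.
elim: m f => [|m IH] f /=.
  congr iint; apply/funext => v; congr f; apply/rowP => i.
  by rewrite -(row_mxEr (0 : 'rV[R]_0) v); congr (row_mx _ _ _ _); exact: ord_inj.
apply: eq_integral => t _; rewrite IH; congr iint; apply/funext => u.
by congr iint; apply/funext => v; rewrite row_mx_vcons.
Qed.

(** * Measurability of composite integrands *)

Lemma measurable_fst_comp (d d1 d2 : measure_display) (T : measurableType d)
    (T1 : measurableType d1) (T2 : measurableType d2) (f : T -> T1 * T2) :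
  measurable_fun setT f -> measurable_fun setT (fun t => (f t).1).
Proof. by move=> mf; exact: (measurableT_comp measurable_fst mf). Qed.

Lemma measurable_snd_comp (d d1 d2 : measure_display) (T : measurableType d)
    (T1 : measurableType d1) (T2 : measurableType d2) (f : T -> T1 * T2) :
  measurable_fun setT f -> measurable_fun setT (fun t => (f t).2).
Proof. by move=> mf; exact: (measurableT_comp measurable_snd mf). Qed.

Lemma measurable_pair_comp (d d1 d2 d3 : measure_display) (T : measurableType d)
    (T1 : measurableType d1) (T2 : measurableType d2) (T3 : measurableType d3)
    (h : T1 * T2 -> T3) (f : T -> T1) (g : T -> T2) :
  measurable_fun setT h -> measurable_fun setT f -> measurable_fun setT g ->
  measurable_fun setT (fun t => h (f t, g t)).
Proof.
move=> mh mf mg; exact: (measurableT_comp mh (measurable_fun_pair mf mg)).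
Qed.

Lemma measurable_mul (d : measure_display) (T : measurableType d) (R : realType)
    (f g : T -> R) : measurable_fun setT f -> measurable_fun setT g ->
  measurable_fun setT (fun t => f t * g t).
Proof. exact: measurable_funM. Qed.

Lemma measurable_add (d : measure_display) (T : measurableType d) (R : realType)
    (f g : T -> R) : measurable_fun setT f -> measurable_fun setT g ->
  measurable_fun setT (fun t => f t + g t).
Proof. exact: measurable_funD. Qed.

Lemma measurable_opp (d : measure_display) (T : measurableType d) (R : realType)
    (f : T -> R) : measurable_fun setT f -> measurable_fun setT (fun t => - f t).
Proof. exact: measurableT_comp. Qed.

(** Inversion is discontinuous at 0, but on nonnegative values it is the power of exponent -1, also
    at 0, where both take the value 0. *)
Lemma measurable_inv (d : measure_display) (T : measurableType d) (R : realType)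
    (f : T -> R) : (forall t, 0 <= f t) ->
  measurable_fun setT f -> measurable_fun setT (fun t => (f t)^-1).
Proof.
move=> f0 mf; rewrite (_ : (fun t => (f t)^-1) = (fun t => f t `^ (-1))).
  exact: measurableT_comp (measurable_powR _) mf.
by apply/funext => t; rewrite powR_inv1.
Qed.

Lemma measurable_exprn (d : measure_display) (T : measurableType d) (R : realType)
    (f : T -> R) n : measurable_fun setT f -> measurable_fun setT (fun t => f t ^+ n).
Proof. exact: measurable_funX. Qed.

Lemma measurable_pos_indic (d : measure_display) (T : measurableType d) (R : realType)
    (f : T -> R) : measurable_fun setT f ->
  measurable_fun setT (fun t => (0 < f t)%R%:R : R).
Proof.
move=> mf; rewrite [X in measurable_fun _ X](_ : _ = (fun t => if 0 < f t then 1 else 0)).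
  apply: measurable_fun_ifT => //; first exact: measurable_fun_ltr.
by apply/funext => t; case: ifP.
Qed.

Lemma measurable_EFin_comp (d : measure_display) (T : measurableType d) (R : realType)
    (f : T -> R) : measurable_fun setT f -> measurable_fun setT (fun t => (f t)%:E).
Proof. by move=> mf; exact/measurable_EFinP. Qed.

Lemma measurable_emul (d : measure_display) (T : measurableType d) (R : realType)
    (f g : T -> \bar R) : measurable_fun setT f -> measurable_fun setT g ->
  measurable_fun setT (fun t => (f t * g t)%E).
Proof. exact: emeasurable_funM. Qed.

Lemma measurable_continuous_comp (d : measure_display) (T : measurableType d)
    (R : realType) (h : R -> R) (f : T -> R) : continuous h ->
  measurable_fun setT f -> measurable_fun setT (fun t => h (f t)).
Proof.
move=> ch mf; apply: (@measurableT_comp _ _ _ _ _ _ h) => //.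
exact: continuous_measurable_fun.
Qed.

(** Structural descent on the integrand. Inverses leave the nonnegativity of the inverted function
    as a goal, hence the recurrent [mfun => z]. *)
Ltac mfun := repeat first
  [ exact: measurable_cst | exact: measurable_id | exact: measurable_fst
  | exact: measurable_snd | assumption
  | apply: measurable_EFin_comp | apply: measurable_emul
  | apply: measurable_mul | apply: measurable_add | apply: measurable_opp
  | apply: measurable_exprn | apply: measurable_sqrtr | apply: measurable_inv
  | apply: measurable_pos_indic
  | apply: measurable_enorm | apply: measurable_dotv | apply: measurable_vcons
  | apply: measurable_row_mx | apply: measurable_scale_rv
  | apply: measurable_lsubmx | apply: measurable_rsubmx
  | apply: measurable_fst_comp | apply: measurable_snd_comp
  | apply: measurable_fun_pair ].

(** * Integrals over the line and the plane *)

(** The image of Lebesgue measure under t -> c t + b, multiplied by |c|, agrees with Lebesgue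
    measure on half-open intervals, hence everywhere. The sign of c matters because a negative c
    exchanges the open and the closed end. *)
Lemma ge0_integral_affine (R : realType) (c b : R) (f : measurableTypeR R -> \bar R) :
  c != 0 -> measurable_fun setT f -> (forall x, (0 <= f x)%E) ->
  (\int[leb R]_t f (c * t + b)%R = (`|c|^-1)%:E * \int[leb R]_t f t)%E.
Proof.
move=> c0 mf f0.
pose h (t : measurableTypeR R) : measurableTypeR R := c * t + b.
have mh : measurable_fun setT h by apply: measurable_add; mfun.
have cp : 0 < `|c| by rewrite normr_gt0.
pose nu : {measure set (measurableTypeR R) -> \bar R} :=
  mscale (NngNum (ltW cp)) (pushm (leb R) mh).
have E : forall A, measurable A -> leb R A = nu A.
  apply: lebesgue_measure_unique => _ [[x y] _ <-] /=.
  rewrite /nu /mscale /= /pushforward.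
  have [yx|xy] := leP y x.
    rewrite set_itv_ge ?bnd_simp -?leNgt//.
    by rewrite preimage_set0 !measure0 mule0.
  have [cn|cpos] := ltP c 0.
    rewrite (_ : h @^-1` _ = `[(y - b) / c, (x - b) / c[%classic).
      rewrite !lebesgue_measure_itv/= !lte_fin xy ifT; last first.
        by rewrite ltr_nM2r ?invr_lt0// ltrD2r.
      rewrite -!EFinB -EFinM ltr0_norm//; congr EFin.
      by field; rewrite c0.
    apply/seteqP; split=> t /=; rewrite !in_itv/= /h.
      move=> /andP[H1 H2]; rewrite ler_ndivrMr// ltr_ndivlMr//.
      by rewrite lerBlDr ltrBlDr mulrC [t * c]mulrC H1 H2 || (apply/andP; split; lra).
    by rewrite ler_ndivrMr// ltr_ndivlMr// => /andP[H1 H2]; apply/andP; split; lra.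
  have {}cpos : 0 < c by rewrite lt_neqAle eq_sym c0.
  rewrite (_ : h @^-1` _ = `](x - b) / c, (y - b) / c]%classic).
    rewrite !lebesgue_measure_itv/= !lte_fin xy ifT; last first.
      by rewrite ltr_pM2r ?invr_gt0// ltrD2r.
    rewrite -!EFinB -EFinM gtr0_norm//; congr EFin.
    by field; rewrite c0.
  apply/seteqP; split=> t /=; rewrite !in_itv/= /h ltr_pdivrMr// ler_pdivlMr//.
    by move=> /andP[H1 H2]; apply/andP; split; lra.
  by move=> /andP[H1 H2]; apply/andP; split; lra.
have -> : (\int[leb R]_t f t = \int[nu]_t f t)%E.
  by apply: eq_measure_integral => A mA _; exact: E.
rewrite ge0_integral_mscale//= ge0_integral_pushm// muleA -EFinM.
by rewrite mulVf ?mul1e// gt_eqF.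
Qed.

Lemma ge0_integral_scale (R : realType) (c : R) (f : measurableTypeR R -> \bar R) :
  0 < c -> measurable_fun setT f -> (forall x, (0 <= f x)%E) ->
  (\int[leb R]_t f t = c%:E * \int[leb R]_t f (c * t)%R)%E.
Proof.
move=> c0 mf f0.
under [in RHS]eq_integral do rewrite -[(c * _)%R]addr0.
rewrite ge0_integral_affine ?gt_eqF// gtr0_norm// muleA -EFinM mulfV ?gt_eqF//.
by rewrite mul1e.
Qed.

Lemma ge0_integral_oppr (R : realType) (f : measurableTypeR R -> \bar R) :
  measurable_fun setT f -> (forall x, (0 <= f x)%E) ->
  (\int[leb R]_t f (- t)%R = \int[leb R]_t f t)%E.
Proof.
move=> mf f0.
under eq_integral do rewrite -mulN1r -[(-1 * _)%R]addr0.
by rewrite ge0_integral_affine// ?oppr_eq0// normrN1 invr1 mul1e.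
Qed.

(* Substituting [u = a t + b s] for [s], then [t = b s' + a u] for [t], turns
   [t^2 + s^2] into [u^2 + s'^2] when [a^2 + b^2 = 1]. *)
Lemma integral_rotation (R : realType) (a b : R)
    (F : measurableTypeR R * measurableTypeR R -> \bar R) :
  0 <= b -> measurable_fun setT F -> (forall x, (0 <= F x)%E) ->
  (\int[leb R]_t \int[leb R]_s F (t ^+ 2 + s ^+ 2, a * t + b * s)%R =
   \int[leb R]_t \int[leb R]_s F (t ^+ 2 + s ^+ 2, Num.sqrt (a ^+ 2 + b ^+ 2) * t)%R)%E.
Proof.
move=> b0 mF F0.
(* Here the square root is |a|, and a negative a is absorbed by the reflection of t. *)
have [b00|bn0] := eqVneq b 0.
  rewrite b00 expr0n addr0 sqrtr_sqr.
  under eq_integral do under eq_integral do rewrite mul0r addr0.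
  have [a0|a0] := leP 0 a; first by rewrite ger0_norm.
  rewrite ltr0_norm//.
  pose G (t : measurableTypeR R) : \bar R :=
    (\int[leb R]_s F (t ^+ 2 + s ^+ 2, - a * t)%R)%E.
  have mG : measurable_fun setT G.
    pose f (z : measurableTypeR R * measurableTypeR R) : \bar R :=
      F (z.1 ^+ 2 + z.2 ^+ 2, - a * z.1)%R.
    have mf : measurable_fun setT f by apply: measurable_pair_comp => //; mfun.
    have f0 z : (0 <= f z)%E by exact: F0.
    exact: (measurable_fun_fubini_tonelli_F (m2 := leb R) f mf f0).
  rewrite [RHS](_ : _ = \int[leb R]_t G t)%E// -ge0_integral_oppr//; last first.
    by move=> t; apply: integral_ge0.
  apply: eq_integral => t _; apply: eq_integral => s _.
  by rewrite sqrrN mulrNN.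
set g := Num.sqrt _.
have bp : 0 < b by rewrite lt_neqAle eq_sym bn0.
have g2 : g ^+ 2 = a ^+ 2 + b ^+ 2 by rewrite sqr_sqrtr// addr_ge0 ?sqr_ge0.
have gp : 0 < g by rewrite sqrtr_gt0 ltr_wpDl ?sqr_ge0// exprn_gt0.
have gn0 : g != 0 by rewrite gt_eqF.
(* Without the normalization a^2 + b^2 = 1 the substitutions are s = (g u - a t)/b, with Jacobian
   g/b, and then t = (b s + a u)/g, with Jacobian b/g; the two factors cancel. *)
transitivity (\int[leb R]_t ((g / b)%:E *
    \int[leb R]_u F (t ^+ 2 + ((g * u - a * t) / b) ^+ 2, g * u)%R))%E.
  apply: eq_integral => t _.
  have := @ge0_integral_affine R (g / b) (- (a * t / b))
    (fun s => F (t ^+ 2 + s ^+ 2, a * t + b * s)%R).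
  rewrite mulf_neq0 ?invr_eq0// => /(_ isT) H.
  rewrite [X in ((g / b)%:E * X)%E](_ : _ = (\int[leb R]_u
     F (t ^+ 2 + (g / b * u + - (a * t / b)) ^+ 2, a * t + b * (g / b * u + - (a * t / b)))%R)%E).
    rewrite H//; last by apply: measurable_pair_comp => //; mfun.
    by rewrite muleA -EFinM gtr0_norm ?divr_gt0// mulfV ?mul1e// mulf_neq0 ?invr_eq0.
  by apply: eq_integral => u _; congr (F (_, _)); field.
have gb0 : 0 <= g / b by rewrite divr_ge0// ltW.
under eq_integral => t _.
  rewrite -ge0_integralZl//; last by apply: measurable_pair_comp => //; mfun.
  over.
rewrite (fubini_tonelli (fun z : measurableTypeR R * measurableTypeR R => ((g / b)%:E * F (z.1 ^+ 2 + ((g * z.2 - a * z.1) / b) ^+ 2, g * z.2)%R)%E))//; last 2 first.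
- by apply: measurable_emul; [mfun | apply: measurable_pair_comp => //; mfun].
- by move=> z; apply: mule_ge0 => //; rewrite lee_fin divr_ge0// ltW.
apply: eq_integral => u _ /=.
rewrite ge0_integralZl//; last by apply: measurable_pair_comp => //; mfun.
have := @ge0_integral_affine R (b / g) (a * u / g)
    (fun t => F (t ^+ 2 + ((g * u - a * t) / b) ^+ 2, g * u)%R).
rewrite mulf_neq0 ?invr_eq0// => /(_ isT) H.
rewrite gtr0_norm ?divr_gt0// invf_div in H.
rewrite -H//; last by apply: measurable_pair_comp => //; mfun.
apply: eq_integral => s _; congr (F (_, _)).
have -> : (g * u - a * (b / g * s + a * u / g)) / b = (b * u - a * s) / g.
  have -> : g * u = g ^+ 2 * u / g by field.
  by rewrite g2; field; rewrite bn0 gn0.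
have -> : b / g * s + a * u / g = (b * s + a * u) / g by field.
rewrite !exprMn exprVn g2 -mulrDl; apply: (canLR (mulfK _)); last by ring.
by rewrite -g2 expf_neq0.
Qed.

Lemma sin_atan (R : realType) (s : R) : sin (atan s) = s / Num.sqrt (1 + s ^+ 2).
Proof.
have c0 : cos (atan s) != 0.
  by apply/lt0r_neq0/cos_gt0_pihalf; rewrite atan_gtNpi2 atan_ltpi2.
by rewrite -cos_atan -[X in X * _](atanK s) /tan mulrVK// unitfE.
Qed.

Lemma sqr1D_gt0 (R : realType) (s : R) : 0 < 1 + s ^+ 2.
Proof. by rewrite ltr_pwDl// sqr_ge0. Qed.

(** Folding the negative half-line onto the positive one prepares the use of the fundamental theorem
    of calculus on [0, +oo[. *)
Lemma ge0_integral_line (R : realType) (f : measurableTypeR R -> \bar R) :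
  measurable_fun setT f -> (forall t, (0 <= f t)%E) ->
  (\int[leb R]_t f t = \int[leb R]_(t in `[0%R, +oo[) f t +
                       \int[leb R]_(t in `[0%R, +oo[) f (- t)%R)%E.
Proof.
move=> mf f0.
have mfn : measurable_fun setT (fun t : measurableTypeR R => f (- t)).
  by apply: (measurableT_comp mf); mfun.
rewrite (_ : [set: measurableTypeR R] = `[0, +oo[%classic `|` `]-oo, 0[%classic :> set R); last first.
  apply/seteqP; split => // t _ /=; rewrite !in_itv/= andbT.
  by case: (leP 0 t) => _; [left|right].
rewrite ge0_integral_setU//=; last 2 first.
- exact: measurable_funTS.
- apply/disj_setPRL => t /=; rewrite !in_itv/= => t0.
  by move: t0; rewrite andbT; case: ltP.
congr (_ + _)%E.
rewrite -[RHS]integral_itv_obnd_cbnd; last exact: measurable_funTS.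
rewrite [LHS]integral_mkcond [RHS]integral_mkcond -[LHS]ge0_integral_oppr.
- apply: eq_integral => t _; rewrite !patchE.
  have -> : (- t \in `]-oo, 0[%classic) = (t \in `]0, +oo[%classic).
    by rewrite !mem_setE /= !in_itv/= andbT oppr_lt0.
  by [].
- by apply/measurable_restrict => //; exact: measurable_funTS.
- by move=> t; rewrite patchE; case: ifP.
Qed.

(** The substitution u = atan s: G o atan is a primitive of the integrand on the whole line, with
    limits G(pi/2) and G(-pi/2) at the two ends. *)
Lemma ge0_integral_atan (R : realType) (g G : R -> R) :
  continuous g -> (forall u : R, 0 <= g u) -> (forall u : R, is_derive u 1 G (g u)) ->
  (\int[leb R]_s (g (atan s) / (1 + s ^+ 2))%:E = (G (pi / 2) - G (- (pi / 2)))%:E)%E.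
Proof.
move=> cg g0 dG.
pose h (s : R) : R := g (atan s) / (1 + s ^+ 2).
have ch : continuous h.
  move=> s; apply: cvgM.
    by apply: continuous_comp; [exact: continuous_atan|exact: cg].
  apply: cvgV; first by rewrite gt_eqF// sqr1D_gt0.
  by apply: cvgD; [exact: cvg_cst|exact: exprn_continuous].
have h0 s : 0 <= h s by rewrite divr_ge0// ltW// sqr1D_gt0.
have cG : continuous G by move=> u; apply/differentiable_continuous/derivable1_diffP; exact: ex_derive.
have dH (s : R) : is_derive s 1 (G \o atan) (h s) by apply: is_derive1_comp.
have dHn (s : R) : is_derive s 1 (fun s => - G (- atan s)) (h (- s)).
  have dGn : is_derive s 1 (G \o (fun s => - atan s)) (g (- atan s) * (- (1 + s ^+ 2)^-1)).
    by apply: is_derive1_comp.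
  have -> : h (- s) = - (g (- atan s) * (- (1 + s ^+ 2)^-1)).
    by rewrite /h atanN sqrrN mulrN opprK.
  exact: is_deriveN.
have half (f F : R -> R) l : continuous f -> (forall s, 0 <= f s) ->
    (forall s : R, is_derive s 1 F (f s)) -> F x @[x --> +oo] --> l ->
    (\int[leb R]_(s in `[0%R, +oo[) (f s)%:E = l%:E - (F 0)%:E)%E.
  move=> cf f0 dF Fl; apply: ge0_continuous_FTC2y => //.
  - exact: continuous_subspaceT.
  - apply: cvg_at_right_filter.
    by apply/differentiable_continuous/derivable1_diffP; case: (dF 0).
  - by move=> s _; rewrite derive1E; case: (dF s).
have cvgG : (G \o atan) x @[x --> +oo] --> G (pi / 2).
  exact: continuous_cvg (cG _) (@cvgy_atan R).
have cvgGn : - G (- atan x) @[x --> +oo] --> - G (- (pi / 2)).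
  have cGn : {for pi / 2, continuous (fun u => G (- u))}.
    by apply: continuous_comp; [exact: opp_continuous|exact: cG].
  by apply: cvgN; exact: continuous_cvg cGn (@cvgy_atan R).
rewrite ge0_integral_line//; last first.
  apply: measurable_EFin_comp; apply: continuous_measurable_fun; exact: ch.
rewrite (half _ _ _ ch h0 dH cvgG).
rewrite (half (fun s => h (- s)) _ _ _ _ dHn cvgGn)//; last first.
  by move=> s; apply: continuous_comp; [exact: opp_continuous|exact: ch].
rewrite /= atan0 oppr0 -!EFinB -EFinD; congr EFin; lra.
Qed.

Lemma integral_inv_sqr1D (R : realType) :
  (\int[leb R]_s ((1 + s ^+ 2)^-1)%:E = (pi : R)%:E)%E.
Proof.
transitivity (\int[leb R]_s ((cst 1 : R -> R) (atan s) / (1 + s ^+ 2))%:E)%E.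
  by apply: eq_integral => s _ /=; rewrite mul1r.
rewrite (@ge0_integral_atan _ _ id)//=.
- by congr EFin; lra.
- by move=> u; exact: cvg_cst.
Qed.

Lemma integrable_atan (R : realType) (g : R -> R) (M : R) :
  continuous g -> (forall u, `|g u| <= M) ->
  (leb R).-integrable setT (EFin \o (fun s : R => g (atan s) / (1 + s ^+ 2))).
Proof.
move=> cg gM.
have mi : measurable_fun setT (fun s : measurableTypeR R => (1 + s ^+ 2)^-1 : R).
  by mfun => s; rewrite ltW// sqr1D_gt0.
have i1 : (leb R).-integrable setT (EFin \o (fun s : R => (1 + s ^+ 2)^-1)).
  apply/integrableP; split; first exact: measurable_EFin_comp.
  under eq_integral => s _ do
    rewrite /= ger0_norm ?invr_ge0 ?(ltW (sqr1D_gt0 s))//.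
  by rewrite integral_inv_sqr1D ltry.
apply: (le_integrable measurableT _ _ (integrableZl measurableT M i1)).
- apply: measurable_EFin_comp; apply: measurable_mul => //.
  apply: (measurable_continuous_comp (h := g \o atan)); last by mfun.
  by move=> s; apply: continuous_comp; [exact: continuous_atan|exact: cg].
- move=> s _; rewrite /= lee_fin !normrM ler_wpM2r//.
  exact: le_trans (gM _) (ler_norm _).
Qed.

(** Adding M makes the integrand nonnegative, so the previous formula applies; the two contributions
    of M cancel. *)
Lemma Rintegral_atan (R : realType) (g G : R -> R) (M : R) :
  continuous g -> (forall u, `|g u| <= M) -> (forall u : R, is_derive u 1 G (g u)) ->
  \int[leb R]_s (g (atan s) / (1 + s ^+ 2)) = G (pi / 2) - G (- (pi / 2)).
Proof.
move=> cg gM dG.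
have M0 : 0 <= M by exact: le_trans (normr_ge0 _) (gM 0).
have cM : continuous (cst M : R -> R) by move=> u; exact: cvg_cst.
have cgM : continuous (fun u => g u + M) by move=> u; apply: cvgD; [exact: cg|exact: cvg_cst].
have I2 : (leb R).-integrable setT (EFin \o (fun s : R => (g (atan s) + M) / (1 + s ^+ 2))).
  apply: (integrable_atan (g := fun u => g u + M) (M := M + M) cgM) => u.
  by rewrite (le_trans (ler_normD _ _))// lerD// ger0_norm.
transitivity (\int[leb R]_s ((g (atan s) + M) / (1 + s ^+ 2) - cst M (atan s) / (1 + s ^+ 2))).
  by apply: eq_Rintegral => s _ /=; rewrite -mulrBl addrK.
rewrite RintegralB//; last first.
  by apply: integrable_atan => // u; rewrite /= ger0_norm.
have gM0 u : 0 <= g u + M by have := gM u; rewrite ler_norml => /andP[]; lra.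
have dM (u : R) : is_derive u 1 (fun u => M * u) M.
  have -> : (fun u => M * u) = M *: id by [].
  by apply: is_derive_eq; rewrite /GRing.scale /= mulr1.
have dGM (u : R) : is_derive u 1 (fun u => G u + M * u) (g u + M) by exact: is_deriveD.
rewrite /Rintegral (ge0_integral_atan cgM gM0 dGM).
rewrite (ge0_integral_atan cM (fun=> M0) dM) /=.
lra.
Qed.

(** * The Bessel kernel and its decay *)

(* The integrals of [cos (l sin u) c(u)] and [sin (l sin u) c(u)] over [(-pi/2, pi/2)],
   with [u = atan s]: this avoids integrals over moving or compact domains. *)
Definition cosInt (R : realType) (c : R -> R) (l : R) : R :=
  \int[leb R]_s (cos (l * sin (atan s)) * c (atan s) / (1 + s ^+ 2)).
Definition sinInt (R : realType) (c : R -> R) (l : R) : R :=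
  \int[leb R]_s (sin (l * sin (atan s)) * c (atan s) / (1 + s ^+ 2)).

Lemma continuous_cosM (R : realType) (c : R -> R) (l : R) : continuous c ->
  continuous (fun u => cos (l * sin u) * c u).
Proof.
move=> cc u; apply: cvgM; last exact: cc.
apply: (@continuous_comp _ _ _ (fun u => l * sin u) cos); last exact: continuous_cos.
by apply: cvgM; [exact: cvg_cst|exact: continuous_sin].
Qed.

Lemma continuous_sinM (R : realType) (c : R -> R) (l : R) : continuous c ->
  continuous (fun u => sin (l * sin u) * c u).
Proof.
move=> cc u; apply: cvgM; last exact: cc.
apply: (@continuous_comp _ _ _ (fun u => l * sin u) sin); last exact: continuous_sin.
by apply: cvgM; [exact: cvg_cst|exact: continuous_sin].
Qed.

Lemma norm_cos_le1 (R : realType) (x : R) : `|cos x| <= 1.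
Proof. by rewrite ler_norml cos_geN1 cos_le1. Qed.

Lemma norm_sin_le1 (R : realType) (x : R) : `|sin x| <= 1.
Proof. by rewrite ler_norml sin_geN1 sin_le1. Qed.

Lemma norm_le1M (R : realType) (x y : R) : `|x| <= 1 -> `|y| <= 1 -> `|x * y| <= 1.
Proof. by move=> x1 y1; rewrite normrM mulr_ile1. Qed.

(** The bound 1 on [df] makes 1/(1+s^2) an integrable dominating function, uniformly in l. *)
Lemma derive_under_atan (R : realType) (f df : R -> R -> R) :
  (forall l, continuous (f l)) -> (forall l, continuous (df l)) ->
  (forall l u, `|f l u| <= 1) -> (forall l u, `|df l u| <= 1) ->
  (forall (l u : R), is_derive l 1 (f ^~ u) (df l u)) ->
  forall l : R, is_derive l 1 (fun l => \int[leb R]_s (f l (atan s) / (1 + s ^+ 2)))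
                     (\int[leb R]_s (df l (atan s) / (1 + s ^+ 2))).
Proof.
move=> cf cdf f1 df1 dfE l.
pose F (x s : R) := f x (atan s) / (1 + s ^+ 2).
have dF (x s : R) : is_derive x 1 (F ^~ s) (df x (atan s) / (1 + s ^+ 2)).
  have -> : F ^~ s = (1 + s ^+ 2)^-1 *: (f ^~ (atan s)).
    by apply/funext => y; rewrite /F /= mulrC.
  by rewrite mulrC; exact: is_deriveZ.
have c1 : continuous (cst 1 : R -> R) by move=> u; exact: cvg_cst.
have il : `]l - 1, l + 1[%classic l by rewrite /= in_itv/=; apply/andP; split; lra.
have intF x : `]l - 1, l + 1[%classic x -> (leb R).-integrable setT (EFin \o F x).
  by move=> _; exact: integrable_atan (cf x) (f1 x).
have derF x y : `]l - 1, l + 1[%classic x -> setT y -> derivable (F ^~ y) x 1.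
  by move=> _ _; exact: ex_derive.
have int1 : (leb R).-integrable setT (EFin \o (fun s : R => cst 1 (atan s) / (1 + s ^+ 2))).
  by apply: (integrable_atan (M := 1) c1) => u; rewrite /= normr1.
have G0 (s : R) : 0 <= cst 1 (atan s) / (1 + s ^+ 2).
  by rewrite /= mul1r invr_ge0 ltW// sqr1D_gt0.
have dFE x s : (F ^~ s)^`()%classic x = df x (atan s) / (1 + s ^+ 2).
  by rewrite derive1E; exact: derive_val.
have Gub x y : `]l - 1, l + 1[%classic x -> setT y ->
    `|(F ^~ y)^`()%classic x| <= cst 1 (atan y) / (1 + y ^+ 2).
  move=> _ _; rewrite dFE normrM [X in _ * X]ger0_norm ?invr_ge0 ?(ltW (sqr1D_gt0 y))//.
  by rewrite ler_wpM2r ?invr_ge0 ?(ltW (sqr1D_gt0 y)).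
have D1 := derivable_under_integral measurableT il intF derF G0 int1 Gub.
have D2 := differentiation_under_integral measurableT il intF derF G0 int1 Gub.
apply: DeriveDef; first exact: D1.
by rewrite -derive1E D2; apply: eq_Rintegral => s _; exact: dFE.
Qed.

Lemma is_derive_cosM (R : realType) (a b l : R) :
  is_derive l 1 (fun l => cos (l * a) * b) (- (sin (l * a) * (a * b))).
Proof.
have d1 : is_derive l 1 (fun l => l * a) a.
  have -> : (fun l => l * a) = (fun l => a *: l) by apply/funext => y; rewrite mulrC.
  by apply: is_derive_eq; rewrite /GRing.scale /= mulr1.
have d2 : is_derive l 1 (cos \o (fun l => l * a)) (- sin (l * a) * a).
  exact: is_derive1_comp.
have -> : (fun l => cos (l * a) * b) = b *: (cos \o (fun l => l * a)).
  by apply/funext => y; rewrite mulrC.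
have -> : - (sin (l * a) * (a * b)) = b *: (- sin (l * a) * a) by rewrite /GRing.scale /=; ring.
exact: is_deriveZ.
Qed.

Lemma is_derive_sinM (R : realType) (a b l : R) :
  is_derive l 1 (fun l => sin (l * a) * b) (cos (l * a) * (a * b)).
Proof.
have d1 : is_derive l 1 (fun l => l * a) a.
  have -> : (fun l => l * a) = (fun l => a *: l) by apply/funext => y; rewrite mulrC.
  by apply: is_derive_eq; rewrite /GRing.scale /= mulr1.
have d2 : is_derive l 1 (sin \o (fun l => l * a)) (cos (l * a) * a).
  exact: is_derive1_comp.
have -> : (fun l => sin (l * a) * b) = b *: (sin \o (fun l => l * a)).
  by apply/funext => y; rewrite mulrC.
have -> : cos (l * a) * (a * b) = b *: (cos (l * a) * a) by rewrite /GRing.scale /=; ring.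
exact: is_deriveZ.
Qed.

Lemma is_derive_cosInt (R : realType) (c : R -> R) :
  continuous c -> (forall u, `|c u| <= 1) -> forall l : R,
  is_derive l 1 (cosInt c) (- sinInt (fun u => sin u * c u) l).
Proof.
move=> cc c1 l.
have csc : continuous (fun u => sin u * c u).
  by move=> u; apply: cvgM; [exact: continuous_sin|exact: cc].
rewrite (_ : - sinInt _ l =
    \int[leb R]_s (- (sin (l * sin (atan s)) * (sin (atan s) * c (atan s))) / (1 + s ^+ 2))).
  apply: (@derive_under_atan R (fun l u => cos (l * sin u) * c u)
     (fun l u => - (sin (l * sin u) * (sin u * c u)))).
  - by move=> x; exact: continuous_cosM.
  - by move=> x u; apply: cvgN; exact: continuous_sinM.
  - by move=> x u; rewrite norm_le1M ?norm_cos_le1.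
  - by move=> x u; rewrite normrN !norm_le1M ?norm_sin_le1.
  - by move=> x u; exact: is_derive_cosM.
rewrite -mulN1r /sinInt -RintegralZl//.
  by apply: eq_Rintegral => s _; rewrite mulN1r mulNr.
apply: (integrable_atan (g := fun u => sin (l * sin u) * (sin u * c u)) (M := 1)).
  exact: continuous_sinM.
by move=> u; rewrite !norm_le1M ?norm_sin_le1.
Qed.

Lemma is_derive_sinInt (R : realType) (c : R -> R) :
  continuous c -> (forall u, `|c u| <= 1) -> forall l : R,
  is_derive l 1 (sinInt c) (cosInt (fun u => sin u * c u) l).
Proof.
move=> cc c1 l.
have csc : continuous (fun u => sin u * c u).
  by move=> u; apply: cvgM; [exact: continuous_sin|exact: cc].
apply: (@derive_under_atan R (fun l u => sin (l * sin u) * c u)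
   (fun l u => cos (l * sin u) * (sin u * c u))).
- by move=> x; exact: continuous_sinM.
- by move=> x; exact: continuous_cosM.
- by move=> x u; rewrite norm_le1M ?norm_sin_le1.
- by move=> x u; rewrite !norm_le1M ?norm_sin_le1 ?norm_cos_le1.
- by move=> x u; exact: is_derive_sinM.
Qed.

Lemma norm_Rintegral_atan_le (R : realType) (g : R -> R) :
  continuous g -> (forall u, `|g u| <= 1) ->
  `|\int[leb R]_s (g (atan s) / (1 + s ^+ 2))| <= pi.
Proof.
move=> cg g1; apply: le_trans (le_normr_Rintegral measurableT (integrable_atan cg g1)) _.
have -> : pi = \int[leb R]_s ((1 + s ^+ 2)^-1) :> R.
  by rewrite /Rintegral integral_inv_sqr1D.
have c1 : continuous (cst 1 : R -> R) by move=> u; exact: cvg_cst.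
apply: le_Rintegral => //.
- have := integrable_abse (integrable_atan cg g1).
  by apply: eq_integrable.
- have c11 (u : R) : `|cst 1 u : R| <= 1 by rewrite /= normr1.
  have := integrable_atan c1 c11.
  by apply: eq_integrable => // s _; rewrite /= mul1r.
- move=> s _; rewrite normrM [X in _ * X]ger0_norm ?invr_ge0 ?(ltW (sqr1D_gt0 s))//.
  by rewrite -[leRHS]mul1r ler_wpM2r ?invr_ge0 ?(ltW (sqr1D_gt0 s)).
Qed.

Lemma norm_cosInt_le (R : realType) (c : R -> R) (l : R) :
  continuous c -> (forall u, `|c u| <= 1) -> `|cosInt c l| <= pi.
Proof.
move=> cc c1; apply: (norm_Rintegral_atan_le (g := fun u => cos (l * sin u) * c u)).
  exact: continuous_cosM.
by move=> u; rewrite norm_le1M ?norm_cos_le1.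
Qed.

Lemma norm_sinInt_le (R : realType) (c : R -> R) (l : R) :
  continuous c -> (forall u, `|c u| <= 1) -> `|sinInt c l| <= pi.
Proof.
move=> cc c1; apply: (norm_Rintegral_atan_le (g := fun u => sin (l * sin u) * c u)).
  exact: continuous_sinM.
by move=> u; rewrite norm_le1M ?norm_sin_le1.
Qed.

Lemma continuous_cosX (R : realType) (n : nat) : continuous (fun u : R => cos u ^+ n).
Proof.
move=> u; apply: (@continuous_comp _ _ _ cos (fun x => x ^+ n)).
  exact: continuous_cos.
exact: exprn_continuous.
Qed.

Lemma norm_cosX_le1 (R : realType) (n : nat) (u : R) : `|cos u ^+ n| <= 1.
Proof. by rewrite normrX exprn_ile1// norm_cos_le1. Qed.

(* Integrating the derivative of [sin (l sin u) cos^(n+1) u] over [(-pi/2, pi/2)]. *)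
Lemma cosInt_sinInt (R : realType) (n : nat) (l : R) :
  l * cosInt (fun u => cos u ^+ n.+2) l =
  n.+1%:R * sinInt (fun u => sin u * cos u ^+ n) l.
Proof.
pose g (u : R) := cos (l * sin u) * (cos u ^+ n.+2).
pose h (u : R) := sin (l * sin u) * (sin u * cos u ^+ n).
have cg : continuous g by apply: continuous_cosM; exact: continuous_cosX.
have ch : continuous h.
  apply: continuous_sinM => u; apply: cvgM; first exact: continuous_sin.
  exact: continuous_cosX.
have g1 u : `|g u| <= 1 by rewrite norm_le1M ?norm_cos_le1 ?norm_cosX_le1.
have h1 u : `|h u| <= 1 by rewrite !norm_le1M ?norm_sin_le1 ?norm_cosX_le1.
have cf : continuous (fun u => l * g u - n.+1%:R * h u).
  move=> u; apply: cvgB; apply: cvgM; first [exact: cvg_cst|exact: cg|exact: ch].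
have fM u : `|l * g u - n.+1%:R * h u| <= `|l| + n.+1%:R.
  rewrite (le_trans (ler_normB _ _))// lerD//.
    by rewrite normrM -[leRHS]mulr1; apply: ler_wpM2l => //; exact: g1.
  by rewrite normrM normr_nat -[leRHS]mulr1; apply: ler_wpM2l => //; exact: h1.
have dF (u : R) : is_derive u 1 (fun u => sin (l * sin u) * cos u ^+ n.+1) (l * g u - n.+1%:R * h u).
  have d1 : is_derive u 1 (fun u => l * sin u) (l * cos u).
    by rewrite [X in is_derive _ _ X _](_ : _ = l *: (@sin R))//; apply: is_derive_eq.
  have d2 : is_derive u 1 (sin \o (fun u => l * sin u)) (cos (l * sin u) * (l * cos u)).
    exact: is_derive1_comp.
  have d3 : is_derive u 1 ((@cos R) ^+ n.+1) (n.+1%:R * cos u ^+ n * (- sin u)).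
    by apply: is_derive_eq; rewrite /GRing.scale.
  have -> : (fun u => sin (l * sin u) * cos u ^+ n.+1) =
      (sin \o (fun u => l * sin u)) * ((@cos R) ^+ n.+1).
    by apply/funext => x; rewrite /= fctE exprfctE.
  apply: is_derive_eq; rewrite /GRing.scale/= exprfctE /g /h !exprS; ring.
have E := Rintegral_atan cf fM dF.
have I1 := integrable_atan cg g1.
have I2 := integrable_atan ch h1.
apply/eqP; rewrite -subr_eq0; apply/eqP.
transitivity (\int[leb R]_s ((l * g (atan s) - n.+1%:R * h (atan s)) / (1 + s ^+ 2))).
  rewrite /cosInt /sinInt -RintegralZl// -[X in _ - X]RintegralZl// -RintegralB//.
  - by apply: eq_Rintegral => s _; rewrite /g /h; ring.
  - by have := integrableZl measurableT l I1; apply: eq_integrable.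
  - by have := integrableZl measurableT n.+1%:R I2; apply: eq_integrable.
(* The boundary terms vanish: cos(pi/2) = 0 occurs with the positive exponent n+1. *)
by rewrite E cosN cos_pihalf !exprS !mul0r !mulr0 subrr.
Qed.

(* The energy [l^(k-1) (J^2 + J'^2) + (k-1) l^(k-2) J J'] of a solution of Bessel's
   equation [l J'' + (k-1) J' + l J = 0] has derivative [-(k-1) l^(k-3) J J'],
   so it grows at most by a bounded factor. *)
Lemma bessel_decay (R : realType) (n : nat) (J P Q : R -> R) (M : R) :
  (forall l : R, is_derive l 1 J (P l)) -> (forall l : R, is_derive l 1 P (Q l)) ->
  (forall l : R, l * (Q l + J l) = - (n.+1%:R * P l)) ->
  (forall l, `|J l| <= M) -> (forall l, `|P l| <= M) ->
  exists C : R, forall l, 0 <= l -> (1 + l) ^+ n.+1 * J l ^+ 2 <= C.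
Proof.
move=> dJ dP ode JM PM.
(* This is the k-1 of Bessel's equation, the block having dimension n+2. It is also the threshold:
   for l >= k the cross term of the energy is at most half of l^(n+1) (P^2 + J^2). *)
pose k : R := n.+1%:R.
pose E (l : R) := l ^+ n.+1 * (P l ^+ 2 + J l ^+ 2) + k * (l ^+ n * (J l * P l)).
have k0 : 0 < k by rewrite ltr0n.
have k1 : 1 <= k by rewrite ler1n.
have JP (l : R) : `|J l * P l| <= (P l ^+ 2 + J l ^+ 2) / 2.
  rewrite ler_norml; apply/andP; split.
    by have := sqr_ge0 (J l + P l); nra.
  by have := sqr_ge0 (J l - P l); nra.
have Elow (l : R) : k <= l -> l ^+ n.+1 * (P l ^+ 2 + J l ^+ 2) <= 2 * E l.
  move=> kl; have l0 : 0 <= l by lra.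
  have ln : 0 <= l ^+ n by exact: exprn_ge0.
  have S0 : 0 <= P l ^+ 2 + J l ^+ 2 by rewrite addr_ge0 ?sqr_ge0.
  have H : - (l * ((P l ^+ 2 + J l ^+ 2) / 2)) <= k * (J l * P l).
    have := JP l; rewrite ler_norml => /andP[H1 H2].
    apply: le_trans (_ : k * - ((P l ^+ 2 + J l ^+ 2) / 2) <= _); last by rewrite ler_wpM2l// ltW.
    by rewrite mulrN lerN2 ler_wpM2r// divr_ge0.
  have aux (z S T : R) : z * - (l * (S / 2)) <= z * (k * T) ->
      l * z * S <= 2 * (l * z * S + k * (z * T)) by lra.
  by rewrite /E exprS; apply: aux; exact: ler_wpM2l.
pose dE (l : R) := (k * l ^+ n) * (P l ^+ 2 + J l ^+ 2) + l ^+ n.+1 * (2 * P l * Q l + 2 * J l * P l)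
   + k * ((n%:R * l ^+ n.-1) * (J l * P l) + l ^+ n * (P l * P l + J l * Q l)).
have dEE (l : R) : is_derive l 1 E (dE l).
  have E' : E = (id ^+ n.+1) * (P ^+ 2 + J ^+ 2) + k *: ((id ^+ n) * (J * P)).
    by apply/funext => x; rewrite /E /GRing.scale /= !fctE.
  rewrite E'; apply: is_derive_eq.
  rewrite /GRing.scale /= !fctE /dE /=; ring.
(* The equation gives l dE = - k l^n J P, and l^(n+1) |J P| <= E for l >= k. So the relative growth
   of E is at most k/l^2, which is integrable at infinity. *)
have dEle (l : R) : k <= l -> dE l <= k / l ^+ 2 * E l.
  move=> kl; have l0 : 0 < l by lra.
  have l20 : 0 < l ^+ 2 by rewrite exprn_gt0.
  have dE1 : dE l * l = - (k * l ^+ n * (J l * P l)).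
    have nl : n%:R * l ^+ n.-1 * l = n%:R * l ^+ n.
      by case: (n) => [|m]; rewrite ?mul0r//= -mulrA -exprSr.
    transitivity ((k * l ^+ n) * (P l ^+ 2 + J l ^+ 2) * l + l ^+ n.+1 * (2 * P l * (l * Q l) + 2 * J l * P l * l)
      + k * ((n%:R * l ^+ n.-1 * l) * (J l * P l) + l ^+ n * (P l * P l * l + J l * (l * Q l)))).
      by rewrite /dE; ring.
    have -> : l * Q l = - (k * P l) - l * J l by have := ode l; rewrite -/k; lra.
    have kE : k = n%:R + 1 by rewrite /k -natr1.
    by rewrite nl (exprS l n) kE; ring.
  have ln : 0 <= l ^+ n by rewrite exprn_ge0// ltW.
  rewrite mulrAC ler_pdivlMr// (_ : dE l * l ^+ 2 = dE l * l * l); last by ring.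
  rewrite dE1.
  have H1 := Elow l kl.
  have := JP l; rewrite ler_norml => /andP[H2 H3].
  rewrite -mulNr -[leRHS]mulr1.
  have H4 : - (l ^+ n * (J l * P l)) * l <= E l.
    have := ler_wpM2l ln H2; have := ler_wpM2l (ltW l0) (ler_wpM2l ln H2).
    by move: H1; rewrite exprS; lra.
  by have := ler_wpM2l (ltW k0) H4; lra.
have M0 : 0 <= M by exact: le_trans (normr_ge0 _) (JM 0).
(* exp(k/l) is the integrating factor for the growth rate k/l^2: H is nonincreasing beyond k, so
   E(l) <= H(l) <= H(k) = e E(k). *)
pose H (l : R) := E l * expR (k / l).
have dH (l : R) : 0 < l -> is_derive l 1 H (dE l * expR (k / l) - E l * (expR (k / l) * (k / l ^+ 2))).
  move=> l0; have ln0 : l != 0 by rewrite gt_eqF.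
  have d1 : is_derive l 1 (fun x => k / x) (- (k / l ^+ 2)).
    have -> : (fun x => k / x) = k *: (fun x => x^-1) by [].
    have dV : is_derive l 1 (fun x : R => x^-1) (- l ^- 2).
      by have := @is_deriveV _ id l 1 1 ln0 (is_derive_id _ _); rewrite /GRing.scale /= mulr1.
    have -> : - (k / l ^+ 2) = k *: (- l ^- 2) by rewrite /GRing.scale /= mulrN.
    exact: is_deriveZ.
  have d2 : is_derive l 1 (expR \o (fun x => k / x)) (expR (k / l) * - (k / l ^+ 2)).
    exact: is_derive1_comp.
  have -> : H = E * (expR \o (fun x => k / x)) by [].
  by apply: is_derive_eq; rewrite /GRing.scale /=; ring.
have Hle (l : R) : k <= l -> H l <= H k.
  move=> kl; apply: (@ler0_derive1_nincr _ H k l) => //.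
  - move=> x; rewrite in_itv/= => /andP[kx _].
    have xp : 0 < x by lra.
    by have := dH x xp => ?; exact: ex_derive.
  - move=> x; rewrite in_itv/= => /andP[kx _].
    have xp : 0 < x by lra.
    have D := dH x xp; rewrite derive1E derive_val.
    have := dEle x (ltW kx) => H1.
    have := ler_wpM2r (expR_ge0 (k / x)) H1; lra.
  - apply: continuous_in_subspaceT => x; rewrite inE /= in_itv/= => /andP[kx _].
    have xp : 0 < x by lra.
    have D := dH x xp.
    by apply/differentiable_continuous/derivable1_diffP; exact: ex_derive.
(* The first term covers l < k by boundedness of J, the second l >= k >= 1, where 1 + l <= 2 l.
   Absolute values make the sum dominate each term. *)
exists (`|(1 + k) ^+ n.+1 * M ^+ 2| + `|2 ^+ n.+1 * (2 * (E k * expR 1))|) => l l0.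
have J2 : J l ^+ 2 <= M ^+ 2 by rewrite -real_normK ?num_real// lerXn2r ?nnegrE.
have [kl|lk] := leP k l; last first.
  rewrite -[leLHS]addr0 lerD// (le_trans _ (ler_norm _))// ler_pM ?sqr_ge0//.
    by rewrite exprn_ge0// addr_ge0.
  by rewrite lerXn2r ?nnegrE ?addr_ge0 ?(ltW k0)// lerD2l ltW.
rewrite -[leLHS]add0r lerD// (le_trans _ (ler_norm _))//.
apply: (@le_trans _ _ (2 ^+ n.+1 * (l ^+ n.+1 * (P l ^+ 2 + J l ^+ 2)))).
  rewrite mulrA -exprMn ler_pM ?sqr_ge0 ?exprn_ge0 ?addr_ge0//.
    by rewrite lerXn2r ?nnegrE ?addr_ge0 ?mulr_ge0//; lra.
  by rewrite lerDr sqr_ge0.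
rewrite ler_wpM2l ?exprn_ge0//; apply: le_trans (Elow l kl) _.
rewrite ler_wpM2l//; apply: le_trans (_ : H l <= _).
  rewrite /H ler_peMr//; last by rewrite -[leLHS]expR0 ler_expR divr_ge0// ltW.
  have := Elow l kl; have : 0 <= l ^+ n.+1 * (P l ^+ 2 + J l ^+ 2).
    by rewrite mulr_ge0 ?exprn_ge0 ?addr_ge0 ?sqr_ge0.
  by lra.
by apply: le_trans (Hle l kl) _; rewrite /H divff// gt_eqF.
Qed.

(** Two derivatives of J bring down sin^2 u, so J'' + J is the integral with cos^(n+2) u in place of
    cos^n u, since 1 - sin^2 = cos^2. The integration by parts above then turns l (J'' + J) into
    -(n+1) J'. *)
Lemma cosInt_decay (R : realType) (n : nat) :
  exists C : R, forall l : R, 0 <= l ->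
    (1 + l) ^+ n.+1 * cosInt (fun u => cos u ^+ n) l ^+ 2 <= C.
Proof.
have cc := @continuous_cosX R n.
have c1 := @norm_cosX_le1 R n.
have csc : continuous (fun u : R => sin u * cos u ^+ n).
  by move=> u; apply: cvgM; [exact: continuous_sin|exact: cc].
have sc1 (u : R) : `|sin u * cos u ^+ n| <= 1 by rewrite norm_le1M ?norm_sin_le1.
apply: (@bessel_decay R n _ (fun l => - sinInt (fun u => sin u * cos u ^+ n) l)
  (fun l => - cosInt (fun u => sin u * (sin u * cos u ^+ n)) l) pi).
- exact: is_derive_cosInt.
- move=> l; apply: is_deriveN; exact: is_derive_sinInt.
- move=> l; rewrite mulrN opprK -cosInt_sinInt; congr (_ * _).
  rewrite addrC /cosInt -RintegralB//.
  + apply: eq_Rintegral => s _; 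
    have -> : cos (atan s) ^+ n.+2 = (1 - sin (atan s) * sin (atan s)) * cos (atan s) ^+ n.
      have -> : 1 - sin (atan s) * sin (atan s) = cos (atan s) * cos (atan s).
        by have := cos2Dsin2 (atan s); rewrite !expr2; lra.
      by rewrite !exprS mulrA.
    by ring.
  + apply: (integrable_atan (g := fun u => cos (l * sin u) * cos u ^+ n) (M := 1)).
      exact: continuous_cosM.
    by move=> u; rewrite norm_le1M ?norm_cos_le1.
  + apply: (integrable_atan (g := fun u => cos (l * sin u) * (sin u * (sin u * cos u ^+ n))) (M := 1)).
      apply: continuous_cosM => u; apply: cvgM; first exact: continuous_sin.
      exact: csc.
    by move=> u; rewrite !norm_le1M ?norm_cos_le1 ?norm_sin_le1.
- by move=> l; exact: norm_cosInt_le.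
- by move=> l; rewrite normrN; exact: norm_sinInt_le.
Qed.

(** * Radial and zonal integrals *)

Lemma ge0_integral_munS (R : realType) (n : nat) (f : rvT R n.+1 -> \bar R) :
  measurable_fun setT f -> (forall x, (0 <= f x)%E) ->
  (\int[mun R n.+1]_v f v = \int[leb R]_t \int[mun R n]_w f (vcons t w))%E.
Proof.
move=> mf f0; rewrite -iintE//=; apply: eq_integral => t _.
rewrite -iintE//; apply: (measurableT_comp mf (_ : measurable_fun setT (fun w : rvT R n => vcons t w : rvT R n.+1))).
by mfun.
Qed.

Lemma ge0_integral_mun_add (R : realType) (m k : nat) (f : rvT R (m + k) -> \bar R) :
  measurable_fun setT f -> (forall x, (0 <= f x)%E) ->
  (\int[mun R (m + k)]_v f v =
   \int[mun R m]_u \int[mun R k]_v f (row_mx u v))%E.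
Proof.
move=> mf f0.
pose g (z : rvT R m * rvT R k) : \bar R := f (row_mx z.1 z.2).
have mg : measurable_fun setT g.
  apply: (measurableT_comp mf (_ : measurable_fun setT (fun z : rvT R m * rvT R k => row_mx z.1 z.2 : rvT R (m + k)))).
  by mfun.
have g0 z : (0 <= g z)%E by exact: f0.
have mG := measurable_fun_fubini_tonelli_F (m2 := mun R k) g mg g0.
rewrite -[LHS]iintE// iint_add.
rewrite [LHS](_ : _ = iint m (fubini_F (mun R k) g)).
  by rewrite iintE// => x; apply: integral_ge0 => y _; exact: g0.
congr iint; apply/funext => u; rewrite iintE// /fubini_F//.
exact: (measurable_pair_comp (h := g)).
Qed.

Lemma dotv_vcons (R : realType) (n : nat) (x : 'rV[R]_n.+1) (t : R) (v : 'rV[R]_n) :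
  dotv x (vcons t v) = x 0 ord0 * t + dotv (vtail x) v.
Proof.
rewrite /dotv big_ord_recl vcons_ord0; congr (_ + _).
by apply: eq_bigr => i _; rewrite !mxE liftK.
Qed.

Lemma dotvv_ge0 (R : realType) (n : nat) (x : 'rV[R]_n) : 0 <= dotv x x.
Proof. by apply: sumr_ge0 => i _; rewrite -expr2 sqr_ge0. Qed.

Lemma enorm_ge0 (R : realType) (n : nat) (x : 'rV[R]_n) : 0 <= enorm x.
Proof. exact: sqrtr_ge0. Qed.

Lemma sqr_enorm (R : realType) (n : nat) (x : 'rV[R]_n) : enorm x ^+ 2 = dotv x x.
Proof. by rewrite sqr_sqrtr// dotvv_ge0. Qed.

Lemma enorm_vcons (R : realType) (n : nat) (t : R) (v : 'rV[R]_n) :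
  enorm (vcons t v) = Num.sqrt (t ^+ 2 + enorm v ^+ 2).
Proof. by rewrite /enorm dotv_vcons vcons_ord0 vtail_vcons sqr_enorm expr2. Qed.

Lemma enorm_vtail (R : realType) (n : nat) (x : 'rV[R]_n.+1) :
  enorm x = Num.sqrt (x 0 ord0 ^+ 2 + enorm (vtail x) ^+ 2).
Proof. by rewrite -enorm_vcons vcons_eta. Qed.

Lemma enorm_rV0 (R : realType) (v : 'rV[R]_0) : enorm v = 0.
Proof. by rewrite /enorm /dotv big_ord0 sqrtr0. Qed.

(** Rotation invariance for functions of |v| and x.v, which moves x to the first axis. The tail of x
    is moved to its own first axis by induction, and one rotation in the plane of the first two
    coordinates does the rest. *)
Lemma integral_zonal_rotation (R : realType) (n : nat) (x : 'rV[R]_n.+1)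
    (F : measurableTypeR R * measurableTypeR R -> \bar R) :
  measurable_fun setT F -> (forall z, (0 <= F z)%E) ->
  (\int[mun R n.+1]_v F (enorm v, dotv x v) =
   \int[mun R n.+1]_v F (enorm v, enorm x * (v : 'rV[R]_n.+1) 0 ord0)%R)%E.
Proof.
move=> + F0.
have mL k (y : 'rV[R]_k) G : measurable_fun setT G ->
    measurable_fun setT (fun v : rvT R k => G (enorm v, dotv y v) : \bar R).
  by move=> mG; apply: measurable_pair_comp; [exact: mG|mfun|mfun].
have mR k (c : R) G : measurable_fun setT G ->
    measurable_fun setT (fun v : rvT R k.+1 => G (enorm v, c * (v : 'rV[R]_k.+1) 0 ord0)%R : \bar R).
  by move=> mG; apply: measurable_pair_comp; [exact: mG|mfun|mfun; exact: measurable_coord_rv].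
(* In dimension one only the sign of x has to be reflected. *)
elim: n x F F0 => [|n IH] x F F0 mF.
  rewrite (ge0_integral_munS (mL _ x F mF) (fun=> F0 _)).
  rewrite (ge0_integral_munS (mR _ (enorm x) F mF) (fun=> F0 _)).
  have xE : enorm x = `|x 0 ord0|.
    by rewrite enorm_vtail enorm_rV0 expr0n addr0 sqrtr_sqr.
  pose f c (z : measurableTypeR R * rvT R 0) : \bar R := F (`|z.1|, c * z.1)%R.
  have mf c : measurable_fun setT (f c).
    apply: measurable_pair_comp; [exact: mF| |by mfun].
    by apply: (measurable_continuous_comp (h := Num.norm)); [exact: norm_continuous|mfun].
  have f0 c z : (0 <= f c z)%E by exact: F0.
  pose G c (t : measurableTypeR R) : \bar R := (\int[mun R 0]_w f c (t, w))%E.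
  have mG c : measurable_fun setT (G c).
    exact: (measurable_fun_fubini_tonelli_F (m2 := mun R 0) (f c) (mf c) (f0 c)).
  have G0 c t : (0 <= G c t)%E by apply: integral_ge0 => w _; exact: f0.
  transitivity (\int[leb R]_t G (x 0%R ord0) t)%E.
    apply: eq_integral => t _; apply: eq_integral => w _.
    rewrite dotv_vcons enorm_vcons enorm_rV0 expr0n addr0 sqrtr_sqr.
    by rewrite [dotv _ w]big_ord0 addr0.
  transitivity (\int[leb R]_t G (enorm x) t)%E; last first.
    apply: eq_integral => t _; apply: eq_integral => w _.
    by rewrite enorm_vcons enorm_rV0 expr0n addr0 sqrtr_sqr vcons_ord0.
  rewrite xE; have [x0|x0] := leP 0 (x 0 ord0).
    by rewrite ger0_norm.
  have -> : `|x 0 ord0| = - x 0 ord0 by rewrite ltr0_norm.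
  rewrite -(ge0_integral_oppr (mG (- x 0 ord0)) (G0 _)).
  apply: eq_integral => t _; apply: eq_integral => w _.
  by rewrite /f /= normrN mulrNN.
pose b := enorm (vtail x).
pose f (z : (measurableTypeR R * measurableTypeR R) * rvT R n) : \bar R :=
  F (Num.sqrt (z.1.1 + enorm z.2 ^+ 2), z.1.2)%R.
have mf : measurable_fun setT f.
  by apply: measurable_pair_comp; [exact: mF|mfun|mfun].
have f0 z : (0 <= f z)%E by exact: F0.
(* All coordinates but the first two are integrated out; t and s then enter only through t^2 + s^2
   and a linear form. [E] below is applied to the coefficients (x_0, |tail x|) and, backwards, to
   (|x|, 0). *)
pose T := fubini_F (mun R n) f.
have mT : measurable_fun setT T.
  exact: (measurable_fun_fubini_tonelli_F (m2 := mun R n) f mf f0).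
have T0 z : (0 <= T z)%E by apply: integral_ge0 => w _; exact: f0.
pose Ft c (t : R) (z : measurableTypeR R * measurableTypeR R) : \bar R :=
  F (Num.sqrt (t ^+ 2 + z.1 ^+ 2), c * t + z.2)%R.
have mFt c t : measurable_fun setT (Ft c t).
  by apply: measurable_pair_comp; [exact: mF|mfun|mfun].
have Ft0 c t z : (0 <= Ft c t z)%E by exact: F0.
have E (c d : R) : (\int[leb R]_t \int[mun R n.+1]_w
    Ft c t (enorm w, d * (w : 'rV[R]_n.+1) 0 ord0)%R =
    \int[leb R]_t \int[leb R]_s T (t ^+ 2 + s ^+ 2, c * t + d * s)%R)%E.
  apply: eq_integral => t _.
  rewrite (ge0_integral_munS (mR _ d _ (mFt c t)) (fun=> Ft0 _ _ _)).
  apply: eq_integral => s _; apply: eq_integral => w _.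
  rewrite /f /Ft /= vcons_ord0 enorm_vcons sqr_sqrtr ?addrA//.
  by rewrite addr_ge0// sqr_ge0.
transitivity (\int[leb R]_t \int[mun R n.+1]_w
    Ft (x 0%R ord0) t (enorm w, b * (w : 'rV[R]_n.+1) 0 ord0)%R)%E.
  rewrite (ge0_integral_munS (mL _ x F mF) (fun=> F0 _)).
  apply: eq_integral => t _.
  rewrite -(IH (vtail x) _ (Ft0 (x 0 ord0) t) (mFt _ t)).
  by apply: eq_integral => w _; rewrite /Ft /= dotv_vcons enorm_vcons.
rewrite E (integral_rotation _ (enorm_ge0 _) mT T0) -enorm_vtail.
transitivity (\int[leb R]_t \int[leb R]_s T (t ^+ 2 + s ^+ 2, enorm x * t + 0 * s)%R)%E.
  by apply: eq_integral => t _; apply: eq_integral => s _; rewrite mul0r addr0.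
rewrite -E (ge0_integral_munS (mR _ (enorm x) F mF) (fun=> F0 _)).
apply: eq_integral => t _; apply: eq_integral => w _.
by rewrite /Ft /= enorm_vcons vcons_ord0 mul0r addr0.
Qed.

(* If [t = rho s] with [rho > 0] then [slope s] is [t / sqrt (t^2 + rho^2)]. *)
Definition slope (R : realType) (s : R) : R := s / Num.sqrt (1 + s ^+ 2).
Definition slope_weight (R : realType) (k : nat) (s : R) : R := (Num.sqrt (1 + s ^+ 2))^-1 ^+ k.

Lemma measurable_slope (R : realType) (d : measure_display) (T : measurableType d)
  (f : T -> R) : measurable_fun setT f -> measurable_fun setT (fun t => slope (f t)).
Proof. by move=> mf; apply: measurable_mul => //; mfun => t; exact: sqrtr_ge0. Qed.

Lemma measurable_slope_weight (R : realType) (k : nat) (d : measure_display) (T : measurableType d)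
  (f : T -> R) : measurable_fun setT f -> measurable_fun setT (fun t => slope_weight k (f t)).
Proof. by move=> mf; mfun => t; exact: sqrtr_ge0. Qed.

Lemma slope_weight_ge0 (R : realType) (k : nat) (s : R) : 0 <= slope_weight k s.
Proof. by rewrite exprn_ge0// invr_ge0 sqrtr_ge0. Qed.

(** As du = ds/(1+s^2) for u = atan s, the weight is the density cos^n u du of the Bessel kernel. *)
Lemma slope_weightE (R : realType) (n : nat) (s : R) :
  slope_weight n.+2 s = cos (atan s) ^+ n / (1 + s ^+ 2).
Proof.
rewrite /slope_weight cos_atan -[n.+2]addn2 exprD; congr (_ * _).
by rewrite exprVn sqr_sqrtr ?(ltW (sqr1D_gt0 s)).
Qed.

Lemma slope_weight_le (R : realType) (n : nat) (s : R) :
  slope_weight n.+2 s <= (1 + s ^+ 2)^-1.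
Proof.
rewrite slope_weightE -[leRHS]mul1r ler_wpM2r ?invr_ge0 ?(ltW (sqr1D_gt0 s))//.
Qed.

(** The Jacobian r^(k-1) of polar coordinates, cut off at r > 0 so that radial integrals run over
    the whole line. *)
Definition radial_weight (R : realType) (k : nat) (r : R) : R := (0 < r)%R%:R * r ^+ k.-1.

Lemma radial_weight_ge0 (R : realType) (k : nat) (r : R) : 0 <= radial_weight k r.
Proof.
rewrite /radial_weight; case: ltP => [r0|_]; last by rewrite mul0r.
by rewrite mul1r exprn_ge0// ltW.
Qed.

Lemma measurable_radial_weight (R : realType) (k : nat) (d : measure_display) (T : measurableType d)
  (f : T -> R) : measurable_fun setT f -> measurable_fun setT (fun t => radial_weight k (f t)).
Proof. by move=> mf; rewrite /radial_weight; mfun. Qed.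

(* Polar coordinates on the half plane [rho > 0] without angles: substitute
   [t = rho s], then [rho = r / sqrt (1 + s^2)]. *)
Lemma integral_half_plane (R : realType) (n : nat)
    (F : measurableTypeR R * measurableTypeR R -> \bar R) :
  measurable_fun setT F -> (forall z, (0 <= F z)%E) ->
  (\int[leb R]_t \int[leb R]_r ((radial_weight n.+1 r)%:E *
      F (Num.sqrt (t ^+ 2 + r ^+ 2), t)%R) =
   \int[leb R]_r ((radial_weight n.+2 r)%:E * \int[leb R]_s
      (F (r, r * slope s)%R * (slope_weight n.+2 s)%:E)))%E.
Proof.
move=> mF F0.
pose h (s : R) := Num.sqrt (1 + s ^+ 2).
have h1 s : 0 < h s by rewrite sqrtr_gt0 sqr1D_gt0.
have hn0 s : h s != 0 by rewrite gt_eqF.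
have rwE (r : R) : 0 < r -> radial_weight n.+2 r = r * radial_weight n.+1 r.
  by move=> r0; rewrite /radial_weight r0 !mul1r /= exprS.
have rw0 k (r : R) : ~ 0 < r -> radial_weight k r = 0 :> R.
  by move=> /negP/negbTE r0; rewrite /radial_weight r0 mul0r.
pose f1 (z : measurableTypeR R * measurableTypeR R) : \bar R :=
  ((radial_weight n.+1 z.2)%:E * F (Num.sqrt (z.1 ^+ 2 + z.2 ^+ 2), z.1)%R)%E.
have mf1 : measurable_fun setT f1.
  apply: measurable_emul.
    by apply: measurable_EFin_comp; apply: measurable_radial_weight; mfun.
  by apply: measurable_pair_comp; [exact: mF|mfun|mfun].
have f10 z : (0 <= f1 z)%E by rewrite /f1 mule_ge0 ?lee_fin ?radial_weight_ge0 ?F0.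
pose f2 (z : measurableTypeR R * measurableTypeR R) : \bar R :=
  ((radial_weight n.+2 z.1)%:E * F (z.1 * h z.2, z.1 * z.2)%R)%E.
have mf2 : measurable_fun setT f2.
  apply: measurable_emul.
    by apply: measurable_EFin_comp; apply: measurable_radial_weight; mfun.
  by apply: measurable_pair_comp; [exact: mF|rewrite /h; mfun|mfun].
have f20 z : (0 <= f2 z)%E by rewrite /f2 mule_ge0 ?lee_fin ?radial_weight_ge0 ?F0.
pose f3 (z : measurableTypeR R * measurableTypeR R) : \bar R :=
  ((radial_weight n.+2 z.2)%:E * (F (z.2, z.2 * slope z.1)%R * (slope_weight n.+2 z.1)%:E))%E.
have mFs (r : R) : measurable_fun setT (fun s : measurableTypeR R =>
    (F (r, r * slope s)%R * (slope_weight n.+2 s)%:E)%E).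
  apply: measurable_emul; last first.
    by apply: measurable_EFin_comp; apply: measurable_slope_weight; mfun.
  apply: measurable_pair_comp; [exact: mF|by mfun|].
  by mfun => z; exact: sqrtr_ge0.
have Fs0 (r s : R) : (0 <= F (r, r * slope s)%R * (slope_weight n.+2 s)%:E)%E.
  by rewrite mule_ge0 ?lee_fin ?slope_weight_ge0 ?F0.
have mf3 : measurable_fun setT f3.
  apply: measurable_emul.
    by apply: measurable_EFin_comp; apply: measurable_radial_weight; mfun.
  apply: measurable_emul; last first.
    by apply: measurable_EFin_comp; apply: measurable_slope_weight; mfun.
  apply: measurable_pair_comp; [exact: mF|by mfun|].
  by mfun => z; exact: sqrtr_ge0.
have f30 z : (0 <= f3 z)%E by rewrite /f3 mule_ge0 ?lee_fin ?radial_weight_ge0 ?Fs0.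
have step (r : R) (f g : measurableTypeR R -> \bar R) : 0 < r ->
    measurable_fun setT f -> (forall t, (0 <= f t)%E) ->
    (forall t, (r%:E * f (r * t)%R = g t)%E) ->
    (\int[leb R]_t f t = \int[leb R]_t g t)%E.
  move=> r0 mf f0 fg; rewrite (ge0_integral_scale r0 mf f0).
  rewrite -ge0_integralZl.
  - by apply: eq_integral => t _; exact: fg.
  - exact: measurableT.
  - by apply: (measurableT_comp mf); mfun.
  - by move=> t _; exact: f0.
  - by rewrite lee_fin ltW.
transitivity (\int[leb R]_t \int[leb R]_r f1 (t, r))%E.
  by apply: eq_integral => t _; exact: eq_integral.
rewrite (fubini_tonelli f1 mf1 f10).
transitivity (\int[leb R]_r \int[leb R]_s f2 (r, s))%E.
  apply: eq_integral => r _.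
  have [r0|r0] := pselect (0 < r); last first.
    by apply: eq_integral => t _; rewrite /f1 /f2 /= !rw0// !mul0e.
  apply: (step r) => //.
    by apply: measurable_pair_comp; [exact: mf1|mfun|mfun].
  move=> s; rewrite /f1 /f2 /= muleA -EFinM rwE//; congr (_ * F (_, _))%E.
  rewrite /h exprMn -[X in _ + X]mulr1 -mulrDr [s ^+ 2 + 1]addrC sqrtrM ?sqr_ge0//.
  by rewrite sqrtr_sqr gtr0_norm.
rewrite (fubini_tonelli f2 mf2 f20).
transitivity (\int[leb R]_s \int[leb R]_r f3 (s, r))%E.
  apply: eq_integral => s _.
  have hV : 0 < (h s)^-1 by rewrite invr_gt0.
  apply: (step (h s)^-1) => //.
    by apply: measurable_pair_comp; [exact: mf2|mfun|mfun].
  move=> r; rewrite /f2 /f3 /= [in RHS]muleA [in RHS]muleAC muleA -!EFinM.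
  congr (_%:E * F (_, _))%E.
  (* One power of 1/h from the Jacobian and n+1 from the radial weight make up
     [slope_weight n.+2]. *)
  - rewrite /radial_weight pmulr_rgt0// /slope_weight -/(h s) exprMn [in RHS]exprS/=.
    by ring.
  - by rewrite mulrAC mulVf// mul1r.
  - by rewrite /slope -/(h s); ring.
rewrite (fubini_tonelli f3 mf3 f30).
apply: eq_integral => r _; rewrite -ge0_integralZl.
- exact: eq_integral.
- exact: measurableT.
- exact: mFs.
- by move=> s _; exact: Fs0.
- by rewrite lee_fin radial_weight_ge0.
Qed.

(** The two half-lines contribute equally, whence the constant 2; the origin, missed by both
    indicators, is a null set. *)
Lemma integral_radial1 (R : realType) (f : measurableTypeR R -> \bar R) :
  measurable_fun setT f -> (forall r, (0 <= f r)%E) ->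
  (\int[mun R 1]_v f (enorm v) =
   2%:E * \int[leb R]_r ((radial_weight 1 r)%:E * f r))%E.
Proof.
move=> mf f0.
have mfe : measurable_fun setT (fun v : rvT R 1 => f (enorm v)).
  by apply: (measurableT_comp mf); mfun.
have mabs : measurable_fun setT (fun t : measurableTypeR R => f `|t|).
  apply: (measurableT_comp mf).
  by apply: (measurable_continuous_comp (h := Num.norm)); [exact: norm_continuous|mfun].
transitivity (\int[leb R]_t f `|t|%R)%E.
  rewrite -(iintE mfe (fun=> f0 _)); apply: eq_integral => t _.
  by rewrite /= enorm_vcons enorm_rV0 expr0n addr0 sqrtr_sqr.
pose p (t : measurableTypeR R) : \bar R := ((0 < t)%R%:R%:E * f `|t|%R)%E.
have mp : measurable_fun setT p by apply: measurable_emul; [mfun|exact: mabs].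
have p0 t : (0 <= p t)%E by rewrite /p mule_ge0 ?lee_fin ?f0 ?ler0n.
have mpn : measurable_fun setT (fun t : measurableTypeR R => p (- t)).
  by apply: (measurableT_comp mp); mfun.
transitivity (\int[leb R]_t (p t + p (- t)%R))%E.
  apply: ae_eq_integral.
  - exact: measurableT.
  - exact: mabs.
  - exact: emeasurable_funD.
  - exists [set 0]; split => //; first exact: lebesgue_measure_set1.
    move=> t /= Ht; apply: contrapT => /eqP t0; apply: Ht => _.
    rewrite /p oppr_gt0 normrN.
    by case: ltgtP t0 => //; rewrite ?mul1e ?mul0e ?adde0 ?add0e.
rewrite ge0_integralD.
- rewrite (ge0_integral_oppr mp p0) -mule2n mule_natl.
  congr (_ *+ _)%E; apply: eq_integral => r _.
  rewrite /p /radial_weight expr0 mulr1.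
  by case: ltP => r0; rewrite ?mul0e// gtr0_norm.
- exact: measurableT.
- by move=> t _; exact: p0.
- exact: mp.
- by move=> t _; exact: p0.
- exact: mpn.
Qed.

(* The zonal formula in dimension [n + 2] is the radial one in dimension [n + 1]
   combined with polar coordinates of the half plane. *)
Lemma integral_zonal_of_radial (R : realType) (n : nat) (c : R) :
  0 <= c ->
  (forall f : measurableTypeR R -> \bar R,
    measurable_fun setT f -> (forall r, (0 <= f r)%E) ->
    (\int[mun R n.+1]_v f (enorm v) =
     c%:E * \int[leb R]_r ((radial_weight n.+1 r)%:E * f r))%E) ->
  forall (x : 'rV[R]_n.+2) (F : measurableTypeR R * measurableTypeR R -> \bar R),
  measurable_fun setT F -> (forall z, (0 <= F z)%E) ->
  (\int[mun R n.+2]_v F (enorm v, dotv x v) =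
   c%:E * \int[leb R]_r ((radial_weight n.+2 r)%:E * \int[leb R]_s
      (F (r, enorm x * (r * slope s))%R * (slope_weight n.+2 s)%:E)))%E.
Proof.
move=> c0 H x F mF F0.
pose G (z : measurableTypeR R * measurableTypeR R) : \bar R :=
  F (z.1, enorm x * z.2)%R.
have mG : measurable_fun setT G.
  by apply: measurable_pair_comp; [exact: mF|mfun|mfun].
have G0 z : (0 <= G z)%E by exact: F0.
rewrite (integral_zonal_rotation _ mF F0).
have mR : measurable_fun setT
    (fun v : rvT R n.+2 => F (enorm v, enorm x * (v : 'rV[R]_n.+2) 0 ord0)%R).
  by apply: measurable_pair_comp; [exact: mF|mfun|mfun; exact: measurable_coord_rv].
rewrite (ge0_integral_munS mR (fun=> F0 _)) -(integral_half_plane n mG G0).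
pose g (z : measurableTypeR R * measurableTypeR R) : \bar R :=
  ((radial_weight n.+1 z.2)%:E * G (Num.sqrt (z.1 ^+ 2 + z.2 ^+ 2), z.1)%R)%E.
have mg : measurable_fun setT g.
  apply: measurable_emul; last by apply: measurable_pair_comp; [exact: mG|mfun|mfun].
  by apply: measurable_EFin_comp; apply: measurable_radial_weight; mfun.
have g0 z : (0 <= g z)%E by rewrite /g mule_ge0 ?lee_fin ?radial_weight_ge0 ?G0.
rewrite -ge0_integralZl.
- apply: eq_integral => t _.
  pose f (r : measurableTypeR R) : \bar R := G (Num.sqrt (t ^+ 2 + r ^+ 2), t)%R.
  have mf : measurable_fun setT f by apply: measurable_pair_comp; [exact: mG|mfun|mfun].
  have f0 r : (0 <= f r)%E by exact: G0.
  rewrite -(H f mf f0); apply: eq_integral => w _.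
  by rewrite /f /G /= enorm_vcons vcons_ord0.
- exact: measurableT.
- exact: (measurable_fun_fubini_tonelli_F (m2 := leb R) g mg g0).
- by move=> t _; apply: integral_ge0 => r _; exact: (g0 (t, r)).
- by rewrite lee_fin.
Qed.

Lemma integral_slope_weight_lty (R : realType) (n : nat) :
  (\int[leb R]_s (slope_weight n.+2 s)%:E < +oo)%E.
Proof.
apply: (@le_lt_trans _ _ (pi : R)%:E); last by rewrite ltry.
rewrite -integral_inv_sqr1D; apply: ge0_le_integral => //.
- by move=> s _; rewrite lee_fin slope_weight_ge0.
- by apply: measurable_EFin_comp; apply: measurable_slope_weight; mfun.
- by apply: measurable_EFin_comp; mfun => s; rewrite ltW// sqr1D_gt0.
- by move=> s _; rewrite lee_fin slope_weight_le.
Qed.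

(** Induction on the dimension: the zonal formula at x = 0, for an integrand depending on |v| only,
    multiplies the constant by the finite mass W of the slope weight. Starting from 2, this
    recursion yields the area of the unit sphere of R^(k+1). *)
Lemma integral_radial (R : realType) (k : nat) :
  exists2 c : R, 0 <= c & forall f : measurableTypeR R -> \bar R,
    measurable_fun setT f -> (forall r, (0 <= f r)%E) ->
    (\int[mun R k.+1]_v f (enorm v) =
     c%:E * \int[leb R]_r ((radial_weight k.+1 r)%:E * f r))%E.
Proof.
elim: k => [|k [c c0 H]]; first by exists 2 => // f; exact: integral_radial1.
pose W := (\int[leb R]_s (slope_weight k.+2 s)%:E)%E.
have W0 : (0 <= W)%E by apply: integral_ge0 => s _; rewrite lee_fin slope_weight_ge0.
have WE : (fine W)%:E = W by rewrite fineK// ge0_fin_numE// integral_slope_weight_lty.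
exists (c * fine W); first by rewrite mulr_ge0 ?fine_ge0.
move=> f mf f0.
pose F (z : measurableTypeR R * measurableTypeR R) : \bar R := f z.1.
have mF : measurable_fun setT F by apply: (measurableT_comp mf); mfun.
have F0 z : (0 <= F z)%E by exact: f0.
have E := integral_zonal_of_radial c0 H (0 : 'rV[R]_k.+2) mF F0.
transitivity (\int[mun R k.+2]_v F (enorm v, dotv 0 v))%E.
  exact: eq_integral.
rewrite E EFinM -muleA; congr (_ * _)%E.
have m1 : measurable_fun setT (fun r : measurableTypeR R => ((radial_weight k.+2 r)%:E * f r)%E).
  apply: measurable_emul; last exact: mf.
  by apply: measurable_EFin_comp; apply: measurable_radial_weight; mfun.
rewrite -ge0_integralZl; last 4 first.
- exact: measurableT.
- exact: m1.
- by move=> r _; rewrite mule_ge0 ?f0 ?lee_fin ?radial_weight_ge0.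
- by rewrite WE.
apply: eq_integral => r _; rewrite [RHS]muleCA; congr (_ * _)%E.
rewrite /F /= ge0_integralZl ?WE 1?muleC//.
- by apply: measurable_EFin_comp; apply: measurable_slope_weight; mfun.
- by move=> s _; rewrite lee_fin slope_weight_ge0.
Qed.

Lemma integral_zonal (R : realType) (n : nat) :
  exists2 c : R, 0 <= c & forall (x : 'rV[R]_n.+2)
    (F : measurableTypeR R * measurableTypeR R -> \bar R),
  measurable_fun setT F -> (forall z, (0 <= F z)%E) ->
  (\int[mun R n.+2]_v F (enorm v, dotv x v) =
   c%:E * \int[leb R]_r ((radial_weight n.+2 r)%:E * \int[leb R]_s
      (F (r, enorm x * (r * slope s))%R * (slope_weight n.+2 s)%:E)))%E.
Proof.
have [c c0 H] := integral_radial R n; exists c => // x F.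
exact: integral_zonal_of_radial.
Qed.

(** * Integration over the sphere *)

Lemma dotv_row (R : realType) (m k : nat) (x y : 'rV[R]_(m + k)) :
  dotv x y = dotv (lsubmx x) (lsubmx y) + dotv (rsubmx x) (rsubmx y).
Proof.
by rewrite /dotv big_split_ord /=; congr (_ + _); apply: eq_bigr => i _; rewrite !mxE.
Qed.

Lemma dotvZr (R : realType) (n : nat) (c : R) (x y : 'rV[R]_n) :
  dotv x (c *: y) = c * dotv x y.
Proof. by rewrite /dotv mulr_sumr; apply: eq_bigr => i _; rewrite !mxE mulrCA. Qed.

Lemma enormZ (R : realType) (n : nat) (c : R) (x : 'rV[R]_n) :
  enorm (c *: x) = `|c| * enorm x.
Proof.
rewrite /enorm dotvZr (_ : dotv (c *: x) x = c * dotv x x).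
  by rewrite mulrA -expr2 sqrtrM ?sqr_ge0// sqrtr_sqr.
by rewrite /dotv mulr_sumr; apply: eq_bigr => i _; rewrite !mxE mulrA.
Qed.

Lemma enorm_row (R : realType) (m k : nat) (y : 'rV[R]_(m + k)) :
  enorm y = Num.sqrt (enorm (lsubmx y) ^+ 2 + enorm (rsubmx y) ^+ 2).
Proof. by rewrite !sqr_enorm -dotv_row. Qed.

Lemma norm_coord_le_enorm (R : realType) (n : nat) (x : 'rV[R]_n) (i : 'I_n) :
  `|x 0 i| <= enorm x.
Proof.
rewrite -sqrtr_sqr ler_sqrt ?dotvv_ge0// /dotv (bigD1 i)//= -expr2 lerDl.
by apply: sumr_ge0 => j _; rewrite -expr2 sqr_ge0.
Qed.

Lemma enorm_normalize (R : realType) (n : nat) (y : 'rV[R]_n) :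
  0 < enorm y -> enorm ((enorm y)^-1 *: y) = 1.
Proof.
move=> y0; rewrite enormZ ger0_norm ?invr_ge0 ?enorm_ge0//.
by rewrite mulVf// gt_eqF.
Qed.

(* [sint_nn] is an integral over the punctured unit ball of the extension of the
   integrand that is constant along rays. *)
Definition radext (R : realType) (n : nat) (g : 'rV[R]_n -> R) (y : 'rV[R]_n) : R :=
  if (0 < enorm y) && (enorm y <= 1) then g ((enorm y)^-1 *: y) else 0.

(** The measurability clause of [L2_sphere], for one real component. *)
Definition sphere_measurable (R : realType) (n : nat) (g : 'rV[R]_n -> R) : Prop :=
  forall U : set R, open U -> borelN n (@sphere R n `&` g @^-1` U).

(** Functions on the sphere are uncontrolled elsewhere; extension by 0 makes them Borel on the whole
    space. *)
Definition sphere_ext (R : realType) (n : nat) (g : 'rV[R]_n -> R) (w : 'rV[R]_n) : R :=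
  if enorm w == 1 then g w else 0.

Lemma measurable_sphere (R : realType) (n : nat) :
  measurable (@sphere R n : set (rvT R n)).
Proof.
rewrite (_ : sphere n = (fun x : rvT R n => enorm x) @^-1` [set 1])//.
rewrite -[X in measurable X]setTI.
by have := @measurable_enorm _ (rvT R n) R n id (@measurable_id _ _ _); apply.
Qed.

Lemma measurable_sphere_ext (R : realType) (n : nat) (g : 'rV[R]_n -> R) :
  sphere_measurable g -> measurable_fun setT (sphere_ext g : rvT R n -> R).
Proof.
move=> mg; apply: (measurability _ (RGenOpens.measurableE R)) => _ [_ [a [b ->] <-]].
rewrite setTI.
have mS := @measurable_sphere R n.
have mgU : measurable (sphere n `&` g @^-1` `]a, b[%classic : set (rvT R n)).
  by apply: mg; exact: interval_open.
have [ab0|ab0] := pselect (`]a, b[%classic (0 : R)).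
  rewrite (_ : _ @^-1` _ = (sphere n `&` g @^-1` `]a, b[%classic) `|` ~` sphere n).
    by apply: measurableU => //; exact: measurableC.
  apply/seteqP; split=> w; rewrite /preimage /= /sphere_ext /sphere /=.
    by case: eqP => [w1 H|w1 _]; [left|right].
  by case: eqP => [w1 [[_ H]//|//]|_ _].
rewrite (_ : _ @^-1` _ = sphere n `&` g @^-1` `]a, b[%classic)//.
apply/seteqP; split=> w; rewrite /preimage /= /sphere_ext /sphere /=.
  by case: eqP.
by move=> [-> ]; rewrite eqxx.
Qed.

Lemma measurable_le1_indic (d : measure_display) (T : measurableType d) (R : realType)
    (f : T -> R) : measurable_fun setT f ->
  measurable_fun setT (fun t => (f t <= 1)%R%:R : R).
Proof.
move=> mf; rewrite [X in measurable_fun _ X](_ : _ = (fun t => if f t <= 1 then 1 else 0)).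
  by apply: measurable_fun_ifT => //; exact: measurable_fun_ler.
by apply/funext => t; case: ifP.
Qed.

Lemma radextE (R : realType) (n : nat) (g : 'rV[R]_n -> R) (y : 'rV[R]_n) :
  radext g y = (0 < enorm y)%R%:R * (enorm y <= 1)%R%:R *
    sphere_ext g ((enorm y)^-1 *: y).
Proof.
rewrite /radext /sphere_ext; case: ltP => [y0|_] /=; last by rewrite !mul0r.
by rewrite enorm_normalize// eqxx mul1r; case: ifP => _; rewrite ?mul1r ?mul0r.
Qed.

Lemma measurable_radext (R : realType) (n : nat) (g : 'rV[R]_n -> R) :
  sphere_measurable g -> measurable_fun setT (radext g : rvT R n -> R).
Proof.
move=> mg; rewrite (funext (radextE g)).
have mS := measurable_sphere_ext mg.
apply: measurable_mul.
  apply: measurable_mul; first by mfun.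
  by apply: measurable_le1_indic; mfun.
apply: (measurableT_comp mS (_ : measurable_fun setT
  (fun y : rvT R n => (enorm y)^-1 *: (y : 'rV[R]_n) : rvT R n))).
by mfun => y; exact: enorm_ge0.
Qed.

Lemma sphere_measurable_of (R : realType) (n : nat) (g : rvT R n -> R) :
  measurable_fun setT g -> @sphere_measurable R n g.
Proof.
move=> mg U oU.
(* A conversion: [borelN] is the sigma-algebra of [rvT]. *)
suff : measurable (sphere n `&` g @^-1` U : set (rvT R n)) by [].
apply: measurableI; first exact: measurable_sphere.
by rewrite -[X in measurable X]setTI; apply: mg => //; exact: open_measurable.
Qed.

Lemma sphere_measurableM (R : realType) (n : nat) (g : 'rV[R]_n -> R) (h : rvT R n -> R) :
  sphere_measurable g -> measurable_fun setT h ->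
  sphere_measurable (fun w : 'rV[R]_n => g w * h w).
Proof.
move=> mg mh U oU.
have := @sphere_measurable_of R n (fun w => sphere_ext g w * h w).
move=> /(_ (measurable_mul (measurable_sphere_ext mg) mh) U oU).
rewrite [X in borelN _ X -> _](_ : _ = sphere n `&` (fun w : 'rV[R]_n => g w * h w) @^-1` U)//.
apply/seteqP; split=> w [/= w1]; rewrite /sphere_ext w1 eqxx.
  by [].
by [].
Qed.

Lemma sphere_measurable_comp (R : realType) (n : nat) (g : 'rV[R]_n -> R) (h : R -> R) :
  sphere_measurable g -> continuous h -> sphere_measurable (fun w => h (g w)).
Proof.
move=> mg ch U oU; apply: (mg (h @^-1` U)).
by apply: open_comp => // x _; exact: ch.
Qed.

Lemma sphere_measurableD (R : realType) (n : nat) (g h : 'rV[R]_n -> R) :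
  sphere_measurable g -> sphere_measurable h ->
  sphere_measurable (fun w => g w + h w).
Proof.
move=> mg mh U oU.
have := @sphere_measurable_of R n (fun w => sphere_ext g w + sphere_ext h w).
move=> /(_ (measurable_add (measurable_sphere_ext mg) (measurable_sphere_ext mh)) U oU).
rewrite [X in borelN _ X -> _](_ : _ = sphere n `&` (fun w : 'rV[R]_n => g w + h w) @^-1` U)//.
by apply/seteqP; split=> w [/= w1]; rewrite /sphere_ext w1 eqxx.
Qed.

Lemma radext_ge0 (R : realType) (n : nat) (g : 'rV[R]_n -> R) y :
  (forall w, 0 <= g w) -> 0 <= radext g y.
Proof. by move=> g0; rewrite /radext; case: ifP. Qed.

Lemma sint_nnE (R : realType) (n : nat) (g : 'rV[R]_n -> R) :
  sphere_measurable g -> (forall w, 0 <= g w) ->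
  sint_nn (fun w => (g w)%:E) = (n%:R%:E * \int[mun R n]_y (radext g y)%:E)%E.
Proof.
move=> mg g0; rewrite /sint_nn -iintE.
- by congr (_ * iint _ _)%E; apply/funext => y; rewrite /radext; case: ifP.
- by apply: measurable_EFin_comp; exact: measurable_radext.
- by move=> y; rewrite lee_fin radext_ge0.
Qed.

(** Integrability makes both parts finite, so that [fine] does not return its default value at
    infinity and the difference is a genuine integral. *)
Lemma sintE (R : realType) (n : nat) (g : 'rV[R]_n -> R) :
  sphere_measurable g -> (mun R n).-integrable setT (EFin \o radext g) ->
  sint g = n%:R * \int[mun R n]_y radext g y.
Proof.
move=> mg ig; rewrite /sint sint_nnE; last 2 first.
- apply: (sphere_measurable_comp (h := fun z => Num.max z 0)) => //.
  by move=> z; apply: continuous_max; [exact: cvg_id|exact: cvg_cst].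
- by move=> w; rewrite le_max lexx orbT.
rewrite sint_nnE; last 2 first.
- apply: (sphere_measurable_comp (h := fun z => Num.max (- z) 0)) => //.
  by move=> z; apply: continuous_max; [exact: opp_continuous|exact: cvg_cst].
- by move=> w; rewrite le_max lexx orbT.
have E1 : (\int[mun R n]_y (radext (fun w => Num.max (g w) 0) y)%:E =
    \int[mun R n]_y (EFin \o radext g)^\+ y)%E.
  apply: eq_integral => y _; rewrite funeposE /= /radext.
  by case: ifP => _; rewrite ?EFin_max ?maxxx.
have E2 : (\int[mun R n]_y (radext (fun w => Num.max (- g w) 0) y)%:E =
    \int[mun R n]_y (EFin \o radext g)^\- y)%E.
  apply: eq_integral => y _; rewrite funenegE /= /radext.
  by case: ifP => _; rewrite ?EFin_max ?oppe0 ?oppr0 ?maxxx.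
have fp := integrable_pos_fin_num measurableT ig.
have fn := integrable_neg_fin_num measurableT ig.
by rewrite E1 E2 !fineM//= -mulrBr -fineB// /Rintegral [in RHS]integralE.
Qed.

Lemma iint_box (R : realType) (n : nat) (c : R) : 0 <= c ->
  iint n (fun v : 'rV[R]_n => ([forall i, `|v 0 i| <= c])%:R%:E) = ((2 * c) ^+ n)%:E.
Proof.
move=> c0; elim: n => [|n IH].
  by rewrite /= expr0; congr (_%:E); case: forallP => // H; exfalso; apply: H => -[].
have E (t : R) (v : 'rV[R]_n) : ([forall i, `|vcons t v 0 i| <= c] : bool) =
    (`|t| <= c) && [forall i, `|v 0 i| <= c].
  apply/forallP/andP => [H|[H1 /forallP H2] i].
    split; first by have := H ord0; rewrite vcons_ord0.
    by apply/forallP => i; have := H (lift ord0 i); rewrite mxE liftK.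
  by rewrite mxE; case: unliftP => [j _|_].
transitivity (\int[leb R]_t ((2 * c) ^+ n * (\1_(`[- c, c]%classic : set R) t))%:E)%E.
  apply: eq_integral => t _.
  rewrite [LHS](_ : _ = iint n (fun v : 'rV[R]_n => ((`|t| <= c)%R && [forall i, `|v 0 i| <= c])%:R%:E)); last first.
    by congr (iint n _); apply/funext => v; rewrite E.
  rewrite indicE mem_setE in_itv/= -ler_norml.
  case: (`|t| <= c) => /=; first by rewrite IH mulr1.
  rewrite mulr0.
  have z k : iint k (fun=> 0%E : \bar R) = 0%E :> \bar R.
    by elim: k => //= k IHk; apply: integral0_eq => s _; exact: IHk.
  exact: z.
under eq_integral do rewrite EFinM.
rewrite ge0_integralZl//; last 2 first.
- by apply/measurable_EFinP; exact: measurable_indic.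
- by rewrite lee_fin exprn_ge0// mulr_ge0.
rewrite integral_indic//= setIT lebesgue_measure_itv/= lte_fin.
case: ifPn => [_|]; first by rewrite -EFinD -EFinM exprSr; congr EFin; lra.
rewrite -leNgt => H; have c00 : c = 0 by lra.
by rewrite mule0 c00 mulr0 exprS mul0r.
Qed.

(** The ball lies in the cube of side 2c, whose volume comes by iteration. The order c^n is the
    right one, and the horn estimates depend on it. *)
Lemma mun_ball_lty (R : realType) (n : nat) (c : R) : 0 <= c ->
  (\int[mun R n]_v ((enorm v <= c)%R%:R)%:E <= ((2 * c) ^+ n)%:E)%E.
Proof.
move=> c0; rewrite -(iint_box n c0) iintE//; last first.
  apply: measurable_EFin_comp.
  (* A finite product of one-coordinate indicators is visibly measurable. *)
  have -> : (fun v : rvT R n => [forall i, `|(v : 'rV[R]_n) 0 i| <= c]%:R : R) =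
     (fun v => \prod_(i < n) (if `|(v : 'rV[R]_n) 0 i| <= c then 1 else 0)).
    apply/funext => v; case: forallP => H.
      by rewrite big1// => i _; rewrite H.
    move/existsNP: H => [i /negP Hi]; rewrite (bigD1 i)//= ifN ?mul0r//.
  apply: measurable_prod => i _; apply: measurable_fun_ifT => //.
  apply: measurable_fun_ler => //.
  by apply: (measurable_continuous_comp (h := Num.norm)); [exact: norm_continuous|exact: measurable_coord_rv].
apply: ge0_le_integral => //.
- apply: measurable_EFin_comp.
  rewrite [X in measurable_fun _ X](_ : _ = (fun t => if enorm t <= c then 1 else 0)).
    by apply: measurable_fun_ifT => //; apply: measurable_fun_ler => //; mfun.
  by apply/funext => t; case: ifP.
- apply: measurable_EFin_comp.
  have -> : (fun v : rvT R n => [forall i, `|(v : 'rV[R]_n) 0 i| <= c]%:R : R) =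
     (fun v => \prod_(i < n) (if `|(v : 'rV[R]_n) 0 i| <= c then 1 else 0)).
    apply/funext => v; case: forallP => H.
      by rewrite big1// => i _; rewrite H.
    move/existsNP: H => [i /negP Hi]; rewrite (bigD1 i)//= ifN ?mul0r//.
  apply: measurable_prod => i _; apply: measurable_fun_ifT => //.
  apply: measurable_fun_ler => //.
  by apply: (measurable_continuous_comp (h := Num.norm)); [exact: norm_continuous|exact: measurable_coord_rv].
- move=> v _; rewrite lee_fin; case: (leP (enorm v) c) => [vc|_] //=.
  rewrite (_ : [forall i, _] = true)//; apply/forallP => i.
  exact: le_trans (norm_coord_le_enorm _ _) vc.
Qed.

(** J(0) is the mass by which the average over rotations is normalized. *)
Lemma cosInt0_gt0 (R : realType) (n : nat) : 0 < cosInt (fun u : R => cos u ^+ n) 0.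
Proof.
have cc := @continuous_cosX R n.
have ci := integrable_atan cc (@norm_cosX_le1 R n).
rewrite /cosInt (_ : Rintegral _ _ _ = \int[leb R]_s (cos (atan s) ^+ n / (1 + s ^+ 2))); last first.
  by apply: eq_Rintegral => s _; rewrite mul0r cos0 mul1r.
have pos (s : R) : 0 < cos (atan s) ^+ n / (1 + s ^+ 2).
  by rewrite divr_gt0 ?sqr1D_gt0// exprn_gt0// cos_atan invr_gt0 sqrtr_gt0 sqr1D_gt0.
(* The minimum of the integrand on [0, 1], taken at s = 1. *)
pose k : R := (Num.sqrt 2)^-1 ^+ n / 2.
have k0 : 0 < k by rewrite divr_gt0// exprn_gt0// invr_gt0 sqrtr_gt0.
apply: (lt_le_trans k0).
have kE : k = \int[leb R]_(s in `[0, 1]) k.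
  rewrite /Rintegral integral_cst//= lebesgue_measure_itv/= lte_fin ltr01.
  by rewrite oppr0 adde0 mule1.
rewrite [leLHS]kE /Rintegral fine_le//.
- rewrite integral_cst//= lebesgue_measure_itv/= lte_fin ltr01.
  by rewrite oppr0 adde0 mule1.
- by have := integrable_fin_num measurableT ci.
apply: (@le_trans _ _ (\int[leb R]_(s in `[0%R, 1%R]) (cos (atan s) ^+ n / (1 + s ^+ 2))%:E)%E).
  apply: ge0_le_integral => //.
  - by move=> s _; rewrite lee_fin ltW.
  - by apply: measurable_funTS; have /integrableP[] := ci.
  - move=> s /=; rewrite in_itv/= => /andP[s0 s1]; rewrite lee_fin /k.
    have s2 : 1 + s ^+ 2 <= 2 by rewrite expr2; nra.
    rewrite ler_pM ?exprn_ge0 ?invr_ge0 ?sqrtr_ge0//.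
      rewrite lerXn2r ?nnegrE ?invr_ge0 ?sqrtr_ge0//.
        by rewrite cos_atan invr_ge0 sqrtr_ge0.
      by rewrite cos_atan lef_pV2 ?posrE ?sqrtr_gt0 ?sqr1D_gt0// ler_sqrt.
    by rewrite lef_pV2 ?posrE ?sqr1D_gt0.
apply: ge0_subset_integral => //.
- by have /integrableP[] := ci.
- by move=> s _; rewrite lee_fin ltW.
Qed.

(** * Averaging over the rotations of the last block *)

Definition polar_weight (R : realType) (m n : nat)
    (z : (rvT R m * measurableTypeR R) * measurableTypeR R) : R :=
  radial_weight n.+2 z.1.2 * slope_weight n.+2 z.2.

Lemma measurable_polar_weight (R : realType) (m n : nat) :
  measurable_fun setT (@polar_weight R m n).
Proof.
apply: measurable_mul; first by apply: measurable_radial_weight; mfun.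
by apply: measurable_slope_weight; mfun.
Qed.

Lemma polar_weight_ge0 (R : realType) (m n : nat) z : 0 <= @polar_weight R m n z.
Proof. by rewrite mulr_ge0 ?radial_weight_ge0 ?slope_weight_ge0. Qed.

(** The coordinates (u, r, s): the first block is kept, the last one is described by zonal
    coordinates around x. The constant is the same for all x and F, so it enters both sides of the
    averaged estimate alike. *)
Lemma integral_mun_add_zonal (R : realType) (m n : nat) :
  exists2 c : R, 0 <= c & forall (x : 'rV[R]_n.+2)
    (F : rvT R m * (measurableTypeR R * measurableTypeR R) -> \bar R),
  measurable_fun setT F -> (forall z, (0 <= F z)%E) ->
  (\int[mun R (m + n.+2)]_y F (lsubmx y, (enorm (rsubmx y), dotv x (rsubmx y))) =
   \int[sfprod (sfprod (mun R m) (leb R)) (leb R)]_z ((c * polar_weight n z)%:E *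
      F (z.1.1, (z.1.2, enorm x * (z.1.2 * slope z.2))%R)))%E.
Proof.
have [c c0 H] := integral_zonal R n; exists c => // x F mF F0.
have mS : measurable_fun setT (fun z : (rvT R m * measurableTypeR R) * measurableTypeR R => slope z.2).
  by apply: measurable_slope; mfun.
have mPhi : measurable_fun setT (fun z : (rvT R m * measurableTypeR R) * measurableTypeR R =>
    F (z.1.1, (z.1.2, enorm x * (z.1.2 * slope z.2))%R)).
  apply: measurable_pair_comp; [exact: mF|by mfun|].
  apply: measurable_fun_pair; first by mfun.
  by apply: measurable_mul; [mfun|apply: measurable_mul; [mfun|exact: mS]].
pose Q (z : (rvT R m * measurableTypeR R) * measurableTypeR R) : \bar R :=
  ((c * polar_weight n z)%:E * F (z.1.1, (z.1.2, enorm x * (z.1.2 * slope z.2))%R))%E.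
have mQ : measurable_fun setT Q.
  apply: measurable_emul; last exact: mPhi.
  apply: measurable_EFin_comp; apply: measurable_mul; first by mfun.
  exact: measurable_polar_weight.
have Q0 z : (0 <= Q z)%E.
  by rewrite /Q mule_ge0 ?F0// lee_fin mulr_ge0 ?polar_weight_ge0.
have mQ1 : measurable_fun setT (fubini_F (leb R) Q).
  exact: (measurable_fun_fubini_tonelli_F (m2 := leb R) Q mQ Q0).
have Q10 z : (0 <= fubini_F (leb R) Q z)%E by apply: integral_ge0 => s _; exact: Q0.
rewrite -[RHS]/(\int[(sfprod (mun R m) (leb R) \x leb R)%E]_z Q z)%E.
rewrite (fubini_tonelli1 Q mQ Q0).
rewrite -[RHS]/(\int[(mun R m \x leb R)%E]_z fubini_F (leb R) Q z)%E.
rewrite (fubini_tonelli1 (fubini_F (leb R) Q) mQ1 Q10).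
have mL : measurable_fun setT (fun y : rvT R (m + n.+2) =>
    F (lsubmx (y : 'rV[R]_(m + n.+2)), (enorm (rsubmx y), dotv x (rsubmx y)))).
  have m1 : measurable_fun setT (fun y : rvT R (m + n.+2) =>
      lsubmx (y : 'rV[R]_(m + n.+2)) : rvT R m) by mfun.
  have m2 : measurable_fun setT (fun y : rvT R (m + n.+2) =>
      (enorm (rsubmx (y : 'rV[R]_(m + n.+2))), dotv x (rsubmx (y : 'rV[R]_(m + n.+2)))) :
      measurableTypeR R * measurableTypeR R).
    by apply: measurable_fun_pair; mfun.
  exact: measurable_pair_comp mF m1 m2.
rewrite (ge0_integral_mun_add mL (fun=> F0 _)).
apply: eq_integral => u _.
pose Fu (z : measurableTypeR R * measurableTypeR R) : \bar R := F (u, z).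
have mFu : measurable_fun setT Fu.
  exact: (measurable_pair_comp (f := cst u) (g := id) mF (measurable_cst _) (@measurable_id _ _ _)).
have Fu0 z : (0 <= Fu z)%E by exact: F0.
transitivity (\int[mun R n.+2]_v Fu (enorm v, dotv x v))%E.
  by apply: eq_integral => v _; rewrite row_mxKl row_mxKr.
rewrite (H x Fu mFu Fu0).
have mi (r : R) : measurable_fun setT (fun s : measurableTypeR R =>
    (Fu (r, enorm x * (r * slope s))%R * (slope_weight n.+2 s)%:E)%E).
  apply: measurable_emul; last first.
    by apply: measurable_EFin_comp; apply: measurable_slope_weight; mfun.
  apply: measurable_pair_comp; [exact: mFu|by mfun|].
  by mfun => s; exact: sqrtr_ge0.
have i0 (r s : R) : (0 <= Fu (r, enorm x * (r * slope s))%R * (slope_weight n.+2 s)%:E)%E.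
  by rewrite mule_ge0 ?Fu0// lee_fin slope_weight_ge0.
pose q (z : measurableTypeR R * measurableTypeR R) : \bar R :=
  (Fu (z.1, enorm x * (z.1 * slope z.2))%R * (slope_weight n.+2 z.2)%:E)%E.
have mq : measurable_fun setT q.
  apply: measurable_emul; last first.
    by apply: measurable_EFin_comp; apply: measurable_slope_weight; mfun.
  apply: measurable_pair_comp; [exact: mFu|by mfun|].
  by mfun => s; exact: sqrtr_ge0.
have q0 z : (0 <= q z)%E by exact: i0.
have mqF := measurable_fun_fubini_tonelli_F (m2 := leb R) q mq q0.
rewrite -ge0_integralZl; last 4 first.
- exact: measurableT.
- apply: measurable_emul; last exact: mqF.
  by apply: measurable_EFin_comp; apply: measurable_radial_weight; mfun.
- move=> r _; rewrite mule_ge0 ?lee_fin ?radial_weight_ge0//.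
  by apply: integral_ge0 => s _; exact: i0.
- by rewrite lee_fin.
apply: eq_integral => r _; rewrite muleA -EFinM -ge0_integralZl; last 4 first.
- exact: measurableT.
- exact: mi.
- by move=> s _; exact: i0.
- by rewrite lee_fin mulr_ge0 ?radial_weight_ge0.
apply: eq_integral => s _; rewrite /Q /polar_weight /= /Fu (muleC _ (slope_weight _ _)%:E) muleA -EFinM.
by rewrite -mulrA.
Qed.

(** The zonal formula concerns nonnegative integrands; a signed one passes through its positive and
    negative parts, which commute with a nonnegative weight. *)
Lemma funepos_scale (R : realType) (T : Type) (a : T -> R) (f : T -> R) : (forall z, 0 <= a z) ->
  ((EFin \o (fun z => (a z * f z)%R))^\+)%E = (fun z => ((a z)%:E * (EFin \o f)^\+ z)%E).
Proof.
move=> a0; apply/funext => z; rewrite !funeposE.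
change (maxe (a z * f z)%:E 0%:E = (a z)%:E * maxe (f z)%:E 0%:E)%E.
rewrite -!EFin_max -EFinM; congr EFin.
by rewrite maxr_pMr// mulr0.
Qed.

Lemma funeneg_scale (R : realType) (T : Type) (a : T -> R) (f : T -> R) : (forall z, 0 <= a z) ->
  ((EFin \o (fun z => (a z * f z)%R))^\-)%E = (fun z => ((a z)%:E * (EFin \o f)^\- z)%E).
Proof.
move=> a0; apply/funext => z; rewrite !funenegE.
change (maxe (- (a z * f z))%:E 0%:E = (a z)%:E * maxe (- f z)%:E 0%:E)%E.
rewrite -!EFin_max -EFinM; congr EFin.
by rewrite maxr_pMr// mulr0 mulrN.
Qed.

Lemma Rintegral_oddT (R : realType) (f : R -> R) :
  measurable_fun setT f -> (forall s, f (- s) = - f s) ->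
  (leb R).-integrable setT (EFin \o f) -> \int[leb R]_s f s = 0.
Proof.
move=> mf odd fi.
have mfp : measurable_fun setT ((EFin \o f)^\+)%E.
  by apply: measurable_funepos; exact: measurable_EFin_comp.
rewrite /Rintegral integralE.
have -> : (\int[leb R]_s ((EFin \o f)^\- s) = \int[leb R]_s ((EFin \o f)^\+ s))%E.
  rewrite -(ge0_integral_oppr mfp (fun=> funepos_ge0 _ _)).
  by apply: eq_integral => s _; rewrite funenegE funeposE /= odd.
by rewrite subee// (integrable_pos_fin_num measurableT fi).
Qed.

(** Here the plane wave becomes the kernel: expand cos(A + l sigma) with sigma = sin(atan s); the
    term with sin(l sigma) is odd in s and integrates to 0. *)
Lemma integral_cos_slope (R : realType) (n : nat) (A l : R) :
  (leb R).-integrable setT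
    (EFin \o (fun s : R => cos (A + l * slope s) * slope_weight n.+2 s)) /\
  \int[leb R]_s (cos (A + l * slope s) * slope_weight n.+2 s) =
  cos A * cosInt (fun u => cos u ^+ n) l.
Proof.
have E (s : R) : cos (A + l * slope s) * slope_weight n.+2 s =
    cos A * (cos (l * sin (atan s)) * cos (atan s) ^+ n / (1 + s ^+ 2)) -
    sin A * (sin (l * sin (atan s)) * cos (atan s) ^+ n / (1 + s ^+ 2)).
  by rewrite slope_weightE /slope -sin_atan cosD; ring.
have cc := @continuous_cosX R n.
have c1 := @norm_cosX_le1 R n.
have I1 : (leb R).-integrable setT (EFin \o (fun s : R =>
    cos (l * sin (atan s)) * cos (atan s) ^+ n / (1 + s ^+ 2))).
  apply: (integrable_atan (g := fun u => cos (l * sin u) * cos u ^+ n) (M := 1)).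
    exact: continuous_cosM.
  by move=> u; rewrite norm_le1M ?norm_cos_le1.
have I2 : (leb R).-integrable setT (EFin \o (fun s : R =>
    sin (l * sin (atan s)) * cos (atan s) ^+ n / (1 + s ^+ 2))).
  apply: (integrable_atan (g := fun u => sin (l * sin u) * cos u ^+ n) (M := 1)).
    exact: continuous_sinM.
  by move=> u; rewrite norm_le1M ?norm_sin_le1.
have J1 : (leb R).-integrable setT (EFin \o (fun s : R =>
    cos A * (cos (l * sin (atan s)) * cos (atan s) ^+ n / (1 + s ^+ 2)))).
  by have := integrableZl measurableT (cos A) I1; apply: eq_integrable.
have J2 : (leb R).-integrable setT (EFin \o (fun s : R =>
    sin A * (sin (l * sin (atan s)) * cos (atan s) ^+ n / (1 + s ^+ 2)))).
  by have := integrableZl measurableT (sin A) I2; apply: eq_integrable.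
split.
  have := integrableB measurableT J1 J2; apply: eq_integrable => // s _.
  by rewrite /= -EFinB -E.
transitivity (\int[leb R]_s (
    cos A * (cos (l * sin (atan s)) * cos (atan s) ^+ n / (1 + s ^+ 2)) -
    sin A * (sin (l * sin (atan s)) * cos (atan s) ^+ n / (1 + s ^+ 2)))).
  by apply: eq_Rintegral => s _; exact: E.
rewrite RintegralB// RintegralZl// RintegralZl// [X in _ - _ * X](_ : _ = 0).
  by rewrite mulr0 subr0.
apply: Rintegral_oddT => //.
  by have /integrableP[/measurable_EFinP] := I2.
by move=> s; rewrite atanN sinN cosN sqrrN mulrN sinN !mulNr.
Qed.

(* A function invariant under rotations of the last block is determined by its values at
   points whose last block lies on the first axis. *)
Definition axial (R : realType) (m n : nat) (u : 'rV[R]_m) (r : R) : 'rV[R]_(m + n.+1) :=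
  row_mx u (r *: delta_mx 0 ord0).

Lemma measurable_axial (R : realType) (m n : nat) (d : measure_display) (T : measurableType d)
    (u : T -> rvT R m) (r : T -> R) : measurable_fun setT u -> measurable_fun setT r ->
  measurable_fun setT (fun t => axial n (u t) (r t) : rvT R (m + n.+1)).
Proof. by move=> mu mr; mfun. Qed.

Lemma row_normalize (R : realType) (m k : nat) (y : 'rV[R]_(m + k)) (c : R) :
  c *: y = row_mx (c *: lsubmx y) (c *: rsubmx y).
Proof. by rewrite -{1}(hsubmxK y) scale_row_mx. Qed.

(** The cut-off of [radext], expressed by the lengths of the two blocks. *)
Definition disk (R : realType) (a b : R) : R :=
  (0 < Num.sqrt (a ^+ 2 + b ^+ 2))%R%:R * (Num.sqrt (a ^+ 2 + b ^+ 2) <= 1)%R%:R.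

Lemma disk_ge0 (R : realType) (a b : R) : 0 <= disk a b.
Proof. by rewrite mulr_ge0. Qed.

Lemma measurable_disk (R : realType) (d : measure_display) (T : measurableType d)
    (a b : T -> R) : measurable_fun setT a -> measurable_fun setT b ->
  measurable_fun setT (fun t => disk (a t) (b t)).
Proof.
move=> ma mb; apply: measurable_mul; first by mfun.
by apply: measurable_le1_indic; mfun.
Qed.

Lemma radext_axialE (R : realType) (m n : nat) (g : 'rV[R]_(m + n.+1) -> R)
    (h : 'rV[R]_m -> R -> R -> R) (x y : 'rV[R]_(m + n.+1)) :
  (forall w, enorm w = 1 -> g w = g (axial n (lsubmx w) (enorm (rsubmx w)))) ->
  let rho := Num.sqrt (enorm (lsubmx y) ^+ 2 + enorm (rsubmx y) ^+ 2) in
  radext (fun w => g w * h (lsubmx w) (enorm (rsubmx w)) (dotv (rsubmx x) (rsubmx w))) y =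
  disk (enorm (lsubmx y)) (enorm (rsubmx y)) *
    (sphere_ext (fun w => g (axial n (lsubmx w) (enorm (rsubmx w))))
        (axial n (rho^-1 *: lsubmx y) (rho^-1 * enorm (rsubmx y))) *
     h (rho^-1 *: lsubmx y) (rho^-1 * enorm (rsubmx y)) (rho^-1 * dotv (rsubmx x) (rsubmx y))).
Proof.
move=> ginv /=; rewrite -enorm_row /radext /disk -enorm_row.
case: ltP => [y0|_] /=; last by rewrite !mul0r.
case: ifP => _; last by rewrite !(mul0r, mulr0).
have i0 : 0 <= (enorm y)^-1 by rewrite invr_ge0 enorm_ge0.
have lE : lsubmx ((enorm y)^-1 *: y) = (enorm y)^-1 *: lsubmx y.
  by rewrite row_normalize row_mxKl.
have rvE : rsubmx ((enorm y)^-1 *: y) = (enorm y)^-1 *: rsubmx y.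
  by rewrite row_normalize row_mxKr.
have rE : enorm (rsubmx ((enorm y)^-1 *: y)) = (enorm y)^-1 * enorm (rsubmx y).
  by rewrite rvE enormZ ger0_norm.
have e1 : enorm (delta_mx 0 ord0 : 'rV[R]_n.+1) = 1.
  rewrite /enorm /dotv (bigD1 ord0)//= big1 ?addr0 => [|i i0']; rewrite !mxE ?eqxx ?mulr1 ?sqrtr1//.
  by rewrite (negbTE i0') mul0r.
have a0 : 0 <= (enorm y)^-1 * enorm (rsubmx y) by rewrite mulr_ge0 ?enorm_ge0.
have aE : enorm (axial n ((enorm y)^-1 *: lsubmx y) ((enorm y)^-1 * enorm (rsubmx y))) = 1.
  rewrite enorm_row row_mxKl row_mxKr !enormZ e1 mulr1 (ger0_norm a0) (ger0_norm i0) !exprMn -mulrDr.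
  rewrite -[X in _ * X]sqr_sqrtr ?addr_ge0 ?sqr_ge0// -enorm_row -exprMn mulVf ?expr1n ?sqrtr1//.
  by rewrite gt_eqF.
rewrite !mul1r ginv ?enorm_normalize// rE lE rvE dotvZr /sphere_ext aE eqxx.
by rewrite /axial row_mxKl row_mxKr enormZ e1 mulr1 (ger0_norm a0).
Qed.

Lemma continuous_cosInt (R : realType) (n : nat) :
  continuous (cosInt (fun u : R => cos u ^+ n)).
Proof.
move=> l; apply/differentiable_continuous/derivable1_diffP.
by have := is_derive_cosInt (@continuous_cosX R n) (@norm_cosX_le1 R n) l; case.
Qed.

Lemma integral_slope_weight (R : realType) (n : nat) :
  (\int[leb R]_s (slope_weight n.+2 s)%:E = (cosInt (fun u : R => cos u ^+ n) 0)%:E)%E.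
Proof.
have [_ E] := integral_cos_slope n (0 : R) 0.
rewrite cos0 mul1r in E; rewrite -E /Rintegral fineK.
  by apply: eq_integral => s _; rewrite mul0r addr0 cos0 mul1r.
rewrite ge0_fin_numE; last first.
  by apply: integral_ge0 => s _; rewrite mul0r addr0 cos0 mul1r lee_fin slope_weight_ge0.
rewrite (_ : (\int[leb R]_s _)%E = \int[leb R]_s (slope_weight n.+2 s)%:E)%E.
  exact: integral_slope_weight_lty.
by apply: eq_integral => s _; rewrite mul0r addr0 cos0 mul1r.
Qed.

(** The integrand of [radext] as a function of z = (u, (|v|, x''.v)), u and v being the two blocks:
    the shape that the zonal formula accepts. *)
Definition axial_fun (R : realType) (m n : nat) (g : 'rV[R]_(m + n.+1) -> R)
    (h : 'rV[R]_m -> R -> R -> R)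
    (z : rvT R m * (measurableTypeR R * measurableTypeR R)) : R :=
  let rho := Num.sqrt (enorm z.1 ^+ 2 + z.2.1 ^+ 2) in
  disk (enorm z.1) z.2.1 *
    (sphere_ext (fun w => g (axial n (lsubmx w) (enorm (rsubmx w))))
        (axial n (rho^-1 *: z.1) (rho^-1 * z.2.1)) *
     h (rho^-1 *: z.1) (rho^-1 * z.2.1) (rho^-1 * z.2.2)).

Lemma measurable_axial_fun (R : realType) (m n : nat) (g : 'rV[R]_(m + n.+1) -> R)
    (h : rvT R m * (measurableTypeR R * measurableTypeR R) -> R) :
  sphere_measurable g ->
  (forall w, enorm w = 1 -> g w = g (axial n (lsubmx w) (enorm (rsubmx w)))) ->
  measurable_fun setT h ->
  measurable_fun setT (axial_fun g (fun u r t => h (u, (r, t)))).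
Proof.
move=> mg ginv mh.
(* By invariance, the axial values of g on the sphere are those of g itself, whose measurability is
   given. *)
have gE : sphere_ext (fun w => g (axial n (lsubmx w) (enorm (rsubmx w)))) = sphere_ext g.
  by apply/funext => w; rewrite /sphere_ext; case: eqP => // w1; rewrite [RHS]ginv.
rewrite /axial_fun gE.
have m1 : measurable_fun setT (fun z : rvT R m * (measurableTypeR R * measurableTypeR R) =>
    (Num.sqrt (enorm z.1 ^+ 2 + z.2.1 ^+ 2))^-1).
  by mfun => z; exact: sqrtr_ge0.
have mu : measurable_fun setT (fun z : rvT R m * (measurableTypeR R * measurableTypeR R) =>
    (Num.sqrt (enorm z.1 ^+ 2 + z.2.1 ^+ 2))^-1 *: (z.1 : 'rV[R]_m) : rvT R m).
  by apply: measurable_scale_rv; [exact: m1|mfun].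
have mr : measurable_fun setT (fun z : rvT R m * (measurableTypeR R * measurableTypeR R) =>
    (Num.sqrt (enorm z.1 ^+ 2 + z.2.1 ^+ 2))^-1 * z.2.1).
  by apply: measurable_mul; [exact: m1|mfun].
have mt : measurable_fun setT (fun z : rvT R m * (measurableTypeR R * measurableTypeR R) =>
    (Num.sqrt (enorm z.1 ^+ 2 + z.2.1 ^+ 2))^-1 * z.2.2).
  by apply: measurable_mul; [exact: m1|mfun].
apply: measurable_mul; first by apply: measurable_disk; mfun.
apply: measurable_mul.
  exact: (measurableT_comp (measurable_sphere_ext mg) (measurable_axial mu mr)).
have mrt : measurable_fun setT (fun z : rvT R m * (measurableTypeR R * measurableTypeR R) =>
   ((Num.sqrt (enorm z.1 ^+ 2 + z.2.1 ^+ 2))^-1 * z.2.1,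
    (Num.sqrt (enorm z.1 ^+ 2 + z.2.1 ^+ 2))^-1 * z.2.2) : measurableTypeR R * measurableTypeR R).
  by apply: measurable_fun_pair; [exact: mr|exact: mt].
exact: measurable_pair_comp mh mu mrt.
Qed.

Lemma radext_axial_fun (R : realType) (m n : nat) (g : 'rV[R]_(m + n.+1) -> R)
    (h : 'rV[R]_m -> R -> R -> R) (x y : 'rV[R]_(m + n.+1)) :
  (forall w, enorm w = 1 -> g w = g (axial n (lsubmx w) (enorm (rsubmx w)))) ->
  radext (fun w => g w * h (lsubmx w) (enorm (rsubmx w)) (dotv (rsubmx x) (rsubmx w))) y =
  axial_fun g h (lsubmx y, (enorm (rsubmx y), dotv (rsubmx x) (rsubmx y))).
Proof. by move=> ginv; rewrite radext_axialE. Qed.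

(** For fixed (u, r) only the cosine varies with s, and its s-integral is cos(A) J(l), bounded by
    |J(l)|. The right-hand integrand is constant in s up to the weight, so integration in s
    multiplies it by J(0), the factor on the left. *)
Lemma zonal_average (R : realType) (m n : nat) (x : 'rV[R]_(m + n.+2)) (d : R)
    (g : 'rV[R]_(m + n.+2) -> R) :
  let J := cosInt (fun u => cos u ^+ n) in
  sphere_measurable g ->
  (forall w, enorm w = 1 -> g w = g (axial n.+1 (lsubmx w) (enorm (rsubmx w)))) ->
  (mun R (m + n.+2)).-integrable setT (EFin \o radext g) ->
  ((J 0)%:E * `|\int[mun R (m + n.+2)]_y (radext (fun w => (g w * cos (dotv x w + d))%R) y)%:E| <=
   \int[mun R (m + n.+2)]_y
     (radext (fun w => (`|g w| * `|J (enorm (rsubmx x) * enorm (rsubmx w))|)%R) y)%:E)%E.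
Proof.
move=> J mg ginv gi.
have J0 : 0 < J 0 by exact: cosInt0_gt0.
have cJ : continuous J by exact: continuous_cosInt.
have [c c0 H] := integral_mun_add_zonal R m n.
set x1 := lsubmx x; set x2 := rsubmx x.
pose pi3 := sfprod (sfprod (mun R m) (leb R)) (leb R).
pose Gam (z : (rvT R m * measurableTypeR R) * measurableTypeR R) :
    rvT R m * (measurableTypeR R * measurableTypeR R) :=
  (z.1.1, (z.1.2, enorm x2 * (z.1.2 * slope z.2))).
have mGam : measurable_fun setT Gam.
  apply: measurable_fun_pair; first by mfun.
  apply: measurable_fun_pair; first by mfun.
  by mfun => z; exact: sqrtr_ge0.
have mcw : measurable_fun setT (fun z : (rvT R m * measurableTypeR R) * measurableTypeR R =>
    c * polar_weight n z).
  by apply: measurable_mul; [mfun|exact: measurable_polar_weight].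
have cw0 (z : (rvT R m * measurableTypeR R) * measurableTypeR R) : 0 <= c * polar_weight n z by rewrite mulr_ge0 ?polar_weight_ge0.
pose hc (z : rvT R m * (measurableTypeR R * measurableTypeR R)) : R :=
  cos (dotv x1 z.1 + z.2.2 + d).
have mhc : measurable_fun setT hc.
  by apply: (measurable_continuous_comp (h := @cos R)); [exact: continuous_cos|mfun].
pose hJ (z : rvT R m * (measurableTypeR R * measurableTypeR R)) : R :=
  `|J (enorm x2 * z.2.1)|.
have mhJ : measurable_fun setT hJ.
  apply: (measurable_continuous_comp (h := Num.norm)); first exact: norm_continuous.
  by apply: (measurable_continuous_comp (h := J)); [exact: cJ|mfun].
pose ga w := `|g w|.
have mga : sphere_measurable ga.
  exact: (sphere_measurable_comp mg (@norm_continuous _ R)).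
have gainv w : enorm w = 1 -> ga w = ga (axial n.+1 (lsubmx w) (enorm (rsubmx w))).
  by move=> w1; rewrite /ga -ginv.
pose f := axial_fun g (fun u r t => hc (u, (r, t))).
pose fJ := axial_fun ga (fun u r t => hJ (u, (r, t))).
have mf : measurable_fun setT f by exact: measurable_axial_fun.
have mfJ : measurable_fun setT fJ by exact: measurable_axial_fun.
pose P (y : 'rV[R]_(m + n.+2)) : rvT R m * (measurableTypeR R * measurableTypeR R) :=
  (lsubmx y, (enorm (rsubmx y), dotv x2 (rsubmx y))).
have fE y : radext (fun w => g w * cos (dotv x w + d)) y = f (P y).
  rewrite /f /P -(radext_axial_fun _ _ _ ginv); congr (radext _ y).
  by apply/funext => w; rewrite /hc /= dotv_row.
have fJE y : radext (fun w => `|g w| * `|J (enorm x2 * enorm (rsubmx w))|) y = fJ (P y).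
  by rewrite /fJ /P -(radext_axial_fun _ _ _ gainv).
have fJ0 z : 0 <= fJ z.
  rewrite mulr_ge0 ?disk_ge0// mulr_ge0 ?normr_ge0//.
  by rewrite /sphere_ext; case: ifP => // _; exact: normr_ge0.
pose Q z : R := (c * polar_weight n z) * f (Gam z).
have mQ : measurable_fun setT Q.
  by apply: measurable_mul; [exact: mcw|exact: measurableT_comp mf mGam].
(* Fubini for a signed integrand needs this; the zonal formula for |f| transports the integrability
   of g, as the cosine is at most 1. *)
have Qi : pi3.-integrable setT (EFin \o Q).
  apply/integrableP; split; first exact: measurable_EFin_comp.
  pose F z : \bar R := (`|f z|)%:E.
  have mF : measurable_fun setT F.
    apply: measurable_EFin_comp.
    by apply: (measurable_continuous_comp (h := Num.norm)); [exact: norm_continuous|exact: mf].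
  have F0 z : (0 <= F z)%E by rewrite lee_fin normr_ge0.
  rewrite (_ : (\int[pi3]_z _)%E = \int[mun R (m + n.+2)]_y F (P y))%E; last first.
    rewrite [RHS](H x2 F mF F0); apply: eq_integral => z _.
    by rewrite /Q /= normrM ger0_norm.
  have /integrableP[mrg] := gi; apply: le_lt_trans; apply: ge0_le_integral.
  - exact: measurableT.
  - by move=> y _; exact: F0.
  - have mP : measurable_fun setT (P : rvT R (m + n.+2) -> _).
      by apply: measurable_fun_pair; [mfun|apply: measurable_fun_pair; mfun].
    exact: measurableT_comp mF mP.
  - exact: measurableT_comp.
  - move=> y _; rewrite /F /= lee_fin -fE /radext; case: ifP => _; last by rewrite normr0.
    by rewrite normrM -[leRHS]mulr1 ler_wpM2l ?norm_cos_le1.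
have -> : (\int[mun R (m + n.+2)]_y (radext (fun w => (g w * cos (dotv x w + d))%R) y)%:E =
    \int[pi3]_z (EFin \o Q) z)%E.
  have mfe := measurable_EFin_comp mf.
  rewrite integralE [RHS]integralE (funepos_scale (f \o Gam) cw0) (funeneg_scale (f \o Gam) cw0).
  congr (_ - _)%E.
    transitivity (\int[mun R (m + n.+2)]_y ((fun z => (f z)%:E)^\+)%E (P y))%E.
      by apply: eq_integral => y _; rewrite !funeposE fE.
    transitivity (\int[pi3]_z ((c * polar_weight n z)%:E * ((fun z => (f z)%:E)^\+)%E (Gam z)))%E.
      exact: (H x2 _ (measurable_funepos mfe) (funepos_ge0 _)).
    by apply: eq_integral => z _; rewrite !funeposE.
  transitivity (\int[mun R (m + n.+2)]_y ((fun z => (f z)%:E)^\-)%E (P y))%E.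
    by apply: eq_integral => y _; rewrite !funenegE fE.
  transitivity (\int[pi3]_z ((c * polar_weight n z)%:E * ((fun z => (f z)%:E)^\-)%E (Gam z)))%E.
      exact: (H x2 _ (measurable_funeneg mfe) (funeneg_ge0 _)).
    by apply: eq_integral => z _; rewrite !funenegE.
pose FF (z : rvT R m * (measurableTypeR R * measurableTypeR R)) : \bar R := (fJ z)%:E.
have mFF : measurable_fun setT FF by exact: measurable_EFin_comp.
have FF0 z : (0 <= FF z)%E by rewrite lee_fin.
have -> : (\int[mun R (m + n.+2)]_y
     (radext (fun w => (`|g w| * `|J (enorm x2 * enorm (rsubmx w))|)%R) y)%:E =
    \int[pi3]_z ((c * polar_weight n z)%:E * FF (Gam z)))%E.
  by rewrite -[RHS](H x2 FF mFF FF0); apply: eq_integral => y _; rewrite fJE.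
pose QJ z : \bar R := ((c * polar_weight n z)%:E * FF (Gam z))%E.
have mQJ : measurable_fun setT QJ.
  apply: measurable_emul; first exact: measurable_EFin_comp.
  exact: measurableT_comp mFF mGam.
have QJ0 z : (0 <= QJ z)%E by rewrite /QJ mule_ge0 ?FF0// lee_fin.
rewrite -[leRHS]/(\int[(sfprod (mun R m) (leb R) \x leb R)%E]_z QJ z)%E.
rewrite (fubini_tonelli1 QJ mQJ QJ0).
have mQh := measurable_fubini_F (m1 := sfprod (mun R m) (leb R)) (m2 := leb R) Qi.
rewrite -(integral12_prod_meas1 (m1 := sfprod (mun R m) (leb R)) (m2 := leb R) Qi).
(* The absolute value enters only after the integration in s, so the oscillation is kept. *)
apply: (@le_trans _ _ ((J 0)%:E * \int[sfprod (mun R m) (leb R)]_p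
    `|fubini_F (leb R) (EFin \o Q) p|)%E).
  rewrite lee_wpmul2l ?lee_fin ?(ltW J0)//.
  exact: le_abse_integral.
have mabs : measurable_fun setT (fun p => `|fubini_F (leb R) (EFin \o Q) p|%E).
  exact: measurableT_comp.
rewrite -ge0_integralZl; last 4 first.
- exact: measurableT.
- exact: mabs.
- by move=> p _; exact: abse_ge0.
- by rewrite lee_fin ltW.
apply: ge0_le_integral.
- exact: measurableT.
- by move=> p _; rewrite mule_ge0 ?abse_ge0// lee_fin ltW.
- by apply: measurable_emul; [mfun|exact: mabs].
- exact: (measurable_fun_fubini_tonelli_F (m2 := leb R) QJ mQJ QJ0).
move=> [u r] _.
pose rho := Num.sqrt (enorm u ^+ 2 + r ^+ 2).
pose S := sphere_ext (fun w => g (axial n.+1 (lsubmx w) (enorm (rsubmx w))))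
        (axial n.+1 (rho^-1 *: (u : 'rV[R]_m)) (rho^-1 * r)).
pose A := dotv x1 (rho^-1 *: (u : 'rV[R]_m)) + d.
pose l := enorm x2 * (rho^-1 * r).
(* [w] and [S] collect the factors constant in s; [w] is nonnegative, [S] carries the sign of g. *)
pose w := c * radial_weight n.+2 r * disk (enorm u) r.
have w0 : 0 <= w.
  apply: mulr_ge0; last exact: disk_ge0.
  by apply: mulr_ge0; [exact: c0|exact: radial_weight_ge0].
have [Ii IE] := integral_cos_slope n A l.
have QE : fubini_F (leb R) (EFin \o Q) (u, r) = (w * S * (cos A * J l))%:E.
  transitivity (\int[leb R]_s ((w * S)%:E * (cos (A + l * slope s) * slope_weight n.+2 s)%:E))%E.
    apply: eq_integral => s _; rewrite /Q /f /axial_fun /Gam /polar_weight /= -/rho -/S /hc /=.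
    rewrite -EFinM; congr EFin.
    have -> : dotv x1 (rho^-1 *: (u : 'rV[R]_m)) + rho^-1 * (enorm x2 * (r * slope s)) + d = A + l * slope s.
      by rewrite /A /l; ring.
    by rewrite /w; ring.
  apply: etrans (integralZl measurableT Ii (w * S)) _.
  rewrite -/J in IE; rewrite -IE [RHS]EFinM; congr (_ * _)%E.
  by rewrite /Rintegral fineK//; exact: (integrable_fin_num measurableT Ii).
have QJE : fubini_F (leb R) QJ (u, r) = (w * `|S| * `|J l| * J 0)%:E.
  transitivity (\int[leb R]_s ((w * `|S| * `|J l|)%:E * (slope_weight n.+2 s)%:E))%E.
    apply: eq_integral => s _; rewrite /QJ /FF /fJ /axial_fun /Gam /polar_weight /= -/rho /hJ /=.
    rewrite -!EFinM; congr EFin.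
    have -> : sphere_ext (fun w => ga (axial n.+1 (lsubmx w) (enorm (rsubmx w))))
        (axial n.+1 (rho^-1 *: (u : 'rV[R]_m)) (rho^-1 * r)) = `|S|.
      by rewrite /S /sphere_ext; case: ifP => _; rewrite ?normr0.
    by rewrite /w /l; ring.
  rewrite ge0_integralZl.
  - by rewrite integral_slope_weight -EFinM.
  - exact: measurableT.
  - by apply: measurable_EFin_comp; apply: measurable_slope_weight; mfun.
  - by move=> s _; rewrite lee_fin slope_weight_ge0.
  - rewrite lee_fin; apply: mulr_ge0; last exact: normr_ge0.
    by apply: mulr_ge0; [exact: w0|exact: normr_ge0].
clearbody w S.
rewrite QE QJE -EFinM lee_fin mulrC ler_wpM2r ?(ltW J0)//.
rewrite !normrM (ger0_norm w0) mulrA ler_wpM2r//.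
by rewrite -[leRHS]mulr1 ler_wpM2l ?norm_cos_le1// mulr_ge0.
Qed.

(** * Decay of the Fourier transform of an invariant function *)

(** Integrate 2 a b |f g| <= a^2 f^2 + b^2 g^2 and choose a and b. *)
Lemma Rintegral_cauchy_schwarz (d : measure_display) (T : measurableType d) (R : realType)
    (mu : {measure set T -> \bar R}) (f g : T -> R) :
  measurable_fun setT f -> measurable_fun setT g ->
  mu.-integrable setT (EFin \o (fun t => f t ^+ 2)) ->
  mu.-integrable setT (EFin \o (fun t => g t ^+ 2)) ->
  mu.-integrable setT (EFin \o (fun t => f t * g t)) /\
  (\int[mu]_t `|f t * g t|) ^+ 2 <= (\int[mu]_t (f t ^+ 2)) * (\int[mu]_t (g t ^+ 2)).
Proof.
move=> mf mg if2 ig2.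
have mfg : measurable_fun setT (fun t => f t * g t) by exact: measurable_mul.
have ifg : mu.-integrable setT (EFin \o (fun t => f t * g t)).
  apply: (le_integrable measurableT _ _ (integrableD measurableT if2 ig2)).
    exact: measurable_EFin_comp.
  move=> t _; rewrite /= lee_fin [leRHS]ger0_norm ?addr_ge0 ?sqr_ge0//.
  rewrite ler_norml; apply/andP; split.
    by have := sqr_ge0 (f t + g t); have := sqr_ge0 (f t); have := sqr_ge0 (g t); nra.
  by have := sqr_ge0 (f t - g t); have := sqr_ge0 (f t); have := sqr_ge0 (g t); nra.
split => //.
set A := \int[mu]_t (f t ^+ 2); set B := \int[mu]_t (g t ^+ 2); set X := \int[mu]_t `|f t * g t|.
have A0 : 0 <= A by apply: Rintegral_ge0 => t _; exact: sqr_ge0.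
have B0 : 0 <= B by apply: Rintegral_ge0 => t _; exact: sqr_ge0.
have X0 : 0 <= X by apply: Rintegral_ge0 => t _; exact: normr_ge0.
have iabs : mu.-integrable setT (EFin \o (fun t => `|f t * g t|)).
  by have := integrable_abse ifg; apply: eq_integrable.
have key (a b : R) : 0 <= a -> 0 <= b -> 2 * (a * b * X) <= a ^+ 2 * A + b ^+ 2 * B.
  move=> a0 b0.
  have i1 : mu.-integrable setT (EFin \o (fun t => a ^+ 2 * f t ^+ 2)).
    by have := integrableZl measurableT (a ^+ 2) if2; apply: eq_integrable.
  have i2 : mu.-integrable setT (EFin \o (fun t => b ^+ 2 * g t ^+ 2)).
    by have := integrableZl measurableT (b ^+ 2) ig2; apply: eq_integrable.
  have i3 : mu.-integrable setT (EFin \o (fun t => (2 * (a * b)) * `|f t * g t|)).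
    by have := integrableZl measurableT (2 * (a * b)) iabs; apply: eq_integrable.
  rewrite mulrA -RintegralZl// -[X in _ <= X + _]RintegralZl// -[X in _ <= _ + X]RintegralZl//.
  rewrite -RintegralD//; apply: le_Rintegral => //.
    by have := integrableD measurableT i1 i2; apply: eq_integrable.
  move=> t _; rewrite normrM -(real_normK (num_real (f t))) -(real_normK (num_real (g t))).
  by have := sqr_ge0 (a * `|f t| - b * `|g t|); nra.
have [A00|An0] := eqVneq A 0.
  rewrite A00 mul0r.
  have XB a : 0 <= a -> 2 * (a * X) <= B.
    by move=> a0; have := key a 1 a0 ler01; rewrite A00 mulr0 add0r mulr1 expr1n mul1r.
  have [->|Xn0] := eqVneq X 0; first by rewrite expr0n.
  have Xp : 0 < X by rewrite lt_neqAle eq_sym Xn0.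
  (* If A = 0, then 2 a X <= B for every a >= 0; this choice of a contradicts X > 0. *)
  have := XB ((B + 1) / X) (divr_ge0 (addr_ge0 B0 ler01) X0).
  by rewrite divfK//; lra.
have Ap : 0 < A by rewrite lt_neqAle eq_sym An0.
(* With a = X and b = A the inequality becomes 2 X^2 A <= (X^2 + A B) A. *)
have := key X A X0 A0.
have -> : 2 * (X * A * X) = 2 * X ^+ 2 * A by ring.
have -> : X ^+ 2 * A + A ^+ 2 * B = (X ^+ 2 + A * B) * A by ring.
by rewrite ler_pM2r//; lra.
Qed.

Lemma ball_indic_integrable (R : realType) (n : nat) :
  (mun R n).-integrable setT (EFin \o radext (fun _ : 'rV[R]_n => 1 : R)).
Proof.
have m1 : @sphere_measurable R n (fun _ => 1).
  by apply: sphere_measurable_of; exact: measurable_cst.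
have mr := measurable_radext m1.
apply/integrableP; split; first exact: measurable_EFin_comp.
apply: (@le_lt_trans _ _ ((2 * 1) ^+ n)%:E); last by rewrite ltry.
apply: le_trans (mun_ball_lty n ler01); apply: ge0_le_integral.
- exact: measurableT.
- by move=> y _; exact: abse_ge0.
- by apply: measurableT_comp => //; exact: measurable_EFin_comp.
- by apply: measurable_EFin_comp; apply: measurable_le1_indic; mfun.
- move=> y _; rewrite lee_fin /radext; case: ltP => _ /=; last by rewrite normr0.
  by case: (leP (enorm y) 1) => _; rewrite ?normr1 ?normr0.
Qed.

Lemma radextM (R : realType) (n : nat) (g h : 'rV[R]_n -> R) y :
  radext (fun w => g w * h w) y = radext g y * radext h y.
Proof. by rewrite /radext; case: ifP => _; rewrite ?mulr0. Qed.

Lemma radextX2 (R : realType) (n : nat) (g : 'rV[R]_n -> R) y :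
  radext (fun w => g w ^+ 2) y = radext g y ^+ 2.
Proof. by rewrite /radext; case: ifP => _; rewrite ?expr0n. Qed.

(** The unit ball has finite measure, and |t| <= t^2 + 1. *)
Lemma radext_integrable (R : realType) (n : nat) (g : 'rV[R]_n -> R) :
  sphere_measurable g ->
  (mun R n).-integrable setT (EFin \o radext (fun w => g w ^+ 2)) ->
  (mun R n).-integrable setT (EFin \o radext g).
Proof.
move=> mg ig2.
apply: (le_integrable measurableT _ _ (integrableD measurableT ig2 (ball_indic_integrable R n))).
  by apply: measurable_EFin_comp; exact: measurable_radext.
move=> y _; rewrite /= lee_fin /radext; case: ifP => _; last by rewrite normr0.
rewrite [leRHS]ger0_norm ?addr_ge0 ?sqr_ge0// -real_normK ?num_real//.
set t := `|_|; have := sqr_ge0 (t - 1); have : 0 <= t by exact: normr_ge0.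
by nra.
Qed.

(** The decay of J is available at X b with b = rr/rho, which may be small. The n+1 factors [rr] of
    the radial weight restore it: rho <= 1 gives rr <= b <= 1, so (1 + X) rr <= 1 + X b. *)
Lemma bessel_weight_bound (R : realType) (n : nat) (J : R -> R) (C0 rr uu X : R) :
  (forall l, 0 <= l -> (1 + l) ^+ n.+1 * J l ^+ 2 <= C0) -> 0 <= X -> 0 <= uu ->
  let rho := Num.sqrt (uu ^+ 2 + rr ^+ 2) in
  (1 + X) ^+ n.+1 * (radial_weight n.+2 rr * (disk uu rr * J (X * (rho^-1 * rr)) ^+ 2)) <=
  C0 * ((uu <= 1)%R%:R * ((0 < rr) && (rr <= 1))%R%:R).
Proof.
move=> HJ X0 u0 /=; set rho := Num.sqrt (uu ^+ 2 + rr ^+ 2).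
have C00 : 0 <= C0.
  by apply: le_trans (HJ 0 (lexx _)); rewrite addr0 expr1n mul1r sqr_ge0.
have R0 : 0 <= C0 * ((uu <= 1)%R%:R * ((0 < rr) && (rr <= 1))%R%:R) by rewrite !mulr_ge0.
rewrite /radial_weight /disk -/rho.
case: (ltP 0 rr) R0 => [r0|_]; last by rewrite !(mul0r, mulr0).
case: (ltP 0 rho) => [rho0|_]; last by rewrite !(mul0r, mulr0).
case: (leP rho 1) => [rho1 _|_]; last by rewrite !(mul0r, mulr0).
have urho : uu <= rho.
  by rewrite -(ger0_norm u0) -sqrtr_sqr ler_sqrt ?addr_ge0 ?sqr_ge0// lerDl sqr_ge0.
have rrho : rr <= rho.
  by rewrite -(gtr0_norm r0) -sqrtr_sqr ler_sqrt ?addr_ge0 ?sqr_ge0// lerDr sqr_ge0.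
rewrite (le_trans urho rho1) (le_trans rrho rho1) /= !mul1r !mulr1.
set b := rho^-1 * rr.
have b0 : 0 <= b by rewrite mulr_ge0 ?invr_ge0 ?ltW.
have b1 : b <= 1 by rewrite /b mulrC ler_pdivrMr// mul1r.
have rb : rr = rho * b by rewrite /b mulrA divff ?mul1r// gt_eqF.
apply: le_trans (HJ (X * b) (mulr_ge0 X0 b0)).
have Xb0 : 0 <= X * b by rewrite mulr_ge0.
have le1 : (1 + X) * rr <= 1 + X * b.
  have h1 : rr <= b by rewrite rb -[leRHS]mul1r ler_wpM2r.
  have h2 : X * rr <= X * b by rewrite ler_wpM2l.
  by rewrite mulrDl mul1r lerD// (le_trans h1).
rewrite mulrA ler_wpM2r ?sqr_ge0// -exprMn; apply: lerXn2r => //; rewrite nnegrE.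
  by rewrite mulr_ge0 ?(ltW r0)// addr_ge0.
by rewrite addr_ge0.
Qed.

Lemma bessel_sphere_bound (R : realType) (m n : nat) :
  let J := cosInt (fun u : R => cos u ^+ n) in
  exists2 C : R, 0 <= C & forall X : R, 0 <= X ->
    (mun R (m + n.+2)).-integrable setT
      (EFin \o radext (fun w : 'rV[R]_(m + n.+2) => J (X * enorm (rsubmx w)) ^+ 2)) /\
    (1 + X) ^+ n.+1 * \int[mun R (m + n.+2)]_y
      radext (fun w : 'rV[R]_(m + n.+2) => J (X * enorm (rsubmx w)) ^+ 2) y <= C.
Proof.
move=> J; have [C0 HJ] := cosInt_decay R n.
have cJ : continuous J by exact: continuous_cosInt.
have C00 : 0 <= C0.
  by apply: le_trans (HJ 0 (lexx _)); rewrite addr0 expr1n mul1r sqr_ge0.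
have [c c0 H] := integral_mun_add_zonal R m n.
have J00 : 0 <= J 0 by rewrite ltW// cosInt0_gt0.
(* c comes from the zonal formula, C0 from the Bessel decay, J(0) from the integral in s; the last
   factor bounds the unit ball of the first block, and r ranges over an interval of length 1. *)
exists (c * C0 * J 0 * (2 * 1) ^+ m); first by rewrite !mulr_ge0 ?exprn_ge0.
move=> X X0.
pose hJ (z : rvT R m * (measurableTypeR R * measurableTypeR R)) : R := J (X * z.2.1) ^+ 2.
have mhJ : measurable_fun setT hJ.
  apply: measurable_exprn.
  by apply: (measurable_continuous_comp (h := J)); [exact: cJ|mfun].
pose g1 (w : 'rV[R]_(m + n.+2)) : R := 1.
have mg1 : sphere_measurable g1 by apply: sphere_measurable_of; exact: measurable_cst.
pose f := axial_fun g1 (fun u r t => hJ (u, (r, t))).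
have mf : measurable_fun setT f by exact: measurable_axial_fun.
have f0 z : 0 <= f z.
  rewrite mulr_ge0 ?disk_ge0// mulr_ge0 ?sqr_ge0//.
  by rewrite /sphere_ext; case: ifP.
(* The integrand depends on the last block through its length only, so the zonal formula is taken at
   x = 0 with the invariant function 1. *)
have fE y : radext (fun w : 'rV[R]_(m + n.+2) => J (X * enorm (rsubmx w)) ^+ 2) y =
    f (lsubmx y, (enorm (rsubmx y), dotv (rsubmx (0 : 'rV[R]_(m + n.+2))) (rsubmx y))).
  rewrite /f -(radext_axial_fun (g := g1) _ 0 y)//; congr (radext _ y).
  by apply/funext => w; rewrite /g1 mul1r.
have mrad : measurable_fun setT (radext (fun w : 'rV[R]_(m + n.+2) => J (X * enorm (rsubmx w)) ^+ 2) : rvT R _ -> R).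
  apply: measurable_radext; apply: sphere_measurable_of; apply: measurable_exprn.
  by apply: (measurable_continuous_comp (h := J)); [exact: cJ|mfun].
have mfe := measurable_EFin_comp mf.
pose K := (1 + X) ^+ n.+1.
have K0 : 0 < K by rewrite exprn_gt0// ltr_pwDl.
pose br (r : R) : R := ((0 < r) && (r <= 1))%R%:R.
have mbr : measurable_fun setT (br : measurableTypeR R -> R).
  rewrite (_ : br = \1_(`]0, 1]%classic : set R)); first exact: measurable_indic.
  by apply/funext => r; rewrite /br indicE mem_setE in_itv.
pose bu (u : rvT R m) : R := (enorm u <= 1)%R%:R.
have mbu : measurable_fun setT bu by apply: measurable_le1_indic; mfun.
pose M : R := c * C0.
have M0 : 0 <= M by rewrite mulr_ge0.
have main : (\int[mun R (m + n.+2)]_y (radext (fun w : 'rV[R]_(m + n.+2) =>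
    J (X * enorm (rsubmx w)) ^+ 2) y)%:E <= (K^-1 * (c * C0 * J 0 * (2 * 1) ^+ m))%:E)%E.
  under eq_integral do rewrite fE.
  rewrite (H (rsubmx (0 : 'rV[R]_(m + n.+2))) (fun z => (f z)%:E) mfe) => [|z]; last by rewrite lee_fin.
  pose phi (z : (rvT R m * measurableTypeR R) * measurableTypeR R) : \bar R :=
    ((K^-1 * M * (bu z.1.1 * br z.1.2))%:E * (slope_weight n.+2 z.2)%:E)%E.
  have mb : measurable_fun setT (fun p : rvT R m * measurableTypeR R => bu p.1 * br p.2).
    apply: measurable_mul; first exact: measurableT_comp mbu measurable_fst.
    exact: measurableT_comp mbr measurable_snd.
  have mphi : measurable_fun setT phi.
    apply: measurable_emul; last by apply: measurable_EFin_comp; apply: measurable_slope_weight; mfun.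
    apply: measurable_EFin_comp; apply: measurable_mul; first by mfun.
    exact: measurableT_comp mb measurable_fst.
  have b0 u r : 0 <= bu u * br r by rewrite mulr_ge0.
  have k0 : 0 <= K^-1 * M by rewrite mulr_ge0 ?invr_ge0 ?(ltW K0).
  have phi0 z : (0 <= phi z)%E.
    rewrite /phi; apply: mule_ge0; rewrite lee_fin; last exact: slope_weight_ge0.
    by apply: mulr_ge0; [exact: k0|exact: b0].
  apply: (@le_trans _ _ (\int[sfprod (sfprod (mun R m) (leb R)) (leb R)]_z phi z)%E).
    apply: ge0_le_integral.
    - exact: measurableT.
    - by move=> z _; rewrite mule_ge0 ?lee_fin// mulr_ge0 ?polar_weight_ge0.
    - apply: measurable_emul.
        by apply: measurable_EFin_comp; apply: measurable_mul; [mfun|exact: measurable_polar_weight].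
      have mG : measurable_fun setT (fun z : (rvT R m * measurableTypeR R) * measurableTypeR R =>
          (z.1.1, (z.1.2, enorm (rsubmx (0 : 'rV[R]_(m + n.+2))) * (z.1.2 * slope z.2))) :
          rvT R m * (measurableTypeR R * measurableTypeR R)).
        apply: measurable_fun_pair; first by mfun.
        apply: measurable_fun_pair; first by mfun.
        by mfun => z; exact: sqrtr_ge0.
      exact: measurableT_comp mfe mG.
    - exact: mphi.
    move=> [[u r] s] _; rewrite /phi /f /axial_fun /polar_weight /hJ /= -!EFinM lee_fin.
    set rho := Num.sqrt _.
    have B := bessel_weight_bound r HJ X0 (enorm_ge0 (u : 'rV[R]_m)).
    rewrite /= -/rho -/K -/(bu u) -/(br r) -/J in B.
    have S1 : sphere_ext (fun w => g1 (axial n.+1 (lsubmx w) (enorm (rsubmx w))))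
        (axial n.+1 (rho^-1 *: (u : 'rV[R]_m)) (rho^-1 * r)) <= 1.
      by rewrite /sphere_ext; case: ifP.
    have w0 : 0 <= c * (radial_weight n.+2 r * slope_weight n.+2 s).
      apply: mulr_ge0; first exact: c0.
      by apply: mulr_ge0; [exact: radial_weight_ge0|exact: slope_weight_ge0].
    apply: (@le_trans _ _ (c * (radial_weight n.+2 r * slope_weight n.+2 s) *
        (disk (enorm u) r * (1 * J (X * (rho^-1 * r)) ^+ 2)))).
      by rewrite ler_wpM2l// ler_wpM2l ?disk_ge0// ler_wpM2r ?sqr_ge0.
    have cs0 : 0 <= c * slope_weight n.+2 s.
      by apply: mulr_ge0; [exact: c0|exact: slope_weight_ge0].
    have -> : K^-1 * M * (bu u * br r) * slope_weight n.+2 s =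
        K^-1 * (c * slope_weight n.+2 s * (C0 * (bu u * br r))) by rewrite /M; ring.
    rewrite ler_pdivlMl//; apply: le_trans (ler_wpM2l cs0 B).
    rewrite le_eqVlt; apply/orP; left; apply/eqP. ring.
  rewrite -[leLHS]/(\int[(sfprod (mun R m) (leb R) \x leb R)%E]_z phi z)%E.
  rewrite (fubini_tonelli1 phi mphi phi0).
  pose psi (p : rvT R m * measurableTypeR R) : \bar R :=
    ((K^-1 * M * J 0 * bu p.1)%:E * (br p.2)%:E)%E.
  have KM0 : 0 <= K^-1 * M * J 0 by apply: mulr_ge0; [exact: k0|exact: J00].
  have mpsi : measurable_fun setT psi.
    apply: measurable_emul; apply: measurable_EFin_comp.
      by apply: measurable_mul; [mfun|exact: measurableT_comp mbu measurable_fst].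
    exact: measurableT_comp mbr measurable_snd.
  have psi0 p : (0 <= psi p)%E by rewrite /psi mule_ge0 ?lee_fin// mulr_ge0.
  rewrite (_ : (\int[sfprod (mun R m) (leb R)]_p fubini_F (leb R) phi p)%E =
      (\int[sfprod (mun R m) (leb R)]_p psi p)%E); last first.
    apply: eq_integral => -[u r] _; rewrite /fubini_F /phi /psi /= ge0_integralZl.
    - by rewrite integral_slope_weight -!EFinM; congr EFin; rewrite -/J; ring.
    - exact: measurableT.
    - by apply: measurable_EFin_comp; apply: measurable_slope_weight; mfun.
    - by move=> s _; rewrite lee_fin slope_weight_ge0.
    - by rewrite lee_fin; apply: mulr_ge0; [exact: k0|exact: b0].
  rewrite -[leLHS]/(\int[(mun R m \x leb R)%E]_p psi p)%E.
  rewrite (fubini_tonelli1 psi mpsi psi0).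
  have brE : (\int[leb R]_r (br r)%:E = 1)%E.
    transitivity (\int[leb R]_r (\1_(`]0%R, 1%R]%classic : set R) r)%:E)%E.
      by apply: eq_integral => r _; rewrite indicE mem_setE in_itv.
    rewrite integral_indic//= setIT.
    by have := @lebesgue_measure_itv R `]0, 1]; rewrite /= lte_fin ltr01 oppr0 adde0.
  rewrite (_ : (\int[mun R m]_u fubini_F (leb R) psi u)%E =
      (\int[mun R m]_u ((K^-1 * M * J 0)%:E * (bu u)%:E))%E); last first.
    apply: eq_integral => u _; rewrite /fubini_F /psi /= ge0_integralZl.
    - by rewrite brE mule1 EFinM.
    - exact: measurableT.
    - exact: measurable_EFin_comp.
    - by move=> r _; rewrite lee_fin.
    - by rewrite lee_fin mulr_ge0.
  rewrite ge0_integralZl; last 4 first.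
  - exact: measurableT.
  - exact: measurable_EFin_comp.
  - by move=> u _; rewrite lee_fin.
  - by rewrite lee_fin.
  apply: (@le_trans _ _ ((K^-1 * M * J 0)%:E * ((2 * 1) ^+ m)%:E)%E).
    by rewrite lee_wpmul2l ?lee_fin//; exact: mun_ball_lty.
  by rewrite -EFinM lee_fin /M !mulrA.
have irad : (mun R (m + n.+2)).-integrable setT
    (EFin \o radext (fun w : 'rV[R]_(m + n.+2) => J (X * enorm (rsubmx w)) ^+ 2)).
  apply/integrableP; split; first exact: measurable_EFin_comp.
  apply: le_lt_trans (le_lt_trans main (ltry _)).
  rewrite le_eqVlt; apply/orP; left; apply/eqP; apply: eq_integral => y _.
  by rewrite /= ger0_norm// radext_ge0// => w; exact: sqr_ge0.
split => //; rewrite -ler_pdivlMl//.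
rewrite -lee_fin /Rintegral fineK; first exact: main.
exact: (integrable_fin_num measurableT irad).
Qed.

(* Decay of the Fourier transform of a function invariant under rotations of the last
   block: average over the rotations, then Cauchy-Schwarz against the Bessel kernel. *)
Lemma sint_cos_decay (R : realType) (m n : nat) :
  exists2 C : R, 0 <= C & forall (x : 'rV[R]_(m + n.+1)) (d : R) (g : 'rV[R]_(m + n.+1) -> R),
    sphere_measurable g ->
    (forall w, enorm w = 1 -> g w = g (axial n (lsubmx w) (enorm (rsubmx w)))) ->
    (mun R (m + n.+1)).-integrable setT (EFin \o radext (fun w => g w ^+ 2)) ->
    (1 + enorm (rsubmx x)) ^+ n * sint (fun w => g w * cos (dotv x w + d)) ^+ 2 <=
    C * \int[mun R (m + n.+1)]_y radext (fun w => g w ^+ 2) y.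
Proof.
pose mu := mun R (m + n.+1).
have mcos (x : 'rV[R]_(m + n.+1)) d :
    measurable_fun setT (fun w : rvT R (m + n.+1) => cos (dotv x w + d)).
  by apply: (measurable_continuous_comp (h := @cos R)); [exact: continuous_cos|mfun].
have icos x d g : sphere_measurable g -> mu.-integrable setT (EFin \o radext g) ->
    mu.-integrable setT (EFin \o radext (fun w : 'rV[R]_(m + n.+1) => g w * cos (dotv x w + d))).
  move=> mg ig; apply: (le_integrable measurableT _ _ ig).
    apply: measurable_EFin_comp; apply: measurable_radext.
    exact: sphere_measurableM (mcos x d).
  move=> y _; rewrite /= lee_fin radextM normrM -[leRHS]mulr1 ler_wpM2l//.
  by rewrite /radext; case: ifP => _; rewrite ?norm_cos_le1 ?normr0.
(* [sint] carries the dimension as a factor; its square goes into the constant. *)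
suff [C C0 HC] : exists2 C : R, 0 <= C & forall (x : 'rV[R]_(m + n.+1)) (d : R) (g : 'rV[R]_(m + n.+1) -> R),
    sphere_measurable g ->
    (forall w, enorm w = 1 -> g w = g (axial n (lsubmx w) (enorm (rsubmx w)))) ->
    mu.-integrable setT (EFin \o radext (fun w => g w ^+ 2)) ->
    (1 + enorm (rsubmx x)) ^+ n *
      (\int[mu]_y radext (fun w => g w * cos (dotv x w + d)) y) ^+ 2 <=
    C * \int[mu]_y radext (fun w => g w ^+ 2) y.
  exists ((m + n.+1)%:R ^+ 2 * C); first by rewrite mulr_ge0 ?sqr_ge0.
  move=> x d g mg ginv ig2; have ig := radext_integrable mg ig2.
  rewrite sintE; last 2 first.
  - exact: sphere_measurableM.
  - exact: icos.
  rewrite exprMn mulrCA -mulrA ler_wpM2l ?sqr_ge0//.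
  exact: HC.
have A0 (g : 'rV[R]_(m + n.+1) -> R) : 0 <= \int[mu]_y radext (fun w => g w ^+ 2) y.
  by apply: Rintegral_ge0 => y _; apply: radext_ge0 => w; exact: sqr_ge0.
(* A last block of dimension 1 claims no decay: Cauchy-Schwarz against the cosine gives the volume
   of the ball as constant. *)
case: n @mu mcos icos A0 => [|n] mu mcos icos A0.
  exists (\int[mu]_y radext (fun _ : 'rV[R]_(m + 1) => 1 : R) y).
    by apply: Rintegral_ge0 => y _; exact: radext_ge0.
  move=> x d g mg _ ig2; have ig := radext_integrable mg ig2.
  rewrite expr0 mul1r.
  have mc1 : sphere_measurable (fun w : 'rV[R]_(m + 1) => cos (dotv x w + d)).
    by apply: sphere_measurable_of; exact: mcos.
  have ic2 : mu.-integrable setT (EFin \o (fun y => radext (fun w : 'rV[R]_(m + 1) => cos (dotv x w + d)) y ^+ 2)).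
    apply: (le_integrable measurableT _ _ (ball_indic_integrable R (m + 1))).
      apply: measurable_EFin_comp; apply: measurable_exprn; exact: measurable_radext.
    move=> y _; rewrite /= lee_fin /radext; case: ifP => _; last by rewrite expr0n.
    by rewrite normr1 normrX exprn_ile1 ?norm_cos_le1.
  have ig2' : mu.-integrable setT (EFin \o (fun y => radext g y ^+ 2)).
    by move: ig2; apply: eq_integrable => // y _; rewrite /= radextX2.
  have [_ CS] := Rintegral_cauchy_schwarz (measurable_radext mg) (measurable_radext mc1) ig2' ic2.
  have I1 := icos x d g mg ig.
  apply: le_trans (_ : (\int[mu]_y `|radext g y * radext (fun w : 'rV[R]_(m + 1) => cos (dotv x w + d)) y|) ^+ 2 <= _).
    rewrite -real_normK ?num_real// lerXn2r ?nnegrE ?normr_ge0//.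
      by apply: Rintegral_ge0 => y _; exact: normr_ge0.
    apply: le_trans (le_normr_Rintegral measurableT I1) _.
    rewrite le_eqVlt; apply/orP; left; apply/eqP; apply: eq_Rintegral => y _.
    by rewrite radextM.
  apply: le_trans CS _; rewrite mulrC.
  have -> : \int[mu]_t radext g t ^+ 2 = \int[mu]_y radext (fun w => g w ^+ 2) y.
    by apply: eq_Rintegral => y _; rewrite radextX2.
  rewrite ler_wpM2r//; apply: le_Rintegral => //; first exact: ball_indic_integrable.
  move=> y _; rewrite /radext; case: ifP => _; last by rewrite expr0n.
  by rewrite -real_normK ?num_real// exprn_ile1 ?norm_cos_le1.
pose J := cosInt (fun u : R => cos u ^+ n).
have cJ : continuous J by exact: continuous_cosInt.
have J0 : 0 < J 0 by exact: cosInt0_gt0.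
have [C C0 HC] := bessel_sphere_bound R m n.
exists (C / J 0 ^+ 2); first by rewrite divr_ge0 ?sqr_ge0.
move=> x d g mg ginv ig2; have ig := radext_integrable mg ig2.
set X := enorm (rsubmx x).
have X0 : 0 <= X by exact: enorm_ge0.
have [iJ HX] := HC X X0.
pose gJ (w : 'rV[R]_(m + n.+2)) := J (X * enorm (rsubmx w)).
have mJ : sphere_measurable gJ.
  apply: sphere_measurable_of.
  by apply: (measurable_continuous_comp (h := J)); [exact: cJ|mfun].
have iJ2 : mu.-integrable setT (EFin \o (fun y => radext gJ y ^+ 2)).
  by move: iJ; apply: eq_integrable => // y _; rewrite /= -radextX2.
have ig2' : mu.-integrable setT (EFin \o (fun y => radext g y ^+ 2)).
  by move: ig2; apply: eq_integrable => // y _; rewrite /= radextX2.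
have [igJ CS] := Rintegral_cauchy_schwarz (measurable_radext mg) (measurable_radext mJ) ig2' iJ2.
have ZA := zonal_average x d mg ginv ig.
have I1 := icos x d g mg ig.
set S := \int[mu]_y radext (fun w => g w * cos (dotv x w + d)) y.
set Y := \int[mu]_y `|radext g y * radext gJ y|.
set A := \int[mu]_y radext (fun w => g w ^+ 2) y.
set B := \int[mu]_y radext (fun w : 'rV[R]_(m + n.+2) => J (X * enorm (rsubmx w)) ^+ 2) y in HX.
have Y0 : 0 <= Y by apply: Rintegral_ge0 => y _; exact: normr_ge0.
have SY : J 0 * `|S| <= Y.
  rewrite -lee_fin EFinM; move: ZA.
  have fS : (\int[mu]_y (radext (fun w => g w * cos (dotv x w + d)) y)%:E)%E \is a fin_num.
    exact: (integrable_fin_num measurableT I1).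
  rewrite -/J -/X -(fineK fS) abse_EFin => ZA; apply: le_trans ZA _.
  rewrite /Y /Rintegral fineK; last first.
    have := integrable_fin_num measurableT (integrable_abse igJ).
    by rewrite [X in X \is a fin_num](_ : _ = (\int[mu]_y (`|radext g y * radext gJ y|)%:E)%E).
  rewrite le_eqVlt; apply/orP; left; apply/eqP; apply: eq_integral => y _.
  by rewrite -radextM /radext; case: ifP => _; rewrite ?normrM ?normr0.
have CSAB : Y ^+ 2 <= A * B.
  apply: le_trans CS _; rewrite le_eqVlt; apply/orP; left; apply/eqP; congr (_ * _).
    by apply: eq_Rintegral => y _; rewrite radextX2.
  by apply: eq_Rintegral => y _; rewrite -radextX2.
have K0 : 0 <= (1 + X) ^+ n.+1 by rewrite exprn_ge0// addr_ge0.
have JS : (J 0 * `|S|) ^+ 2 <= Y ^+ 2.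
  by rewrite lerXn2r ?nnegrE ?mulr_ge0 ?normr_ge0 ?(ltW J0).
rewrite mulrAC ler_pdivlMr ?exprn_gt0//.
have -> : (1 + X) ^+ n.+1 * S ^+ 2 * J 0 ^+ 2 = (1 + X) ^+ n.+1 * (J 0 * `|S|) ^+ 2.
  by rewrite exprMn real_normK ?num_real//; ring.
apply: (@le_trans _ _ ((1 + X) ^+ n.+1 * (A * B))).
  by rewrite ler_wpM2l// (le_trans JS).
by rewrite mulrCA [leRHS]mulrC ler_wpM2l// /A.
Qed.

(** * Reflections, invariance and complex-valued functions *)

Lemma dotvC (R : realType) (n : nat) (x y : 'rV[R]_n) : dotv x y = dotv y x.
Proof. by apply: eq_bigr => i _; rewrite mulrC. Qed.

Lemma dotvBl (R : realType) (n : nat) (x y z : 'rV[R]_n) :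
  dotv (x - y) z = dotv x z - dotv y z.
Proof.
rewrite /dotv -sumrB; apply: eq_bigr => i _; rewrite !mxE; ring.
Qed.

Lemma mulmx_trE (R : realType) (n : nat) (x y : 'rV[R]_n) : x *m y^T = (dotv x y)%:M.
Proof.
apply/matrixP => i j; rewrite !ord1 !mxE eqxx mulr1n.
by apply: eq_bigr => l _; rewrite !mxE.
Qed.

(* The Householder reflection exchanging [v] and [|v| e_0]. *)
Lemma orthmx_to_axis (R : realType) (n : nat) (v : 'rV[R]_n.+1) :
  exists2 B : 'M[R]_n.+1, orthmx B & v *m B^T = enorm v *: delta_mx 0 ord0.
Proof.
set e := enorm v *: delta_mx 0 ord0.
have ee : dotv e e = dotv v v.
  rewrite -sqr_enorm enormZ (ger0_norm (enorm_ge0 v)) exprMn -sqr_enorm.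
  rewrite [X in _ * X](_ : _ = 1) ?mulr1//.
  rewrite sqr_enorm /dotv (bigD1 ord0)//= big1 ?addr0 => [|i i0]; rewrite !mxE ?eqxx ?mulr1//.
  by rewrite (negbTE i0) mul0r.
pose w := v - e.
have [w0|wn0] := eqVneq w 0.
  exists 1%:M; first by rewrite /orthmx trmx1 mulmx1.
  by rewrite trmx1 mulmx1; apply/eqP; rewrite -subr_eq0; apply/eqP.
have ww : dotv w w != 0.
  apply: contra_neq wn0 => w0; apply/rowP => i; rewrite [RHS]mxE; apply/eqP.
  by rewrite -normr_le0 (le_trans (norm_coord_le_enorm w i))// /enorm w0 sqrtr0.
(* A consequence of |e| = |v|: the reflection subtracts exactly w = v - e from v. *)
have vw : 2 * dotv v w = dotv w w.
  rewrite {2}/w dotvBl !(dotvC _ w) /w !dotvBl ee (dotvC e v); lra.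
have wE : w = v - e by [].
clearbody w.
pose B : 'M[R]_n.+1 := 1%:M - (2 / dotv w w) *: (w^T *m w).
have BT : B^T = B by rewrite /B linearB /= linearZ /= trmx1 trmx_mul trmxK.
exists B; rewrite /orthmx BT.
  have sq : (w^T *m w) *m (w^T *m w) = dotv w w *: (w^T *m w).
    by rewrite mulmxA -(mulmxA w^T) mulmx_trE mul_mx_scalar scalemxAl.
  rewrite /B mulmxBl mul1mx mulmxBr mulmx1 -scalemxAl -scalemxAr sq.
  set c := 2 / dotv w w; set W := w^T *m w.
  have -> : c *: (c *: (dotv w w *: W)) = c *: W + c *: W.
    by rewrite !scalerA -scalerDl; congr (_ *: _); rewrite /c; field.
  by rewrite (opprD (c *: W)) opprK addKr subrK.
rewrite /B mulmxBr mulmx1 -scalemxAr mulmxA mulmx_trE mul_scalar_mx scalerA.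
by rewrite mulrAC vw divff// scale1r wE opprB addrC subrK.
Qed.

Lemma cmod_ge0 (R : realType) (z : R[i]) : 0 <= cmod z.
Proof. exact: sqrtr_ge0. Qed.

Lemma sqr_cmod (R : realType) (z : R[i]) : cmod z ^+ 2 = complex.Re z ^+ 2 + complex.Im z ^+ 2.
Proof. by rewrite sqr_sqrtr// addr_ge0 ?sqr_ge0. Qed.

Definition last_invariant (R : realType) (m k : nat) (F : 'rV[R]_(m + k) -> R[i]) : Prop :=
  forall (B : 'M[R]_k) (w : 'rV[R]_(m + k)), orthmx B -> enorm w = 1 ->
    F (row_mx (lsubmx w) (rsubmx w *m B^T)) = F w.

Lemma last_invariant_axial (R : realType) (m n : nat) (F : 'rV[R]_(m + n.+1) -> R[i]) :
  last_invariant F ->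
  forall w, enorm w = 1 -> F w = F (axial n (lsubmx w) (enorm (rsubmx w))).
Proof.
move=> HF w w1; have [B oB vB] := orthmx_to_axis (rsubmx w).
by rewrite -(HF B w oB w1) vB.
Qed.

Lemma L2_sphere_measurable (R : realType) (n : nat) (F : 'rV[R]_n -> R[i]) : L2_sphere F ->
  sphere_measurable (fun w => complex.Re (F w)) /\ sphere_measurable (fun w => complex.Im (F w)).
Proof. by move=> [H _]; split=> U oU; have [] := H U oU. Qed.

Lemma sphere_measurableX2 (R : realType) (n : nat) (g : 'rV[R]_n -> R) :
  sphere_measurable g -> sphere_measurable (fun w => g w ^+ 2).
Proof.
by move=> mg; apply: (sphere_measurable_comp (h := fun z => z ^+ 2)) => //; exact: exprn_continuous.
Qed.

Lemma sphere_measurable_cmod2 (R : realType) (n : nat) (F : 'rV[R]_n -> R[i]) :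
  L2_sphere F -> sphere_measurable (fun w => cmod (F w) ^+ 2).
Proof.
move=> /L2_sphere_measurable[mRe mIm].
rewrite (_ : (fun w => cmod (F w) ^+ 2) =
  (fun w => complex.Re (F w) ^+ 2 + complex.Im (F w) ^+ 2)).
  by apply: sphere_measurableD; exact: sphere_measurableX2.
by apply/funext => w; rewrite sqr_cmod.
Qed.

(** The dimension is a successor because [sint_nn] has it as a factor: in dimension 0 its finiteness
    would say nothing about the integral. *)
Lemma L2_sphere_integrable (R : realType) (n : nat) (F : 'rV[R]_n.+1 -> R[i]) :
  L2_sphere F ->
  [/\ (mun R n.+1).-integrable setT (EFin \o radext (fun w => complex.Re (F w) ^+ 2)),
      (mun R n.+1).-integrable setT (EFin \o radext (fun w => complex.Im (F w) ^+ 2)) &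
      n.+1%:R * (\int[mun R n.+1]_y radext (fun w => complex.Re (F w) ^+ 2) y +
        \int[mun R n.+1]_y radext (fun w => complex.Im (F w) ^+ 2) y) = L2norm F ^+ 2].
Proof.
move=> LF; have [mRe mIm] := L2_sphere_measurable LF.
have mC := sphere_measurable_cmod2 LF.
have C0 w : 0 <= cmod (F w) ^+ 2 by exact: sqr_ge0.
have := LF.2; rewrite sint_nnE// => fin.
have iC : (mun R n.+1).-integrable setT (EFin \o radext (fun w => cmod (F w) ^+ 2)).
  apply/integrableP; split; first by apply: measurable_EFin_comp; exact: measurable_radext.
  rewrite (_ : (\int[mun R n.+1]_y _)%E = (\int[mun R n.+1]_y (radext (fun w => (cmod (F w) ^+ 2)%R) y)%:E)%E).
    move: fin; set I := (\int[_]_y _)%E => fin.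
    rewrite ltey; apply/eqP => Iy; move: fin; rewrite Iy gt0_muley ?ltxx//.
  by apply: eq_integral => y _; rewrite /= ger0_norm// radext_ge0.
have iRe : (mun R n.+1).-integrable setT (EFin \o radext (fun w => complex.Re (F w) ^+ 2)).
  apply: (le_integrable measurableT _ _ iC).
    by apply: measurable_EFin_comp; apply: measurable_radext; exact: sphere_measurableX2.
  move=> y _; rewrite /= lee_fin /radext; case: ifP => // _.
  by rewrite !ger0_norm ?sqr_ge0// sqr_cmod lerDl sqr_ge0.
have iIm : (mun R n.+1).-integrable setT (EFin \o radext (fun w => complex.Im (F w) ^+ 2)).
  apply: (le_integrable measurableT _ _ iC).
    by apply: measurable_EFin_comp; apply: measurable_radext; exact: sphere_measurableX2.
  move=> y _; rewrite /= lee_fin /radext; case: ifP => // _.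
  by rewrite !ger0_norm ?sqr_ge0// sqr_cmod lerDr sqr_ge0.
split => //; rewrite -RintegralD//.
have I0 : (0 <= \int[mun R n.+1]_y (radext (fun w => (cmod (F w) ^+ 2)%R) y)%:E)%E.
  by apply: integral_ge0 => y _; rewrite lee_fin radext_ge0.
rewrite /L2norm sqr_sqrtr; last first.
  by rewrite fine_ge0// sint_nnE// mule_ge0// lee_fin.
rewrite sint_nnE// fineM//; last exact: (integrable_fin_num measurableT iC).
rewrite -/(Rintegral _ _ _); congr (_ * _); apply: eq_Rintegral => y _.
by rewrite /radext; case: ifP => _; rewrite ?addr0// sqr_cmod.
Qed.

(** Real and imaginary parts of the integrand are sums of Re F and Im F times cosines shifted by 0
    or by pi/2 in either direction; the real estimate applies to each of the four terms. *)
Lemma ext_op_decay (R : realType) (m n : nat) :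
  exists2 C : R, 0 <= C & forall (F : 'rV[R]_(m + n.+1) -> R[i]) (x : 'rV[R]_(m + n.+1)),
    L2_sphere F -> last_invariant F ->
    (1 + enorm (rsubmx x)) ^+ n * cmod (ext_op F x) ^+ 2 <= C * L2norm F ^+ 2.
Proof.
have [C C0 HC] := sint_cos_decay R m n.
pose N : R := (m + n.+1)%:R.
have N0 : 0 < N by rewrite ltr0n addnS.
pose c0 : R := (2 * pi) `^ (- (N / 2)).
(* Two real integrals, each a sum of two terms squared, give the 4; N relates the ball integrals of
   (Re F)^2 and (Im F)^2 to the square of [L2norm]. *)
exists (c0 ^+ 2 * (4 * (C / N))).
  by rewrite mulr_ge0 ?sqr_ge0// mulr_ge0// divr_ge0// ltW.
move=> F x LF iF.
have [mRe mIm] := L2_sphere_measurable LF.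
have iFa := last_invariant_axial iF.
have LFi : [/\ (mun R (m + n.+1)).-integrable setT (EFin \o radext (fun w => complex.Re (F w) ^+ 2)),
      (mun R (m + n.+1)).-integrable setT (EFin \o radext (fun w => complex.Im (F w) ^+ 2)) &
      N * (\int[mun R (m + n.+1)]_y radext (fun w => complex.Re (F w) ^+ 2) y +
        \int[mun R (m + n.+1)]_y radext (fun w => complex.Im (F w) ^+ 2) y) = L2norm F ^+ 2].
  by move: (F) LF; rewrite /N addnS => F' LF'; exact: L2_sphere_integrable.
have [iRe iIm HL] := LFi.
have invRe w : enorm w = 1 -> complex.Re (F w) = complex.Re (F (axial n (lsubmx w) (enorm (rsubmx w)))).
  by move=> w1; rewrite -iFa.
have invIm w : enorm w = 1 -> complex.Im (F w) = complex.Im (F (axial n (lsubmx w) (enorm (rsubmx w)))).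
  by move=> w1; rewrite -iFa.
set A := \int[_]_y _ in HL; set B := \int[mun R (m + n.+1)]_y radext (fun w => complex.Im (F w) ^+ 2) y in HL.
set X := (1 + enorm (rsubmx x)) ^+ n.
have X0 : 0 <= X by rewrite exprn_ge0// addr_ge0 ?enorm_ge0.
have mcos d : measurable_fun setT (fun w : rvT R (m + n.+1) => cos (dotv x w + d)).
  by apply: (measurable_continuous_comp (h := @cos R)); [exact: continuous_cos|mfun].
have icos d g : sphere_measurable g ->
    (mun R (m + n.+1)).-integrable setT (EFin \o radext (fun w => g w ^+ 2)) ->
    (mun R (m + n.+1)).-integrable setT (EFin \o radext (fun w : 'rV[R]_(m + n.+1) => g w * cos (dotv x w + d))).
  move=> mg ig2; have ig := radext_integrable mg ig2.
  apply: (le_integrable measurableT _ _ ig).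
    apply: measurable_EFin_comp; apply: measurable_radext.
    exact: sphere_measurableM (mcos d).
  move=> y _; rewrite /= lee_fin radextM normrM -[leRHS]mulr1 ler_wpM2l//.
  by rewrite /radext; case: ifP => _; rewrite ?norm_cos_le1 ?normr0.
have add g h d e : sphere_measurable g -> sphere_measurable h ->
    (mun R (m + n.+1)).-integrable setT (EFin \o radext (fun w => g w ^+ 2)) ->
    (mun R (m + n.+1)).-integrable setT (EFin \o radext (fun w => h w ^+ 2)) ->
    sint (fun w => g w * cos (dotv x w + d) + h w * cos (dotv x w + e)) =
    sint (fun w => g w * cos (dotv x w + d)) + sint (fun w => h w * cos (dotv x w + e)).
  move=> mg mh ig ih.
  have mgc := sphere_measurableM mg (mcos d).
  have mhc := sphere_measurableM mh (mcos e).
  have rE y : radext (fun w => g w * cos (dotv x w + d) + h w * cos (dotv x w + e)) y =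
      radext (fun w => g w * cos (dotv x w + d)) y + radext (fun w => h w * cos (dotv x w + e)) y.
    by rewrite /radext; case: ifP => _; rewrite ?addr0.
  have Ig := icos d g mg ig. have Ih := icos e h mh ih.
  rewrite !sintE//; last 2 first.
  - exact: sphere_measurableD.
  - have := integrableD measurableT Ig Ih; apply: eq_integrable => // y _.
    by rewrite /= rE.
  rewrite -mulrDr -RintegralD//; congr (_ * _).
  by apply: eq_Rintegral => y _; rewrite rE.
have sq (a b : R) : (a + b) ^+ 2 <= 2 * (a ^+ 2 + b ^+ 2).
  by have := sqr_ge0 (a - b); nra.
have bound d e : X * (sint (fun w => complex.Re (F w) * cos (dotv x w + d) +
    complex.Im (F w) * cos (dotv x w + e))) ^+ 2 <= 2 * (C * (A + B)).
  rewrite add//.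
  have H1 := HC x d _ mRe invRe iRe. have H2 := HC x e _ mIm invIm iIm.
  apply: le_trans (ler_wpM2l X0 (sq _ _)) _.
  rewrite mulrCA ler_wpM2l// mulrDr [leRHS]mulrDr lerD//.
have ReE : (fun w => complex.Re ((cos (dotv w x) +i* sin (dotv w x)) * F w)%C) =
    (fun w => complex.Re (F w) * cos (dotv x w + 0) + complex.Im (F w) * cos (dotv x w + pi / 2)).
  apply/funext => w; rewrite (dotvC w x) addr0 cosD cos_pihalf sin_pihalf.
  by case: (F w) => a b /=; ring.
have ImE : (fun w => complex.Im ((cos (dotv w x) +i* sin (dotv w x)) * F w)%C) =
    (fun w => complex.Re (F w) * cos (dotv x w + - (pi / 2)) + complex.Im (F w) * cos (dotv x w + 0)).
  apply/funext => w; rewrite (dotvC w x) addr0 cosD cosN sinN cos_pihalf sin_pihalf.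
  by case: (F w) => a b /=; ring.
rewrite sqr_cmod /ext_op ReE ImE -/N -/c0.
set S1 := sint _; set S2 := sint _.
have -> : complex.Re ((c0 * S1)%:C + (c0 * S2)%:C * 'i)%C = c0 * S1.
  by rewrite /=; ring.
have -> : complex.Im ((c0 * S1)%:C + (c0 * S2)%:C * 'i)%C = c0 * S2.
  by rewrite /=; ring.
have B1 : X * S1 ^+ 2 <= 2 * (C * (A + B)) by exact: bound.
have B2 : X * S2 ^+ 2 <= 2 * (C * (A + B)) by exact: bound.
rewrite -HL.
have -> : X * ((c0 * S1) ^+ 2 + (c0 * S2) ^+ 2) = c0 ^+ 2 * (X * S1 ^+ 2 + X * S2 ^+ 2) by ring.
have -> : c0 ^+ 2 * (4 * (C / N)) * (N * (A + B)) = c0 ^+ 2 * (2 * (C * (A + B)) + 2 * (C * (A + B))).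
  by field; rewrite gt_eqF.
by rewrite ler_wpM2l ?sqr_ge0// lerD.
Qed.

(** * Exchanging the two blocks *)

Definition swap_row (R : realType) (m k : nat) (w : 'rV[R]_(m + k)) : 'rV[R]_(k + m) :=
  row_mx (rsubmx w) (lsubmx w).

Lemma dotv_swap_row (R : realType) (m k : nat) (x w : 'rV[R]_(m + k)) :
  dotv (swap_row x) (swap_row w) = dotv x w.
Proof. by rewrite dotv_row /swap_row !row_mxKl !row_mxKr addrC -dotv_row. Qed.

Lemma enorm_swap_row (R : realType) (m k : nat) (w : 'rV[R]_(m + k)) :
  enorm (swap_row w) = enorm w.
Proof. by rewrite /enorm dotv_swap_row. Qed.

Lemma swap_rowK (R : realType) (m k : nat) (w : 'rV[R]_(m + k)) :
  swap_row (swap_row w) = w.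
Proof. by rewrite /swap_row row_mxKl row_mxKr hsubmxK. Qed.

Lemma swap_rowZ (R : realType) (m k : nat) (c : R) (w : 'rV[R]_(m + k)) :
  swap_row (c *: w) = c *: swap_row w.
Proof. by rewrite /swap_row !linearZ /= scale_row_mx. Qed.

Lemma measurable_swap_row (R : realType) (m k : nat) :
  measurable_fun setT (fun w : rvT R (m + k) => swap_row w : rvT R (k + m)).
Proof. by rewrite /swap_row; mfun. Qed.

Lemma borel_swap_row (R : realType) (m k : nat) (A : set 'rV[R]_(m + k)) :
  borelN (m + k) A -> borelN (k + m) ((@swap_row R k m) @^-1` A).
Proof.
move=> mA.
suff : measurable ((@swap_row R k m) @^-1` A : set (rvT R (k + m))) by [].
rewrite -[X in measurable X]setTI; exact: measurable_swap_row.
Qed.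

Lemma sphere_measurable_swap (R : realType) (m k : nat) (g : 'rV[R]_(m + k) -> R) :
  sphere_measurable g -> sphere_measurable (fun w : 'rV[R]_(k + m) => g (swap_row w)).
Proof.
move=> mg U oU; have := borel_swap_row (mg U oU).
rewrite (_ : _ @^-1` _ = sphere (k + m) `&` (fun w => g (swap_row w)) @^-1` U)//.
by apply/seteqP; split=> w []; rewrite /sphere /= enorm_swap_row.
Qed.

(** Split both integrals along the blocks; Tonelli exchanges the order. This transfers the decay in
    the last block to the first. *)
Lemma sint_nn_swap (R : realType) (m k : nat) (g : 'rV[R]_(m + k) -> R) :
  sphere_measurable g -> (forall w, 0 <= g w) ->
  sint_nn (fun w : 'rV[R]_(k + m) => (g (swap_row w))%:E) = sint_nn (fun w => (g w)%:E).
Proof.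
move=> mg g0; rewrite sint_nnE ?sint_nnE//; last exact: sphere_measurable_swap.
have -> : (k + m)%:R = (m + k)%:R :> R by rewrite addnC.
congr (_ * _)%E.
have rE y : radext (fun w : 'rV[R]_(k + m) => g (swap_row w)) y = radext g (swap_row y).
  by rewrite /radext enorm_swap_row swap_rowZ.
pose f (z : rvT R m * rvT R k) : \bar R := (radext g (row_mx z.1 z.2))%:E.
have mr : measurable_fun setT (fun y : rvT R (m + k) => (radext g y)%:E).
  by apply: measurable_EFin_comp; exact: measurable_radext.
have r0 y : (0 <= (radext g y)%:E)%E by rewrite lee_fin radext_ge0.
have mf : measurable_fun setT f.
  have mrow : measurable_fun setT (fun z : rvT R m * rvT R k => row_mx z.1 z.2 : rvT R (m + k)) by mfun.
  exact: measurableT_comp mr mrow.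
have f0 z : (0 <= f z)%E by exact: r0.
rewrite (ge0_integral_mun_add mr r0) -[RHS]/(\int[mun R m]_u \int[mun R k]_v f (u, v))%E.
rewrite (fubini_tonelli f mf f0).
have mrs : measurable_fun setT (fun y : rvT R (k + m) => (radext g (swap_row y))%:E).
  have H := measurableT_comp mr (@measurable_swap_row R k m).
  exact: H.
transitivity (\int[mun R (k + m)]_y (radext g (swap_row y))%:E)%E.
  by apply: eq_integral => y _; rewrite rE.
rewrite (ge0_integral_mun_add mrs (fun=> r0 _)).
apply: eq_integral => v _; apply: eq_integral => u _.
by rewrite /f /swap_row row_mxKl row_mxKr.
Qed.

Lemma sint_swap (R : realType) (m k : nat) (g : 'rV[R]_(m + k) -> R) :
  sphere_measurable g -> sint (fun w : 'rV[R]_(k + m) => g (swap_row w)) = sint g.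
Proof.
move=> mg; rewrite /sint.
rewrite (sint_nn_swap (g := fun w => Num.max (g w) 0)); last 2 first.
- apply: (sphere_measurable_comp (h := fun z => Num.max z 0)) => //.
  by move=> z; apply: continuous_max; [exact: cvg_id|exact: cvg_cst].
- by move=> w; rewrite le_max lexx orbT.
rewrite (sint_nn_swap (g := fun w => Num.max (- g w) 0))//.
- apply: (sphere_measurable_comp (h := fun z => Num.max (- z) 0)) => //.
  by move=> z; apply: continuous_max; [exact: opp_continuous|exact: cvg_cst].
- by move=> w; rewrite le_max lexx orbT.
Qed.

Lemma L2_sphere_swap (R : realType) (m k : nat) (F : 'rV[R]_(m + k) -> R[i]) :
  L2_sphere F ->
  L2_sphere (fun w : 'rV[R]_(k + m) => F (swap_row w)) /\
  L2norm (fun w : 'rV[R]_(k + m) => F (swap_row w)) = L2norm F.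
Proof.
move=> LF; have [mRe mIm] := L2_sphere_measurable LF.
have E := sint_nn_swap (sphere_measurable_cmod2 LF) (fun w => sqr_ge0 (cmod (F w))).
split; last by rewrite /L2norm E.
split; last by rewrite E; exact: LF.2.
move=> U oU; split; first exact: (sphere_measurable_swap mRe).
exact: (sphere_measurable_swap mIm).
Qed.

Lemma ext_op_swap (R : realType) (m k : nat) (F : 'rV[R]_(m + k) -> R[i]) (x : 'rV[R]_(m + k)) :
  L2_sphere F ->
  ext_op (fun w : 'rV[R]_(k + m) => F (swap_row w)) (swap_row x) = ext_op F x.
Proof.
move=> LF; have [mRe mIm] := L2_sphere_measurable LF.
have mc : measurable_fun setT (fun w : rvT R (m + k) => cos (dotv w x)).
  by apply: (measurable_continuous_comp (h := @cos R)); [exact: continuous_cos|mfun].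
have ms : measurable_fun setT (fun w : rvT R (m + k) => sin (dotv w x)).
  by apply: (measurable_continuous_comp (h := @sin R)); [exact: continuous_sin|mfun].
have ReE : sphere_measurable (fun w => complex.Re ((cos (dotv w x) +i* sin (dotv w x)) * F w)%C).
  rewrite (_ : (fun w => _) = (fun w => complex.Re (F w) * cos (dotv w x) + complex.Im (F w) * - sin (dotv w x))).
    apply: sphere_measurableD; first exact: sphere_measurableM.
    by apply: sphere_measurableM => //; exact: measurable_opp.
  by apply/funext => w; case: (F w) => a b /=; ring.
have ImE : sphere_measurable (fun w => complex.Im ((cos (dotv w x) +i* sin (dotv w x)) * F w)%C).
  rewrite (_ : (fun w => _) = (fun w => complex.Re (F w) * sin (dotv w x) + complex.Im (F w) * cos (dotv w x))).
    by apply: sphere_measurableD; exact: sphere_measurableM.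
  by apply/funext => w; case: (F w) => a b /=; ring.
rewrite /ext_op -(sint_swap ReE) -(sint_swap ImE).
have dE (w : 'rV[R]_(k + m)) : dotv w (swap_row x) = dotv (swap_row w) x.
  by rewrite -dotv_swap_row swap_rowK.
rewrite (_ : (k + m)%:R = (m + k)%:R :> R); last by rewrite addnC.
by under [in LHS]eq_fun => w do rewrite dE; under [in X in ((_ * X)%:C * _)%C]eq_fun => w do rewrite dE.
Qed.

Definition first_invariant (R : realType) (m k : nat) (F : 'rV[R]_(m + k) -> R[i]) : Prop :=
  forall (A : 'M[R]_m) (w : 'rV[R]_(m + k)), orthmx A -> enorm w = 1 ->
    F (row_mx (lsubmx w *m A^T) (rsubmx w)) = F w.

Lemma ext_op_decay_first (R : realType) (m n : nat) :
  exists2 C : R, 0 <= C & forall (F : 'rV[R]_(m.+1 + n) -> R[i]) (x : 'rV[R]_(m.+1 + n)),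
    L2_sphere F -> first_invariant F ->
    (1 + enorm (lsubmx x)) ^+ m * cmod (ext_op F x) ^+ 2 <= C * L2norm F ^+ 2.
Proof.
have [C C0 HC] := ext_op_decay R n m; exists C => // F x LF iF.
have [LF' nF] := L2_sphere_swap LF.
rewrite -(ext_op_swap x LF) -nF.
have -> : lsubmx x = rsubmx (swap_row x) by rewrite /swap_row row_mxKr.
apply: HC => // B w oB w1; rewrite /swap_row row_mxKl row_mxKr.
rewrite -[RHS](iF B _ oB).
  by rewrite row_mxKl row_mxKr.
by rewrite -/(swap_row w) enorm_swap_row.
Qed.

Lemma Gk_invariant_blocks (R : realType) (m k : nat) (F : 'rV[R]_(m + k) -> R[i]) :
  G_invariant (Gk m k) F -> first_invariant F /\ last_invariant F.
Proof.
move=> H; have o1 j : orthmx (1%:M : 'M[R]_j) by rewrite /orthmx trmx1 mulmx1.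
have E (A : 'M[R]_m) (B : 'M[R]_k) (w : 'rV[R]_(m + k)) : orthmx A -> orthmx B -> enorm w = 1 ->
    F (row_mx (lsubmx w *m A^T) (rsubmx w *m B^T)) = F w.
  move=> oA oB w1; rewrite -[RHS](H (block_mx A 0 0 B) w)//; last by exists A, B.
  rewrite tr_block_mx !trmx0 -{3}(hsubmxK w) mul_row_block !mulmx0.
  by rewrite addr0 add0r.
split=> [A w oA w1|B w oB w1].
  by rewrite -[RHS](E A 1%:M w)// trmx1 mulmx1.
by rewrite -[RHS](E 1%:M B w)// trmx1 mulmx1.
Qed.

(** * Integration over the two horns *)

(** A nonnegative integral is a supremum over simple functions below the integrand, hence monotone
    for arbitrary functions. Thus the q-th power of the extension can be bounded by a measurable
    majorant without establishing its own measurability. *)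
Lemma ge0_le_integralT (d : measure_display) (T : measurableType d) (R : realType)
    (mu : {measure set T -> \bar R}) (f g : T -> \bar R) :
  (forall t, (0 <= f t)%E) -> (forall t, (f t <= g t)%E) ->
  (\int[mu]_t f t <= \int[mu]_t g t)%E.
Proof.
move=> f0 fg; have g0 t : (0 <= g t)%E by exact: le_trans (f0 t) (fg t).
rewrite !ge0_integralTE//; apply: ge_ereal_sup => _ [h hf <-]; apply: ereal_sup_ubound.
by exists h => // t; exact: le_trans (hf t) (fg t).
Qed.

Lemma le_iint (R : realType) (n : nat) (f g : 'rV[R]_n -> \bar R) :
  (forall t, (0 <= f t)%E) -> (forall t, (f t <= g t)%E) -> (iint n f <= iint n g)%E.
Proof.
have ge0 k (h : 'rV[R]_k -> \bar R) : (forall t, (0 <= h t)%E) -> (0 <= iint k h)%E.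
  elim: k h => [|k IH] h h0 /=; first exact: h0.
  by apply: integral_ge0 => t _; exact: IH.
elim: n f g => [|n IH] f g f0 fg /=; first exact: fg.
apply: ge0_le_integralT => t; first by apply: ge0 => v; exact: f0.
by apply: IH => v; [exact: f0|exact: fg].
Qed.

Lemma powR_cvgy_0 (R : realType) (d : R) : 0 < d -> r `^ (- d) @[r --> +oo] --> (0 : R).
Proof.
move=> d0; apply/cvgrPdist_le => e e0; near=> r.
have r0 : 0 < r by near: r; exact: nbhs_pinfty_gt.
rewrite sub0r normrN ger0_norm ?powR_ge0// powRN invf_ple ?posrE ?powR_gt0//.
have -> : e^-1 = (e^-1 `^ d^-1) `^ d by rewrite -powRrM mulVf ?gt_eqF// powRr1// invr_ge0 ltW.
apply: ge0_ler_powR; rewrite ?nnegrE ?powR_ge0 ?(ltW d0) ?(ltW r0)//.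
Unshelve. all: by end_near. Qed.

Lemma integral_powR_tail (R : realType) (d : R) : 0 < d ->
  (\int[leb R]_(r in `[1%R, +oo[) (r `^ (- 1 - d))%:E = (d^-1)%:E)%E.
Proof.
move=> d0.
have dn0 : d != 0 by rewrite gt_eqF.
have D (r : R) : 0 < r -> is_derive r 1 (fun r => - d^-1 * r `^ (- d)) (r `^ (- 1 - d)).
  move=> r0; have H := is_derive1_powR (- d) r0.
  have -> : (fun r => - d^-1 * r `^ (- d)) = (- d^-1) *: (fun r => r `^ (- d)) by [].
  have -> : r `^ (- 1 - d) = (- d^-1) *: (- d * r `^ (- d - 1)).
    by rewrite /GRing.scale /= mulrA mulrNN mulVf// mul1r addrC.
  exact: is_deriveZ.
have cF (r : R) : 0 < r -> {for r, continuous (fun r => - d^-1 * r `^ (- d))}.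
  by move=> r0; apply/differentiable_continuous/derivable1_diffP; case: (D r r0).
have cf (r : R) : 0 < r -> {for r, continuous (fun r => r `^ (- 1 - d))}.
  move=> r0; apply/differentiable_continuous/derivable1_diffP.
  by case: (is_derive1_powR (- 1 - d) r0).
rewrite (@ge0_continuous_FTC2y _ _ (fun r => - d^-1 * r `^ (- d)) 1 0).
- by rewrite powR1 mulr1 -EFinB sub0r opprK.
- by move=> r _; exact: powR_ge0.
- apply: continuous_in_subspaceT => r; rewrite inE /= in_itv/= andbT => r1.
  by apply: cf; exact: lt_le_trans r1.
- rewrite -[X in _ --> X](mulr0 (- d^-1)); apply: cvgM; first exact: cvg_cst.
  exact: powR_cvgy_0.
- by move=> r r1; case: (D r (lt_trans ltr01 r1)).
- by apply: cvg_at_right_filter; exact: cF.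
- by move=> r; rewrite in_itv/= andbT => r1; rewrite derive1E; case: (D r (lt_trans ltr01 r1)).
Qed.

(* The part [1 <= |v|] of [{ |u| <= b |v|^(-be) }], with weight [|v|^(-p)]. *)
Definition horn (R : realType) (b be p uu vv : R) : R :=
  (1 <= vv)%R%:R * vv `^ (- p) * (uu <= b * vv `^ (- be))%R%:R.

Lemma horn_ge0 (R : realType) (b be p uu vv : R) : 0 <= horn b be p uu vv.
Proof. by rewrite !mulr_ge0 ?powR_ge0. Qed.

Lemma measurable_le_indic (d : measure_display) (T : measurableType d) (R : realType)
    (f g : T -> R) : measurable_fun setT f -> measurable_fun setT g ->
  measurable_fun setT (fun t => (f t <= g t)%R%:R : R).
Proof.
move=> mf mg; rewrite [X in measurable_fun _ X](_ : _ = (fun t => if f t <= g t then 1 else 0)).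
  by apply: measurable_fun_ifT => //; exact: measurable_fun_ler.
by apply/funext => t; case: ifP.
Qed.

Lemma measurable_powR_comp (d : measure_display) (T : measurableType d) (R : realType)
    (f : T -> R) (p : R) : measurable_fun setT f ->
  measurable_fun setT (fun t => f t `^ p).
Proof. by move=> mf; exact: measurableT_comp (measurable_powR p) mf. Qed.

Lemma measurable_horn (d : measure_display) (T : measurableType d) (R : realType)
    (b be p : R) (u v : T -> R) : measurable_fun setT u -> measurable_fun setT v ->
  measurable_fun setT (fun t => horn b be p (u t) (v t)).
Proof.
move=> mu mv; apply: measurable_mul.
  apply: measurable_mul; last exact: measurable_powR_comp.
  by apply: measurable_le_indic; mfun.
by apply: measurable_le_indic => //; apply: measurable_mul; [mfun|exact: measurable_powR_comp].
Qed.

(** The slice at v has volume at most (2 b |v|^(-be))^m. In polar coordinates for v there remains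
    the integral of r^(k - p - be m) over r >= 1, and the hypothesis says that this exponent is
    below -1. *)
Lemma horn_integral_lty (R : realType) (m k : nat) (b be p : R) :
  0 <= b -> k.+1%:R - p - be * m%:R < 0 ->
  (\int[mun R k.+1]_v \int[mun R m]_u (horn b be p (enorm u) (enorm v))%:E < +oo)%E.
Proof.
move=> b0 kp; have [c c0 H] := integral_radial R k.
pose phi (r : measurableTypeR R) : \bar R :=
  ((1 <= r)%R%:R * r `^ (- p) * (2 * (b * r `^ (- be))) ^+ m)%:E.
have mphi : measurable_fun setT phi.
  apply: measurable_EFin_comp; apply: measurable_mul.
    apply: measurable_mul; last by apply: measurable_powR_comp; mfun.
    by apply: measurable_le_indic; mfun.
  apply: measurable_exprn; apply: measurable_mul; first by mfun.
  by apply: measurable_mul; [mfun|apply: measurable_powR_comp; mfun].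
have phi0 r : (0 <= phi r)%E.
  by rewrite lee_fin !mulr_ge0 ?powR_ge0// exprn_ge0// !mulr_ge0 ?powR_ge0.
apply: (@le_lt_trans _ _ (\int[mun R k.+1]_v phi (enorm v))%E).
  apply: ge0_le_integralT => v.
    by apply: integral_ge0 => u _; rewrite lee_fin horn_ge0.
  have B0 : 0 <= b * enorm v `^ (- be) by rewrite mulr_ge0 ?powR_ge0.
  rewrite [leLHS](_ : _ = ((1 <= enorm v)%R%:R * enorm v `^ (- p))%:E *
      \int[mun R m]_u ((enorm u <= b * enorm v `^ (- be))%R%:R)%:E)%E.
    rewrite /phi [leRHS]EFinM lee_wpmul2l//.
      by rewrite lee_fin mulr_ge0 ?powR_ge0.
    exact: mun_ball_lty.
  rewrite -ge0_integralZl.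
  - by apply: eq_integral => u _; rewrite /horn EFinM.
  - exact: measurableT.
  - by apply: measurable_EFin_comp; apply: measurable_le_indic; mfun.
  - by move=> u _; rewrite lee_fin.
  - by rewrite lee_fin mulr_ge0 ?powR_ge0.
rewrite (H phi mphi phi0).
(* Chosen so that the exponent k - p - be m equals -1 - d. *)
pose d := - (k.+1%:R - p - be * m%:R).
have d0 : 0 < d by rewrite /d oppr_gt0.
have mt : measurable_fun setT (fun r : measurableTypeR R =>
    ((r `^ (- 1 - d))%:E * (\1_(`[1%R, +oo[%classic : set R) r)%:E)%E).
  apply: measurable_emul; last by apply/measurable_EFinP; exact: measurable_indic.
  by apply: measurable_EFin_comp; apply: measurable_powR_comp; mfun.
rewrite (_ : (\int[leb R]_r _)%E = ((2 * b) ^+ m * d^-1)%:E); last first.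
  rewrite EFinM -(integral_powR_tail d0) [X in (_ * X)%E]integral_mkcond.
  transitivity (\int[leb R]_r (((2 * b) ^+ m)%:E * ((r `^ (- 1 - d))%:E * (\1_(`[1%R, +oo[%classic : set R) r)%:E)))%E.
    apply: eq_integral => r _; rewrite /phi /radial_weight indicE mem_setE in_itv/= andbT -!EFinM.
    congr EFin; case: (leP 1 r) => r1; last by rewrite !(mul0r, mulr0).
    have r0 : 0 < r by exact: lt_le_trans r1.
    have -> : (2 * (b * r `^ (- be))) ^+ m = (2 * b) ^+ m * r `^ (- be * m%:R).
      by rewrite mulrA exprMn powRrM powR_mulrn ?powR_ge0.
    have -> : r `^ (- 1 - d) = r `^ k%:R * r `^ (- p) * r `^ (- be * m%:R).
      rewrite -!powRD ?(gt_eqF r0) ?implybT//; congr (_ `^ _).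
      by rewrite /d -natr1; ring.
    by rewrite r0 (powR_mulrn k (ltW r0)) /=; ring.
  rewrite ge0_integralZl.
  - congr (_ * _)%E; apply: eq_integral => r _; rewrite patchE indicE.
    by case: ifP => _; rewrite ?mule1 ?mule0.
  - exact: measurableT.
  - exact: mt.
  - by move=> r _; rewrite mule_ge0// lee_fin ?powR_ge0// indicE.
  - by rewrite lee_fin exprn_ge0// mulr_ge0.
by rewrite -EFinM ltry.
Qed.

(** Each condition is a lower bound on q cleared of its denominator k-1 or m-1. For k = 1 or m = 1
    the denominator is 0 and q drops out; what remains is the hypothesis on alpha, 1 < al m or al <
    k. As m + k >= 3, the two cases exclude each other. *)
Lemma lambda_Nk_bounds (R : realType) (m k : nat) (al q : R) :
  (3 <= m + k)%N -> (0 < m)%N -> (0 < k)%N -> 0 < al ->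
  (k = 1%N -> 1 / ((m + k)%:R - 1) < al) ->
  (k = (m + k - 1)%N -> al < (m + k)%:R - 1) ->
  lambda_Nk (m + k) k al < q ->
  k%:R - (k%:R - 1) * q / 2 - al * m%:R < 0 /\
  m%:R - (m%:R - 1) * q / 2 - al^-1 * k%:R < 0.
Proof.
move=> N3 m0 k0 al0 H1 HN; rewrite /lambda_Nk natrD.
have mR : 1 <= m%:R :> R by rewrite ler1n.
have kR : 1 <= k%:R :> R by rewrite ler1n.
have aK : al * al^-1 = 1 by rewrite divff// gt_eqF.
have ai0 : 0 < al^-1 by rewrite invr_gt0.
case: eqVneq => [k1|kn1].
  have m2 : (2 <= m)%N by lia.
  have m2R : 2 <= m%:R :> R by rewrite (ler_nat R 2 m).
  have := H1 k1; rewrite natrD k1 ltr_pdivrMr; last by lra.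
  move=> A; rewrite ltr_pdivrMr; last by lra.
  by move=> B; split; lra.
case: eqVneq => [kN|knN].
  have m1 : m = 1%N by lia.
  have k2 : (2 <= k)%N by lia.
  have k2R : 2 <= k%:R :> R by rewrite (ler_nat R 2 k).
  have := HN kN; rewrite natrD m1 => A; rewrite ltr_pdivrMr; last by lra.
  move=> B; split; first by lra.
  have : al * al^-1 < k%:R * al^-1 by rewrite ltr_pM2r//; lra.
  by rewrite aK; lra.
have m2 : (2 <= m)%N by lia.
have m2R : 2 <= m%:R :> R by rewrite (ler_nat R 2 m).
have k2 : (2 <= k)%N by lia.
have k2R : 2 <= k%:R :> R by rewrite (ler_nat R 2 k).
rewrite gt_max => /andP[A B].
have m1p : 0 < m%:R - 1 :> R by lra.
have k1p : 0 < k%:R - 1 :> R by lra.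
move: A B; rewrite !ltr_pdivrMr//; last by lra.
move=> A B.
by split; lra.
Qed.

(** * Covering of [L_alpha] and the final estimate *)

Lemma decay_powR (R : realType) (n : nat) (C D H r q : R) :
  0 <= C -> 0 <= D -> 0 <= H -> 0 <= r -> 0 < q ->
  (1 + r) ^+ n * D ^+ 2 <= C * H ^+ 2 ->
  D `^ q <= (Num.sqrt C * H) `^ q * (1 + r) `^ (- (n%:R * q / 2)).
Proof.
move=> C0 D0 H0 r0 q0 E.
have r1 : 0 < 1 + r by rewrite ltr_pwDl.
have F : ((1 + r) ^+ n * D ^+ 2) `^ (q / 2) <= (C * H ^+ 2) `^ (q / 2).
  apply: ge0_ler_powR => //; rewrite ?nnegrE ?divr_ge0 ?(ltW q0)//.
    by rewrite mulr_ge0 ?sqr_ge0// exprn_ge0// ltW.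
  by rewrite mulr_ge0 ?sqr_ge0.
have sq2 (z : R) : 0 <= z -> (z ^+ 2) `^ (q / 2) = z `^ q.
  by move=> z0; rewrite -(powR_mulrn 2 z0) -powRrM; congr (_ `^ _); field.
have E2 : (C * H ^+ 2) `^ (q / 2) = (Num.sqrt C * H) `^ q.
  by rewrite -sq2 ?mulr_ge0 ?sqrtr_ge0// exprMn sqr_sqrtr.
have E1 : ((1 + r) ^+ n * D ^+ 2) `^ (q / 2) = (1 + r) `^ (n%:R * q / 2) * D `^ q.
  rewrite powRM ?exprn_ge0 ?(ltW r1) ?sqr_ge0// sq2// -(powR_mulrn n (ltW r1)) -powRrM.
  by rewrite mulrA.
by rewrite powRN ler_pdivlMr ?powR_gt0// mulrC -E1 -E2.
Qed.

Lemma powRN_1D_le (R : realType) (r p : R) :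
  1 <= r -> 0 <= p -> (1 + r) `^ (- p) <= r `^ (- p).
Proof.
move=> r1 p0; have rp : 0 < r by lra.
have r1p : 0 < 1 + r by lra.
rewrite !powRN lef_pV2 ?posrE ?powR_gt0//.
by apply: ge0_ler_powR => //; rewrite ?nnegrE ?(ltW rp) ?(ltW r1p)// lerDr.
Qed.

Lemma powRN_1D_le1 (R : realType) (r p : R) :
  0 <= r -> 0 <= p -> (1 + r) `^ (- p) <= 1.
Proof.
move=> r0 p0; have r1p : 0 < 1 + r by lra.
rewrite powRN invf_le1 ?powR_gt0//.
by rewrite -[leLHS](powRr0 (1 + r)) ler_powR// lerDl.
Qed.

(** D stands for the q-th power of the extension. The relation u <= a v^(-al) is the same as v <=
    a^(1/al) u^(-1/al), so the region beyond |u| = 1 is again a horn. On the horns 1 + r may be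
    replaced by r, and on the box the decay factors are at most 1. *)
Lemma L_alpha_cover (R : realType) (m k : nat) (a al : R) (p1 p2 D M : R) (x : 'rV[R]_(m + k)) :
  0 < a -> 0 < al -> 0 <= D -> 0 <= M -> 0 <= p1 -> 0 <= p2 -> L_alpha m k a al x ->
  D <= M * (1 + enorm (rsubmx x)) `^ (- p2) -> D <= M * (1 + enorm (lsubmx x)) `^ (- p1) ->
  D <= M * (horn a al p2 (enorm (lsubmx x)) (enorm (rsubmx x)) +
            (horn (a `^ al^-1) al^-1 p1 (enorm (rsubmx x)) (enorm (lsubmx x)) +
             (enorm (lsubmx x) <= 1)%R%:R * (enorm (rsubmx x) <= 1)%R%:R)).
Proof.
move=> a0 al0 D0 M0 p10 p20 Lx H2 H1.
set u := enorm (lsubmx x) in H1 *; set v := enorm (rsubmx x) in H2 *.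
have u0 : 0 <= u by exact: enorm_ge0.
have v0 : 0 <= v by exact: enorm_ge0.
have b0 : 0 <= (u <= 1)%R%:R * (v <= 1)%R%:R :> R by rewrite mulr_ge0.
have h1 := horn_ge0 a al p2 u v.
have h2 := horn_ge0 (a `^ al^-1) al^-1 p1 v u.
(* [powR] sends 0 to 0 for a nonzero exponent, so [L_alpha] contains the axis v = 0 by a separate
   clause; these points fall into the second horn or the box. *)
have Lxa : v = 0 \/ u <= a * v `^ (- al).
  by case: Lx => [z|]; [left; rewrite /v z /enorm /dotv big1 ?sqrtr0// => i _; rewrite mxE mul0r|right].
have [v1|v1] := leP 1 v.
  have uv : u <= a * v `^ (- al) by case: Lxa => // vz; move: v1; rewrite vz ler10.
  apply: le_trans H2 _; rewrite ler_wpM2l//.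
  apply: (@le_trans _ _ (horn a al p2 u v)); last by rewrite lerDl addr_ge0.
  by rewrite /horn v1 uv mul1r mulr1 powRN_1D_le.
have [u1|u1] := leP 1 u; last first.
  apply: le_trans H2 _; rewrite ler_wpM2l// (le_trans (powRN_1D_le1 v0 p20))//.
  by rewrite (ltW u1) (ltW v1) mulr1 addrA lerDr addr_ge0.
have vu : v <= a `^ al^-1 * u `^ (- al^-1).
  have up : 0 < u by exact: lt_le_trans u1.
  case: Lxa => [->|uv]; first by rewrite mulr_ge0 ?powR_ge0.
  have [vz|vn0] := eqVneq v 0; first by rewrite vz mulr_ge0 ?powR_ge0.
  have vp : 0 < v by rewrite lt_neqAle eq_sym vn0.
  have uv' : v `^ al <= a / u.
    by move: uv; rewrite powRN ler_pdivlMr ?powR_gt0// ler_pdivlMr// mulrC.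
  have -> : v = (v `^ al) `^ al^-1 by rewrite -powRrM mulfV ?gt_eqF// powRr1.
  have -> : a `^ al^-1 * u `^ (- al^-1) = (a / u) `^ al^-1.
    rewrite powRM ?invr_ge0 ?(ltW a0)//; congr (_ * _).
    by rewrite -(powR_inv1 u0) -powRrM mulN1r.
  apply: ge0_ler_powR; rewrite ?nnegrE ?invr_ge0 ?powR_ge0 ?(ltW al0)//.
  by rewrite divr_ge0 ?(ltW a0).
apply: le_trans H1 _; rewrite ler_wpM2l//.
apply: (@le_trans _ _ (horn (a `^ al^-1) al^-1 p1 v u)); last by rewrite addrCA lerDl addr_ge0.
by rewrite /horn u1 vu mul1r mulr1 powRN_1D_le.
Qed.

Definition L_alpha_majorant (R : realType) (m k : nat) (a al p1 p2 : R) (x : 'rV[R]_(m + k)) : R :=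
  horn a al p2 (enorm (lsubmx x)) (enorm (rsubmx x)) +
   (horn (a `^ al^-1) al^-1 p1 (enorm (rsubmx x)) (enorm (lsubmx x)) +
    (enorm (lsubmx x) <= 1)%R%:R * (enorm (rsubmx x) <= 1)%R%:R).

Lemma L_alpha_majorant_ge0 (R : realType) (m k : nat) (a al p1 p2 : R) (x : 'rV[R]_(m + k)) :
  0 <= L_alpha_majorant a al p1 p2 x.
Proof. by rewrite !addr_ge0 ?horn_ge0// mulr_ge0. Qed.

Lemma L_alpha_majorant_lty (R : realType) (m k : nat) (a al p1 p2 : R) :
  0 < a -> m.+1%:R - p1 - al^-1 * k.+1%:R < 0 -> k.+1%:R - p2 - al * m.+1%:R < 0 ->
  (iint (m.+1 + k.+1) (fun x => (L_alpha_majorant a al p1 p2 x)%:E) < +oo)%E /\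
  measurable_fun setT (fun x : rvT R (m.+1 + k.+1) => (L_alpha_majorant a al p1 p2 x)%:E).
Proof.
move=> a0 e1 e2.
pose h1 (x : 'rV[R]_(m.+1 + k.+1)) : \bar R := (horn a al p2 (enorm (lsubmx x)) (enorm (rsubmx x)))%:E.
pose h2 (x : 'rV[R]_(m.+1 + k.+1)) : \bar R := (horn (a `^ al^-1) al^-1 p1 (enorm (rsubmx x)) (enorm (lsubmx x)))%:E.
pose h3 (x : 'rV[R]_(m.+1 + k.+1)) : \bar R := ((enorm (lsubmx x) <= 1)%R%:R * (enorm (rsubmx x) <= 1)%R%:R)%:E.
have mh1 : measurable_fun setT (h1 : rvT R _ -> _).
  by apply: measurable_EFin_comp; apply: measurable_horn; mfun.
have mh2 : measurable_fun setT (h2 : rvT R _ -> _).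
  by apply: measurable_EFin_comp; apply: measurable_horn; mfun.
have mh3 : measurable_fun setT (h3 : rvT R _ -> _).
  apply: measurable_EFin_comp; apply: measurable_mul; apply: measurable_le1_indic; mfun.
have h10 x : (0 <= h1 x)%E by rewrite lee_fin horn_ge0.
have h20 x : (0 <= h2 x)%E by rewrite lee_fin horn_ge0.
have h30 x : (0 <= h3 x)%E by rewrite lee_fin mulr_ge0.
have mh23 : measurable_fun setT (fun x : rvT R (m.+1 + k.+1) => (h2 x + h3 x)%E).
  exact: emeasurable_funD.
have mh123 : measurable_fun setT (fun x : rvT R (m.+1 + k.+1) => (h1 x + (h2 x + h3 x))%E).
  exact: emeasurable_funD.
have sumE : (fun x : rvT R (m.+1 + k.+1) => (L_alpha_majorant a al p1 p2 x)%:E) =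
    (fun x => (h1 x + (h2 x + h3 x))%E).
  by apply/funext => x; rewrite /L_alpha_majorant !EFinD.
rewrite sumE; split => //.
rewrite iintE//; last by move=> x; rewrite !adde_ge0.
rewrite ge0_integralD//; last by move=> x _; rewrite adde_ge0.
rewrite ge0_integralD//.
have E2 (f : 'rV[R]_(m.+1 + k.+1) -> \bar R) (g : R -> R -> R) :
    measurable_fun setT (f : rvT R _ -> _) -> (forall x, (0 <= f x)%E) ->
    (forall x, f x = (g (enorm (lsubmx x)) (enorm (rsubmx x)))%:E) ->
    (\int[mun R (m.+1 + k.+1)]_x f x =
     \int[mun R m.+1]_u \int[mun R k.+1]_v (g (enorm u) (enorm v))%:E)%E.
  move=> mf f0 fg; rewrite (ge0_integral_mun_add mf f0).
  by apply: eq_integral => u _; apply: eq_integral => v _; rewrite fg row_mxKl row_mxKr.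
have fin1 : (\int[mun R (m.+1 + k.+1)]_x h1 x < +oo)%E.
  rewrite (E2 h1 (fun u v => horn a al p2 u v) mh1 h10)//.
  pose f (z : rvT R m.+1 * rvT R k.+1) : \bar R := (horn a al p2 (enorm z.1) (enorm z.2))%:E.
  have mf : measurable_fun setT f by apply: measurable_EFin_comp; apply: measurable_horn; mfun.
  have f0 z : (0 <= f z)%E by rewrite lee_fin horn_ge0.
  (* [horn_integral_lty] integrates the thin variable innermost; for [h1] this is the first block,
     whence the exchange. [h2] is already in that order. *)
  have FT := fubini_tonelli (m1 := mun R m.+1) (m2 := mun R k.+1) f mf f0.
  rewrite -[X in (X < _)%E]/(\int[mun R m.+1]_u \int[mun R k.+1]_v f (u, v))%E FT.
  exact: horn_integral_lty (ltW a0) e2.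
have fin2 : (\int[mun R (m.+1 + k.+1)]_x h2 x < +oo)%E.
  rewrite (E2 h2 (fun u v => horn (a `^ al^-1) al^-1 p1 v u) mh2 h20)//.
  exact: horn_integral_lty (powR_ge0 _ _) e1.
have fin3 : (\int[mun R (m.+1 + k.+1)]_x h3 x < +oo)%E.
  (* The product of the two unit balls lies in a ball of radius sqrt 2, hence of radius 2. *)
  apply: (@le_lt_trans _ _ (\int[mun R (m.+1 + k.+1)]_x ((enorm x <= 2)%R%:R)%:E)%E); last first.
    by apply: le_lt_trans (mun_ball_lty _ _) (ltry _).
  apply: ge0_le_integralT => // x; rewrite lee_fin.
  case: (leP (enorm (lsubmx x)) 1) => [l1|_]; last by rewrite mul0r.
  case: (leP (enorm (rsubmx x)) 1) => [r1|_]; last by rewrite mulr0.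
  suff -> : enorm x <= 2 by rewrite mulr1.
  rewrite enorm_row -[leRHS]ger0_norm// -sqrtr_sqr ler_sqrt ?sqr_ge0//.
  have := exprn_ile1 2 (enorm_ge0 _) l1; have := exprn_ile1 2 (enorm_ge0 _) r1.
  by lra.
apply: lte_add_pinfty; first exact: fin1.
by apply: lte_add_pinfty; [exact: fin2|exact: fin3].
Qed.

Lemma cmodM (R : realType) (y z : R[i]) : cmod (y * z) ^+ 2 = cmod y ^+ 2 * cmod z ^+ 2.
Proof. by rewrite !sqr_cmod; case: y => a b; case: z => c d /=; ring. Qed.

Lemma admissible_blocks (R : realType) (m k : nat) (a al q : R) :
  0 < a -> 0 < al -> 1 <= q ->
  k.+1%:R - (k.+1%:R - 1) * q / 2 - al * m.+1%:R < 0 ->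
  m.+1%:R - (m.+1%:R - 1) * q / 2 - al^-1 * k.+1%:R < 0 ->
  admissible (Gk m.+1 k.+1) q (@Q_alpha R m.+1 k.+1 a al).
Proof.
move=> a0 al0 q1 e2 e1; have q0 : 0 < q by lra.
have [C2 C20 H2] := ext_op_decay R m.+1 k.
have [C1 C10 H1] := ext_op_decay_first R m k.+1.
(* One constant for both decay estimates, as the covering uses a common factor. *)
pose C := C1 + C2.
have C0 : 0 <= C by rewrite addr_ge0.
pose p1 : R := m%:R * q / 2. pose p2 : R := k%:R * q / 2.
have p10 : 0 <= p1 by rewrite !mulr_ge0 ?invr_ge0 ?(ltW q0).
have p20 : 0 <= p2 by rewrite !mulr_ge0 ?invr_ge0 ?(ltW q0).
have [Ify mI] : (iint (m.+1 + k.+1) (fun x => (L_alpha_majorant a al p1 p2 x)%:E) < +oo)%E /\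
    measurable_fun setT (fun x : rvT R (m.+1 + k.+1) => (L_alpha_majorant a al p1 p2 x)%:E).
  apply: L_alpha_majorant_lty => //.
    by move: e1; rewrite -natr1 addrK.
  by move: e2; rewrite -natr1 addrK.
set I := iint _ _ in Ify.
have I0 : (0 <= I)%E.
  rewrite /I iintE//; last by move=> x; rewrite lee_fin L_alpha_majorant_ge0.
  by apply: integral_ge0 => x _; rewrite lee_fin L_alpha_majorant_ge0.
have IE : I = (fine I)%:E by rewrite fineK// ge0_fin_numE.
(* The first term is the q-th root of the factor in the estimate [B]; adding 1 makes the constant
   positive. *)
exists (Num.sqrt C * fine I `^ q^-1 + 1); split.
  apply: lt_le_trans ltr01 _; rewrite lerDr.
  by apply: mulr_ge0; [exact: sqrtr_ge0|exact: powR_ge0].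
move=> F LF /Gk_invariant_blocks[iF1 iF2].
pose H := L2norm F.
have HH : 0 <= H by exact: sqrtr_ge0.
have B : (iint (m.+1 + k.+1) (fun x => ((cmod (Q_alpha m.+1 k.+1 a al x * ext_op F x)%C) `^ q)%:E) <=
    ((Num.sqrt C * H) `^ q * fine I)%:E)%E.
  rewrite EFinM -IE.
  apply: (@le_trans _ _ (iint (m.+1 + k.+1) (fun x => (((Num.sqrt C * H) `^ q)%:E *
      (L_alpha_majorant a al p1 p2 x)%:E)%E))).
    apply: le_iint => x; first by rewrite lee_fin powR_ge0.
    rewrite -EFinM lee_fin.
    rewrite /Q_alpha; case: asboolP => [Lx|_]; last first.
      rewrite (_ : cmod _ = 0); last first.
        by apply/eqP; rewrite -sqrf_eq0 cmodM sqr_cmod /= !expr0n addr0 mul0r.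
      by rewrite powR0 ?gt_eqF// mulr_ge0 ?powR_ge0 ?L_alpha_majorant_ge0.
    have -> : cmod (1%:C * ext_op F x)%C = cmod (ext_op F x) by rewrite mul1r.
    have D0 := cmod_ge0 (ext_op F x).
    apply: L_alpha_cover => //; rewrite ?powR_ge0//.
      apply: decay_powR => //; first exact: enorm_ge0.
      apply: le_trans (H2 F x LF iF2) _.
      by rewrite ler_wpM2r ?sqr_ge0// lerDr.
    apply: decay_powR => //; first exact: enorm_ge0.
    apply: le_trans (H1 F x LF iF1) _.
    by rewrite ler_wpM2r ?sqr_ge0// lerDl.
  rewrite iintE; last 2 first.
  - by apply: measurable_emul; [mfun|exact: mI].
  - by move=> x; rewrite mule_ge0// lee_fin ?powR_ge0 ?L_alpha_majorant_ge0.
  rewrite ge0_integralZl; last 4 first.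
  - exact: measurableT.
  - exact: mI.
  - by move=> x _; rewrite lee_fin L_alpha_majorant_ge0.
  - by rewrite lee_fin powR_ge0.
  by rewrite /I iintE// => x; rewrite lee_fin L_alpha_majorant_ge0.
have B0 : (0 <= iint (m.+1 + k.+1) (fun x => ((cmod (Q_alpha m.+1 k.+1 a al x * ext_op F x)%C) `^ q)%:E))%E.
  rewrite -(_ : iint (m.+1 + k.+1) (fun=> 0%E) = 0%E); last first.
    by rewrite iintE//; exact: integral0.
  by apply: le_iint => // x; rewrite lee_fin powR_ge0.
have qi0 : 0 <= q^-1 by rewrite invr_ge0 ltW.
apply: le_trans (gt0_ler_poweR qi0 _ _ B) _.
- by rewrite in_itv/= B0 leey.
- by rewrite in_itv/= (le_trans B0 B) leey.
have fI0 : 0 <= fine I by rewrite fine_ge0.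
rewrite poweR_EFin lee_fin powRM ?powR_ge0// -powRrM mulfV ?gt_eqF// powRr1 ?mulr_ge0 ?sqrtr_ge0//.
rewrite mulrDl mul1r mulrAC -/H; lra.
Qed.

Unset Implicit Arguments.

Theorem theorem1p2 (R : realType) (N k : nat) (a alpha : R) :
  (3 <= N)%N -> (1 <= k <= N - 1)%N -> 0 < a -> 0 < alpha ->
  (k = 1%N -> 1 / (N%:R - 1) < alpha) ->
  (k = (N - 1)%N -> alpha < N%:R - 1) ->
  forall q : R, 1 <= q -> lambda_Nk N k alpha < q ->
    admissible (Gk (N - k) k) q (Q_alpha (N - k) k a alpha).
Proof.
move=> N3 /andP[k1 kN] a0 al0 H1 HN q q1 lq.
have NE : N = (N - k + k)%N by lia.
have m0 : (0 < N - k)%N by lia.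
(* With N - k generalized to m and N replaced by m + k, both block dimensions can be destructed as
   successors. *)
clear kN; move: (N - k)%N m0 NE => m m0 NE; subst N.
have [e2 e1] := lambda_Nk_bounds N3 m0 k1 al0 H1 HN lq.
case: m m0 e1 e2 {N3 H1 HN lq} => [//|m] _ e1 e2.
case: k k1 e1 e2 => [//|k] _ e1 e2.
exact: admissible_blocks.
Qed.
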